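(* Let $\omega$ be a radial weight and $0<p<\infty$. Assume there is $\rho_0\in[0,1)$ such that for every $\xi\in\mathbb{D}\setminus D(0,\rho_0)$ there exists $K_\xi\in\mathcal{H}(\mathbb{D})$ with: (i) $\|K_\xi\|_{A^p_\omega}=1$; (ii) $\lim_{|\xi|\to1^-}|K_\xi(z)|=0$ uniformly on compact subsets of $\mathbb{D}$; (iii) $\lim_{\xi\to\zeta}\int_{\mathbb{D}\setminus D(\zeta,\delta)}|K_\xi|^p\omega\,dA=0$ for every $\delta>0$ and $\zeta\in\mathbb{T}$. Let $g\in\mathcal{H}(\mathbb{D})$ and let $L_g$ be a $g$-operator written in the form \[L_g=\sum_{k=0}^NS_g^kT_gP_k(T_g)\Pi_0+S_gP_{N+1}(S_g)+P_{N+2}(g-g(0),g(0))\,\delta_0\] with $P_{N+1}\neq0$. Then $L_g$ is bounded on $A^p_\omega$ if and only if $g\in H^\infty$.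
   Context: $\mathbb{D}$ is the open unit disc, $\mathbb{T}$ the unit circle, $D(a,r)=\{z:|z-a|<r\}$, $\mathcal{H}(\mathbb{D})$ the analytic functions on $\mathbb{D}$, $H^\infty$ the bounded analytic functions, $dA=\frac{dx\,dy}{\pi}$. A radial weight is $\omega:\mathbb{D}\to[0,\infty)$ with $\omega(z)=\omega(|z|)$, $\int_0^1\omega<\infty$ and $\int_r^1\omega(s)ds>0$ for $r\in[0,1)$. $A^p_\omega=\{f\in\mathcal{H}(\mathbb{D}):\|f\|^p_{A^p_\omega}=\int_{\mathbb{D}}|f|^p\omega\,dA<\infty\}$. A linear map $L$ on $\mathcal{H}(\mathbb{D})$ is bounded on $A^p_\omega$ if $\sup\{\|Lf\|_{A^p_\omega}:f\in A^p_\omega,\|f\|=1\}<\infty$. $M_gf=fg$, $S_gf(z)=\int_0^zf'(\zeta)g(\zeta)d\zeta$, $T_gf(z)=\int_0^zf(\zeta)g'(\zeta)d\zeta$, $\Pi_0f=f-f(0)$, $\delta_0f=f(0)$. A $g$-operator is a finite linear combination (constant coefficients) of finite compositions of $M_g,S_g,T_g$; every $g$-operator can be written in the displayed form with one-variable polynomials $P_0,\dots,P_{N+1}$ and a two-variable polynomial $P_{N+2}$. *)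

(* Defs.v *)
From HB Require Import structures.
From mathcomp Require Import all_boot all_order all_algebra.
From mathcomp Require Import all_classical all_reals all_analysis.
From mathcomp Require Import complex.
Import Order.TTheory GRing.Theory Num.Theory.
Import numFieldNormedType.Exports.

Set Implicit Arguments.
Unset Strict Implicit.
Unset Printing Implicit Defensive.

Local Open Scope ring_scope.
Local Open Scope classical_set_scope.
Local Open Scope complex_scope.

Section Defs.
Variable R : realType.
Local Notation C := R[i].

Definition modc (z : C) : R := Num.sqrt (complex.Re z ^+ 2 + complex.Im z ^+ 2).

Definition udisc : set C := [set z | modc z < 1].

Definition holo (f : C -> C) : Prop :=
  forall z, modc z < 1 -> derivable (f : C^o -> C^o) z 1.

Definition cderiv (f : C -> C) : C -> C := fun z => 'D_1 (f : C^o -> C^o) z.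

Definition cint01 (h : R -> C) : C :=
  (Rintegral lebesgue_measure `[0, 1] (fun t => complex.Re (h t))) +i*
  (Rintegral lebesgue_measure `[0, 1] (fun t => complex.Im (h t))).

(* S_g f (z) = \int_0^z f'(ζ) g(ζ) dζ  (along the segment [0,z]) *)
Definition Sop (g : C -> C) (f : C -> C) : C -> C :=
  fun z => cint01 (fun t => cderiv f (t%:C * z) * g (t%:C * z) * z).

Definition Top (g : C -> C) (f : C -> C) : C -> C :=
  fun z => cint01 (fun t => f (t%:C * z) * cderiv g (t%:C * z) * z).

Definition Mop (g : C -> C) (f : C -> C) : C -> C := fun z => f z * g z.

Definition Pi0 (f : C -> C) : C -> C := fun z => f z - f 0.

Definition polyop (P : {poly C}) (A : (C -> C) -> (C -> C)) (f : C -> C) : C -> C :=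
  fun z => \sum_(j < size P) P`_j * iter j A f z.

Definition eval2 (Q : {poly {poly C}}) (x y : C) : C :=
  \sum_(j < size Q) (Q`_j).[y] * x ^+ j.

Definition gop (g : C -> C) (N : nat) (P : nat -> {poly C})
    (Q : {poly {poly C}}) (f : C -> C) : C -> C :=
  fun z =>
    \sum_(k < N.+1) iter k (Sop g) (Top g (polyop (P k) (Top g) (Pi0 f))) z
    + Sop g (polyop (P N.+1) (Sop g) f) z
    + eval2 Q (g z - g 0) (g 0) * f 0.

Definition to_c (u : R * R) : C := u.1 +i* u.2.

(* \int_E |f|^p ω dA with dA = dx dy / π, ω radial given by its profile w *)
Definition Aint (p : R) (w : R -> R) (E : set C) (f : C -> C) : \bar R :=
  ((pi^-1)%:E *
   \int[(@lebesgue_measure R \x @lebesgue_measure R)%E]_(u in to_c @^-1` E)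
      ((modc (f (to_c u))) `^ p * w (modc (to_c u)))%:E)%E.

Definition Apnorm (p : R) (w : R -> R) (f : C -> C) : \bar R :=
  ((Aint p w udisc f) `^ (p^-1))%E.

(* radial weight with profile w : [0,1) -> [0,∞), ω(z) = w(|z|) *)
Definition radial_weight (w : R -> R) : Prop :=
  (forall r, 0 <= r < 1 -> 0 <= w r) /\
  lebesgue_measure.-integrable `[0, 1[ (EFin \o w) /\
  (forall r, 0 <= r < 1 ->
     (0 < \int[lebesgue_measure]_(s in `[r, 1%R[) (w s)%:E)%E).

Definition test_kernels (p : R) (w : R -> R) (rho0 : R) (K : C -> C -> C) : Prop :=
  (forall xi, rho0 <= modc xi < 1 ->
     holo (K xi) /\ Apnorm p w (K xi) = 1%E) /\
  (forall E : set C^o, compact E -> E `<=` udisc ->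
     forall eps : R, 0 < eps -> exists r : R, r < 1 /\
       forall xi, rho0 <= modc xi < 1 -> r < modc xi ->
       forall z, E z -> modc (K xi z) < eps) /\
  (forall delta : R, 0 < delta -> forall zeta : C, modc zeta = 1 ->
     forall eps : R, 0 < eps -> exists eta : R, 0 < eta /\
       forall xi, rho0 <= modc xi < 1 -> modc (xi - zeta) < eta ->
       (Aint p w (udisc `\` [set z | (modc (z - zeta) < delta)%R]) (K xi)
          < eps%:E)%E).

Definition bounded_on_Ap (p : R) (w : R -> R)
    (L : (C -> C) -> (C -> C)) : Prop :=
  exists M : R, forall f : C -> C, holo f -> Apnorm p w f = 1%E ->
    (Apnorm p w (L f) <= M%:E)%E.

Definition Hinf (g : C -> C) : Prop :=
  holo g /\ exists M : R, forall z, modc z < 1 -> modc (g z) <= M.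

End Defs.

(* Main.v *)
(* All estimates are made circle by circle.  The integral means of [|f|^p] over circles
   are nondecreasing in the radius and, when [|g| <= M], those of [S_g f] are at most
   [C M^p] times those of [f]: for [p <= 2] this follows from the subharmonicity of a
   combination of powers of [|f|^2 + e] and [|f|^2 + |S_g f|^2 + e], and [p] is then doubled
   through [(S_g f)^2 = 2 S_g(f S_g f) - S_g(S_g(f^2))].  Since the weight is radial, bounded
   [g] give bounded operators.

   Conversely, writing [g_r(z) = g(r z)], the bound of [L_g] passes to [L_{g_m}], first for
   [|m|] close to [1] by rotation and dilation, then for every [m] by subharmonicity in
   [m].  As [g_r] is analytic across the circle, [T_{g_r}] sends the kernels [K_xi] to a null
   sequence when [xi] tends radially to [zeta], hence [L_{g_r} K_xi] equals
   [g_r P_{N+1}(g_r) K_xi] up to a null sequence.  The mass of [K_xi] concentrates at [zeta], so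
   [|g P_{N+1}(g)|] is bounded at [r zeta] independently of [r] and [zeta], and [g] is
   bounded because ['X * P N.+1] is not constant. *)

Require Import Defs.
From HB Require Import structures.
From mathcomp Require Import all_boot all_order all_algebra.
From mathcomp Require Import all_classical all_reals all_analysis.
From mathcomp Require Import measurable_realfun complex ring lra.
Import Order.TTheory GRing.Theory Num.Theory.
Import numFieldNormedType.Exports.
Set Implicit Arguments.
Unset Strict Implicit.
Unset Printing Implicit Defensive.
Local Open Scope ring_scope.
Local Open Scope classical_set_scope.
Local Open Scope complex_scope.

(** The obstacle to necessity is that [g] is not known to be bounded, so the summands of [gop] may
    be unbounded although their sum is bounded, and none can be discarded for [g] itself. For [g_r]
    each summand is bounded, but the estimate must come from [L_g], uniformly in [r]. Conjugation by
    a dilation would turn [L_{g_r} f] into [L_g] of [f(z / r)], which is not defined on the disc;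
    hence [f] is first shrunk to [f_rho], which works for [rho <= |m|], and smaller [m] are reached
    through Moebius maps sending [0] to [m], the mean over a circle near the boundary dominating the
    value at the centre. That [T_z] sends bounded, locally null sequences to null ones rests on the
    gain in [T_z (z^n h) = T_{z^(n+1)} h / (n + 1)]: the first [j] Taylor coefficients of the
    sequence tend to [0], and division by [z^j] costs, near the circle, a factor independent of [j].
    In the sufficiency part the restriction [p <= 2] comes from working with powers [p / 2 <= 1] of
    [|f|^2 + e], the shift [e] keeping these powers smooth at the zeros of [f]. *)

Lemma is_derive1P {K : numFieldType} (f : K^o -> K^o) (z l : K) :
  is_derive (z : K^o) 1 f (l : K^o) <->
  (forall e : K, 0 < e -> exists2 d : K, 0 < d &
     forall w, `|w - z| < d -> `|f w - f z - l * (w - z)| <= e * `|w - z|).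
Proof.
set q := fun h : K => h^-1 *: ((f (h *: (1 : K^o) + z) : K^o) - f z).
have qE h : q h = h^-1 * (f (h + z) - f z) by rewrite /q [h *: _]mulr1.
split=> [[df dl] e e0|H].
  have /cvgrPdist_le/(_ e e0) : q @ 0^' --> (l : K^o).
    by rewrite -dl; exact: df.
  rewrite near_withinE => /nbhs_ballP[d /= d0 dH].
  exists d => // w wz.
  have [->|wz0] := eqVneq w z; first by rewrite !subrr mulr0 subr0 normr0 mulr0.
  have wz1 : w - z != 0 by rewrite subr_eq0.
  have := dH (w - z); rewrite /= /ball/= sub0r normrN => /(_ wz wz1).
  rewrite qE subrK => h.
  have -> : f w - f z - l * (w - z) = - ((l - (w - z)^-1 * (f w - f z)) * (w - z)).
    by field.
  by rewrite normrN normrM ler_wpM2r.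
have ql : q @ 0^' --> (l : K^o).
  apply/cvgrPdist_le => e e0.
  have [d d0 dH] := H e e0.
  rewrite near_withinE; apply/nbhs_ballP; exists d => //= h.
  rewrite /ball/= sub0r normrN => hd h0.
  rewrite qE.
  have := dH (h + z); rewrite addrK => /(_ hd) dh.
  have -> : l - h^-1 * (f (h + z) - f z) = - (h^-1 * (f (h + z) - f z - l * h)).
    by field.
  rewrite normrN normrM normfV mulrC ler_pdivrMr ?normr_gt0//.
split; first by apply/cvg_ex; exists l.
by apply/cvg_lim => //.
Qed.

(** * Differential calculus of functions of a complex variable *)

Section Modulus.
Context {R : realType}.
Local Notation C := R[i].
Implicit Types (z w : C) (r : R).

Lemma modcE z : modc z = Normc.normc z. Proof. by case: z. Qed.

Lemma norm_modc z : `|z| = (modc z)%:C. Proof. by rewrite normc_def. Qed.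

Lemma modc_ge0 z : 0 <= modc z. Proof. exact: sqrtr_ge0. Qed.

Lemma modcM z w : modc (z * w) = modc z * modc w.
Proof. by rewrite !modcE Normc.normcM. Qed.

Lemma modcD z w : modc (z + w) <= modc z + modc w.
Proof. by rewrite !modcE le_normcD. Qed.

Lemma modcN z : modc (- z) = modc z.
Proof. by rewrite !modcE normcN. Qed.

Lemma modcB z w : modc (z - w) <= modc z + modc w.
Proof. by rewrite -(modcN w) modcD. Qed.

Lemma modc_dist z w : modc (z - w) = modc (w - z).
Proof. by rewrite -modcN opprB. Qed.

Lemma modc0 : modc (0 : C) = 0.
Proof. by rewrite modcE Normc.normc0. Qed.

Lemma modc1 : modc (1 : C) = 1.
Proof. by rewrite modcE Normc.normc1. Qed.

Lemma modc_real r : modc r%:C = `|r|.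
Proof. by rewrite /modc/= expr0n addr0 sqrtr_sqr. Qed.

Lemma modc_eq0 z : (modc z == 0) = (z == 0).
Proof.
apply/eqP/eqP => [|->]; last exact: modc0.
by rewrite modcE => /Normc.eq0_normc.
Qed.

Lemma modc_gt0 z : (0 < modc z) = (z != 0).
Proof. by rewrite lt_def modc_eq0 modc_ge0 andbT. Qed.

Lemma modcV z : modc z^-1 = (modc z)^-1.
Proof. by rewrite !modcE Normc.normcV. Qed.

Lemma modcX z n : modc (z ^+ n) = modc z ^+ n.
Proof. by elim: n => [|n ih]; rewrite ?expr0 ?modc1// !exprS modcM ih. Qed.

Lemma modcBB z w : modc z - modc w <= modc (z - w).
Proof. by rewrite lerBlDr -{1}(subrK w z) modcD. Qed.

Lemma modc_sqr z : modc z ^+ 2 = complex.Re z ^+ 2 + complex.Im z ^+ 2.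
Proof. by rewrite sqr_sqrtr// addr_ge0 ?sqr_ge0. Qed.

Lemma Re_le_modc z : `|complex.Re z| <= modc z.
Proof.
by rewrite -sqrtr_sqr /modc ler_wsqrtr// lerDl sqr_ge0.
Qed.

Lemma Im_le_modc z : `|complex.Im z| <= modc z.
Proof.
by rewrite -sqrtr_sqr /modc ler_wsqrtr// lerDr sqr_ge0.
Qed.

Lemma modc_le_ReIm z : modc z <= `|complex.Re z| + `|complex.Im z|.
Proof.
rewrite -(@ler_pXn2r _ 2) ?nnegrE ?modc_ge0 ?addr_ge0// modc_sqr sqrrD.
by rewrite !real_normK ?num_real// lerD2r lerDl mulrn_wge0// mulr_ge0.
Qed.

Lemma modcB_triangle (x y z : C) : modc (x - z) <= modc (x - y) + modc (y - z).
Proof. by rewrite -[x - z](subrKA y) modcD. Qed.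

Lemma ReD z w : complex.Re (z + w) = complex.Re z + complex.Re w.
Proof. by case: z w => [a b] []. Qed.
Lemma ImD z w : complex.Im (z + w) = complex.Im z + complex.Im w.
Proof. by case: z w => [a b] []. Qed.
Lemma ReN z : complex.Re (- z) = - complex.Re z.
Proof. by case: z. Qed.
Lemma ImN z : complex.Im (- z) = - complex.Im z.
Proof. by case: z. Qed.
Lemma ReM z w : complex.Re (z * w) = complex.Re z * complex.Re w - complex.Im z * complex.Im w.
Proof. by case: z w => [a b] []. Qed.
Lemma ImM z w : complex.Im (z * w) = complex.Re z * complex.Im w + complex.Im z * complex.Re w.
Proof. by case: z w => [a b] []. Qed.

Lemma complex_ext z w : complex.Re z = complex.Re w -> complex.Im z = complex.Im w -> z = w.
Proof. by case: z w => [a b] [c d]/= -> ->. Qed.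

End Modulus.

Section Calculus.
Context {R : realType}.
Local Notation C := R[i].
Implicit Types (f g : C -> C) (z w l : C) (c : R -> C) (t s : R).

(* [analytic], [der] and [ci] are opaque copies of [holo], [cderiv] and [cint01]:
   without them, failed unifications unfold limits and integrals. *)
Variant analytic f : Prop := Analytic of holo f.

Fact der_key : {D : (C -> C) -> C -> C | D = @cderiv R}.
Proof. by exists (@cderiv R). Qed.
Definition der := sval der_key.
Lemma derE : der = @cderiv R. Proof. exact: (svalP der_key). Qed.

Fact ci_key : {I : (R -> C) -> C | I = @cint01 R}.
Proof. by exists (@cint01 R). Qed.
Definition ci := sval ci_key.
Lemma ciE : ci = @cint01 R. Proof. exact: (svalP ci_key). Qed.

Lemma analyticE f : analytic f <-> holo f.
Proof. by split=> [[]|]. Qed.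

(** The norm of [C] takes its values in [C], whose order is partial. Continuity and
    differentiability are restated with the real modulus, so that all estimates take place in an
    ordered field, within reach of [lra]. *)
Definition ccont f z := forall e : R, 0 < e -> exists2 d : R, 0 < d &
  forall w, modc (w - z) < d -> modc (f w - f z) <= e.

Definition cder f z l := forall e : R, 0 < e -> exists2 d : R, 0 < d &
  forall w, modc (w - z) < d -> modc (f w - f z - l * (w - z)) <= e * modc (w - z).

Definition rcont c t := forall e : R, 0 < e -> exists2 d : R, 0 < d &
  forall s, `|s - t| < d -> modc (c s - c t) <= e.

Definition rder c t l := forall e : R, 0 < e -> exists2 d : R, 0 < d &
  forall s, `|s - t| < d -> modc (c s - c t - l * (s - t)%:C) <= e * `|s - t|.

Lemma gt0_complexP (e : C) : 0 < e -> exists2 r : R, 0 < r & e = r%:C.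
Proof.
move=> e0; have /complex_realP[k ek] : e \is Num.real by rewrite gtr0_real.
by exists k => //; move: e0; rewrite ek ltcR.
Qed.

Lemma cder_is_derive f z l : cder f z l <-> is_derive (z : C^o) 1 (f : C^o -> C^o) (l : C^o).
Proof.
rewrite is_derive1P; split=> H e e0.
  have [r r0 ->] := gt0_complexP e0.
  have [d d0 dH] := H r r0; exists d%:C; first by rewrite ltcR.
  move=> w; rewrite !norm_modc ltcR => /dH.
  by rewrite -rmorphM/= lecR.
have [|d d0 dH] := H e%:C; first by rewrite ltcR.
have [r r0 de] := gt0_complexP d0; exists r => // w wr.
have := dH w; rewrite !norm_modc de ltcR => /(_ wr).
by rewrite -rmorphM/= lecR.
Qed.

Lemma cder_cderiv f z l : cder f z l -> der f z = l.
Proof. rewrite derE. by move/cder_is_derive => [_ <-]. Qed.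

Lemma derivable_cder f z : derivable (f : C^o -> C^o) z 1 <-> cder f z (der f z).
Proof.
rewrite derE.
split=> [df|/cder_is_derive[]//].
by apply/cder_is_derive; split.
Qed.

Lemma holoP f : analytic f <-> forall z, modc z < 1 -> cder f z (der f z).
Proof. by rewrite analyticE; split=> H z z1; apply/derivable_cder/H. Qed.

Lemma holo_cder f f' : (forall z, modc z < 1 -> cder f z (f' z)) -> analytic f.
Proof. by move=> H; apply/holoP => z z1; rewrite (cder_cderiv (H z z1)); exact: H. Qed.

Lemma rder_ReIm c t l : rder c t l <->
  is_derive t 1 (fun t => complex.Re (c t)) (complex.Re l) /\ is_derive t 1 (fun t => complex.Im (c t)) (complex.Im l).
Proof.
rewrite !is_derive1P; split=> [H|[H1 H2] e e0].
  split=> e e0; have [d d0 dH] := H e e0; exists d => // w /dH; apply: le_trans.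
    apply: le_trans (Re_le_modc _); rewrite !(ReD,ReN,ReM)/=.
    by rewrite mulr0 subr0.
  apply: le_trans (Im_le_modc _); rewrite !(ImD,ImN,ImM)/=.
  by rewrite mulr0 add0r.
have e20 : 0 < e / 2 by rewrite divr_gt0.
have [d1 d10 H1'] := H1 _ e20; have [d2 d20 H2'] := H2 _ e20.
exists (Num.min d1 d2); first by rewrite lt_min d10.
move=> s; rewrite lt_min => /andP[/H1' a /H2' b].
apply: (le_trans (modc_le_ReIm _)).
rewrite !(ReD,ReN,ReM,ImD,ImN,ImM)/= mulr0 subr0 mulr0 add0r.
by apply: (le_trans (lerD a b)); rewrite -mulrDl -splitr.
Qed.

Lemma cder_cont f z l : cder f z l -> ccont f z.
Proof.
move=> H e e0; have [d d0 dH] := H 1 ltr01.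
have K : 0 < 1 + modc l by rewrite ltr_pwDl// modc_ge0.
exists (Num.min d (e / (1 + modc l))); first by rewrite lt_min d0 divr_gt0.
move=> w; rewrite lt_min ltr_pdivlMr// => /andP[/dH h1 h2].
have -> : f w - f z = (f w - f z - l * (w - z)) + l * (w - z) by rewrite subrK.
apply: (le_trans (modcD _ _)); rewrite modcM (le_trans _ (ltW h2))//.
by rewrite [leRHS]mulrDr mulr1 (mulrC (modc l)) lerD2r (le_trans h1)// mul1r.
Qed.

Lemma rder_cont c t l : rder c t l -> rcont c t.
Proof.
move=> H e e0; have [d d0 dH] := H 1 ltr01.
have K : 0 < 1 + modc l by rewrite ltr_pwDl// modc_ge0.
exists (Num.min d (e / (1 + modc l))); first by rewrite lt_min d0 divr_gt0.
move=> s; rewrite lt_min ltr_pdivlMr// => /andP[/dH h1 h2].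
have -> : c s - c t = (c s - c t - l * (s - t)%:C) + l * (s - t)%:C by rewrite subrK.
apply: (le_trans (modcD _ _)); rewrite modcM modc_real (le_trans _ (ltW h2))//.
by rewrite [leRHS]mulrDr mulr1 (mulrC (modc l)) lerD2r (le_trans h1)// mul1r.
Qed.

(* Both kinds of derivative are instances of differentiability along a
   parameter space mapped into [C], which lets the rules be proved once. *)
Definition gcont {T : Type} (m : T -> R) (k : T -> C) := forall e : R, 0 < e ->
  exists2 d : R, 0 < d & forall x, m x < d -> modc (k x) <= e.

Lemma gcontD {T : Type} (m : T -> R) (k1 k2 : T -> C) :
  gcont m k1 -> gcont m k2 -> gcont m (fun x => k1 x + k2 x).
Proof.
move=> H1 H2 e e0; have e20 : 0 < e / 2 by rewrite divr_gt0.
have [d1 d10 {}H1] := H1 _ e20; have [d2 d20 {}H2] := H2 _ e20.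
exists (Num.min d1 d2); first by rewrite lt_min d10.
move=> x; rewrite lt_min => /andP[/H1 a /H2 b].
by rewrite (le_trans (modcD _ _))// (splitr e) lerD.
Qed.

Lemma gcont_bM {T : Type} (m : T -> R) (k1 k2 : T -> C) (B d0 : R) : 0 < d0 ->
  (forall x, m x < d0 -> modc (k1 x) <= B) -> gcont m k2 -> gcont m (fun x => k1 x * k2 x).
Proof.
move=> d00 H1 H2 e e0.
have B0 : 0 < `|B| + 1 by rewrite ltr_pwDr.
have [|d d1 dH] := H2 (e / (`|B| + 1)); first by rewrite divr_gt0.
exists (Num.min d0 d); first by rewrite lt_min d00.
move=> x; rewrite lt_min => /andP[/H1 a /dH b].
rewrite modcM -(divfK (lt0r_neq0 B0) e) mulrC ler_pM ?modc_ge0//.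
by rewrite (le_trans a)// (le_trans (ler_norm _))// lerDl.
Qed.

Lemma gcont_ext {T : Type} (m : T -> R) (k1 k2 : T -> C) :
  k1 =1 k2 -> gcont m k1 -> gcont m k2.
Proof. by move=> E H e /H[d d0 dH]; exists d => // x /dH; rewrite E. Qed.

Lemma gcontM {T : Type} (m : T -> R) (k1 k2 : T -> C) (a b : C) :
  gcont m (fun x => k1 x - a) -> gcont m (fun x => k2 x - b) ->
  gcont m (fun x => k1 x * k2 x - a * b).
Proof.
move=> H1 H2.
apply: (@gcont_ext _ _ (fun x => (k1 x * (k2 x - b)) + b * (k1 x - a))) => [x|].
  by ring.
apply: gcontD.
  have [d d0 dH] := H1 1 ltr01.
  apply: (@gcont_bM _ _ _ _ (1 + modc a) d) => // x /dH h.
  by rewrite -(subrK a (k1 x)) (le_trans (modcD _ _))// lerD2r.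
by apply: (@gcont_bM _ _ _ _ (modc b) 1).
Qed.

Lemma gcont0 {T : Type} (m : T -> R) (k : T -> C) : (forall x, k x = 0) -> gcont m k.
Proof. by move=> k0 e e0; exists 1 => // x _; rewrite k0 modc0 ltW. Qed.

Lemma ccontD f g z : ccont f z -> ccont g z -> ccont (fun w => f w + g w) z.
Proof.
by move=> /gcontD H /H; apply: gcont_ext => w; rewrite opprD addrACA.
Qed.
Lemma ccontM f g z : ccont f z -> ccont g z -> ccont (fun w => f w * g w) z.
Proof. by move=> H1 H2; apply: gcontM. Qed.
Lemma ccont_cst (a : C) z : ccont (fun => a) z.
Proof. by apply: gcont0 => x; rewrite subrr. Qed.
Lemma ccont_id z : ccont id z.
Proof. by move=> e e0; exists e => // w /ltW. Qed.
Lemma ccontN f z : ccont f z -> ccont (fun w => - f w) z.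
Proof. by move=> H e /H[d d0 dH]; exists d => // w /dH; rewrite -opprD modcN. Qed.
Lemma ccontB f g z : ccont f z -> ccont g z -> ccont (fun w => f w - g w) z.
Proof. by move=> H1 /ccontN; exact: ccontD. Qed.

Lemma rcontD (c1 c2 : R -> C) t : rcont c1 t -> rcont c2 t -> rcont (fun s => c1 s + c2 s) t.
Proof.
by move=> /gcontD H /H; apply: gcont_ext => w; rewrite opprD addrACA.
Qed.
Lemma rcontM (c1 c2 : R -> C) t : rcont c1 t -> rcont c2 t -> rcont (fun s => c1 s * c2 s) t.
Proof. by move=> H1 H2; apply: gcontM. Qed.
Lemma rcont_cst (a : C) t : rcont (fun => a) t.
Proof. by apply: gcont0 => x; rewrite subrr. Qed.
Lemma rcontN c t : rcont c t -> rcont (fun s => - c s) t.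
Proof. by move=> H e /H[d d0 dH]; exists d => // w /dH; rewrite -opprD modcN. Qed.
Lemma rcontB (c1 c2 : R -> C) t : rcont c1 t -> rcont c2 t -> rcont (fun s => c1 s - c2 s) t.
Proof. by move=> H1 /rcontN; exact: rcontD. Qed.

Lemma rcont_comp f c t : ccont f (c t) -> rcont c t -> rcont (f \o c) t.
Proof.
move=> H1 H2 e e0; have [d d0 dH] := H1 e e0.
have [|d' d'0 d'H] := H2 (d / 2); first by rewrite divr_gt0.
exists d' => // s /d'H h; apply: dH; apply: le_lt_trans h _.
by rewrite ltr_pdivrMr// ltr_pMr// ltr1n.
Qed.

Lemma ccont_comp f g z : ccont f (g z) -> ccont g z -> ccont (f \o g) z.
Proof.
move=> H1 H2 e e0; have [d d0 dH] := H1 e e0.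
have [|d' d'0 d'H] := H2 (d / 2); first by rewrite divr_gt0.
exists d' => // s /d'H h; apply: dH; apply: le_lt_trans h _.
by rewrite ltr_pdivrMr// ltr_pMr// ltr1n.
Qed.

Lemma rder_eq c t l l' : rder c t l -> l = l' -> rder c t l'.
Proof. by move=> ? <-. Qed.
Lemma cder_eq f z l l' : cder f z l -> l = l' -> cder f z l'.
Proof. by move=> ? <-. Qed.

Lemma cderD f g z l m : cder f z l -> cder g z m -> cder (fun w => f w + g w) z (l + m).
Proof. by rewrite !cder_is_derive => H1 H2; exact: is_deriveD. Qed.
Lemma cderN f z l : cder f z l -> cder (fun w => - f w) z (- l).
Proof. by rewrite !cder_is_derive => H1; exact: is_deriveN. Qed.
Lemma cderB f g z l m : cder f z l -> cder g z m -> cder (fun w => f w - g w) z (l - m).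
Proof. by rewrite !cder_is_derive => H1 H2; exact: is_deriveB. Qed.
Lemma cder_cst a z : cder (fun => a) z 0.
Proof. by rewrite !cder_is_derive; exact: is_derive_cst. Qed.
Lemma cder_id z : cder id z 1.
Proof. by rewrite !cder_is_derive; exact: is_derive_id. Qed.
Lemma cderM f g z l m : cder f z l -> cder g z m -> cder (fun w => f w * g w) z (l * g z + f z * m).
Proof.
move=> H1 H2; rewrite cder_is_derive.
apply: is_derive_eq.
  apply: is_deriveM; apply/cder_is_derive; [exact: H1|exact: H2].
by rewrite addrC ![_ *: _]mulrC mulrC [m * _]mulrC.
Qed.
Lemma cderZ a f z l : cder f z l -> cder (fun w => a * f w) z (a * l).
Proof. by move=> H; have := cderM (cder_cst a z) H; rewrite mul0r add0r. Qed.
Lemma cderX n z : cder (fun w => w ^+ n) z (n%:R * z ^+ n.-1).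
Proof.
elim: n => [|n ih]; first by rewrite mul0r; under eq_fun do rewrite expr0; exact: cder_cst.
have := cderM (cder_id z) ih.
move/cder_eq => /(_ (n.+1%:R * z ^+ n)) h.
under eq_fun do rewrite exprS; apply: h.
case: n {ih} => [|n]/=; first by rewrite mul0r mulr0 addr0.
by rewrite -(natr1 n.+1) !exprS; ring.
Qed.

Lemma cder_ext f g z l (d0 : R) : 0 < d0 -> (forall w, modc (w - z) < d0 -> f w = g w) ->
  cder f z l -> cder g z l.
Proof.
move=> d00 fg H e e0; have [d d1 dH] := H e e0.
exists (Num.min d0 d); first by rewrite lt_min d00.
move=> w; rewrite lt_min => /andP[a /dH]; rewrite !fg//.
by rewrite subrr modc0.
Qed.

Lemma rderD (c1 c2 : R -> C) t l m : rder c1 t l -> rder c2 t m -> rder (fun s => c1 s + c2 s) t (l + m).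
Proof.
move=> H1 H2 e e0; have e20 : 0 < e / 2 by rewrite divr_gt0.
have [d1 d10 {}H1] := H1 _ e20; have [d2 d20 {}H2] := H2 _ e20.
exists (Num.min d1 d2); first by rewrite lt_min d10.
move=> s; rewrite lt_min => /andP[/H1 a /H2 b].
have -> : c1 s + c2 s - (c1 t + c2 t) - (l + m) * (s - t)%:C =
  (c1 s - c1 t - l * (s - t)%:C) + (c2 s - c2 t - m * (s - t)%:C) by ring.
by rewrite (le_trans (modcD _ _))// (splitr e) mulrDl lerD.
Qed.

Lemma rderZ a c t l : rder c t l -> rder (fun s => a * c s) t (a * l).
Proof.
move=> H e e0; have A : 0 < modc a + 1 by rewrite ltr_wpDl// modc_ge0.
have [|d d0 dH] := H (e / (modc a + 1)); first by rewrite divr_gt0.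
exists d => // s /dH h.
have -> : a * c s - a * c t - a * l * (s - t)%:C = a * (c s - c t - l * (s - t)%:C) by ring.
rewrite modcM (le_trans (ler_wpM2l (modc_ge0 _) h))//.
rewrite mulrA ler_wpM2r// mulrC -mulrA ler_piMr ?ltW//.
by rewrite mulrC ltr_pdivrMr// mul1r ltrDl.
Qed.

(** In the chain rule the error of the inner function is multiplied by the modulus [m] of the outer
    derivative; dividing by [1 + m] instead of [m] avoids the case [m = 0]. *)
Lemma half_frac_le (e m x : R) : 0 <= e -> 0 <= m -> 0 <= x ->
  m * (e / 2 / (1 + m) * x) <= e / 2 * x.
Proof.
move=> e0 m0 x0.
have -> : m * (e / 2 / (1 + m) * x) = (e / 2 * x) * (m / (1 + m)).
  by rewrite [m * _]mulrC -!mulrA; congr (_ * (_ * _)); rewrite [_^-1 * _]mulrCA !mulrA [LHS]mulrAC.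
rewrite ler_piMr//; first by rewrite mulr_ge0// divr_ge0.
by rewrite ler_pdivrMr ?ltr_pwDl// mul1r lerDr.
Qed.

Lemma rder_comp f c t l m : rder c t l -> cder f (c t) m -> rder (f \o c) t (m * l).
Proof.
move=> H1 H2 e e0.
have L : 0 < 1 + modc l by rewrite ltr_pwDl// modc_ge0.
have M : 0 < 1 + modc m by rewrite ltr_pwDl// modc_ge0.
have e1 : 0 < e / 2 / (1 + modc l) by rewrite !divr_gt0.
have e2 : 0 < e / 2 / (1 + modc m) by rewrite !divr_gt0.
have [d1 d10 D1] := H2 _ e1; have [d2 d20 D2] := H1 _ e2.
(* Tolerance [1] gives a Lipschitz bound for [c] near [t], with constant [1 + modc l]. *)
have [d3 d30 D3] := H1 _ ltr01.
exists (Num.min (Num.min d2 d3) (d1 / (1 + modc l))).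
  by rewrite !lt_min d20 d30 divr_gt0.
move=> s; rewrite !lt_min ltr_pdivlMr// => /andP[/andP[/D2 a /D3 b] c1].
have cc : modc (c s - c t) <= (1 + modc l) * `|s - t|.
  have -> : c s - c t = (c s - c t - l * (s - t)%:C) + l * (s - t)%:C by rewrite subrK.
  by rewrite (le_trans (modcD _ _))// modcM modc_real mulrDl lerD2r.
have /D1 h : modc (c s - c t) < d1 by rewrite (le_lt_trans cc)// mulrC.
rewrite /=.
have -> : f (c s) - f (c t) - m * l * (s - t)%:C =
  (f (c s) - f (c t) - m * (c s - c t)) + m * (c s - c t - l * (s - t)%:C) by ring.
rewrite (le_trans (modcD _ _))// (splitr e) mulrDl lerD//.
  apply: (le_trans h); apply: (le_trans (ler_wpM2l (ltW e1) cc)).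
  by rewrite mulrA divfK ?lt0r_neq0.
rewrite modcM (le_trans (ler_wpM2l (modc_ge0 _) a))//.
by rewrite half_frac_le ?modc_ge0// ltW.
Qed.

Lemma cder_comp f g z l m : cder g z l -> cder f (g z) m -> cder (f \o g) z (m * l).
Proof.
move=> H1 H2 e e0.
have L : 0 < 1 + modc l by rewrite ltr_pwDl// modc_ge0.
have M : 0 < 1 + modc m by rewrite ltr_pwDl// modc_ge0.
have e1 : 0 < e / 2 / (1 + modc l) by rewrite !divr_gt0.
have e2 : 0 < e / 2 / (1 + modc m) by rewrite !divr_gt0.
have [d1 d10 D1] := H2 _ e1; have [d2 d20 D2] := H1 _ e2.
have [d3 d30 D3] := H1 _ ltr01.
exists (Num.min (Num.min d2 d3) (d1 / (1 + modc l))).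
  by rewrite !lt_min d20 d30 divr_gt0.
move=> s; rewrite !lt_min ltr_pdivlMr// => /andP[/andP[/D2 a /D3 b] c1].
have cc : modc (g s - g z) <= (1 + modc l) * modc (s - z).
  have -> : g s - g z = (g s - g z - l * (s - z)) + l * (s - z) by rewrite subrK.
  by rewrite (le_trans (modcD _ _))// modcM mulrDl lerD2r.
have /D1 h : modc (g s - g z) < d1 by rewrite (le_lt_trans cc)// mulrC.
rewrite /=.
have -> : f (g s) - f (g z) - m * l * (s - z) =
  (f (g s) - f (g z) - m * (g s - g z)) + m * (g s - g z - l * (s - z)) by ring.
rewrite (le_trans (modcD _ _))// (splitr e) mulrDl lerD//.
  apply: (le_trans h); apply: (le_trans (ler_wpM2l (ltW e1) cc)).
  by rewrite mulrA divfK ?lt0r_neq0.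
rewrite modcM (le_trans (ler_wpM2l (modc_ge0 _) a))//.
by rewrite half_frac_le ?modc_ge0// ltW.
Qed.

Lemma cderV z : z != 0 -> cder (fun w => w^-1) z (- z^-2).
Proof.
rewrite -modc_gt0 => z0 e e0.
(* The first entry gives [|w| >= |z| / 2]; together with the second, [|w - z| <= e |z|^2 |w|], as
   required by the exact remainder [(w - z)^2 / (z^2 w)]. *)
pose d := Num.min (modc z / 2) (e * modc z ^+ 3 / 2).
exists d; first by rewrite lt_min !divr_gt0// mulr_gt0// exprn_gt0.
move=> w; rewrite /d lt_min => /andP[w1 w2].
have wz : modc z / 2 <= modc w.
  have := modcBB z w; rewrite modc_dist => h; have := splitr (modc z); lra.
have w0 : 0 < modc w by apply: lt_le_trans wz; rewrite divr_gt0.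
have zn : z != 0 by rewrite -modc_gt0.
have wn : w != 0 by rewrite -modc_gt0.
have -> : w^-1 - z^-1 - - z^-2 * (w - z) = (w - z) * (w - z) / (z ^+ 2 * w).
  by field; rewrite zn wn.
rewrite -mulrA modcM mulrC ler_wpM2r ?modc_ge0// modcM modcV modcM modcX.
rewrite ler_pdivrMr ?mulr_gt0 ?exprn_gt0//.
apply: (le_trans (ltW w2)).
have -> : e * modc z ^+ 3 / 2 = e * (modc z ^+ 2 * (modc z / 2)) by field.
by apply: ler_wpM2l; [exact: ltW|apply: ler_wpM2l => //; rewrite exprn_ge0 ?ltW].
Qed.

Lemma holo_cont f z : analytic f -> modc z < 1 -> ccont f z.
Proof. by move=> /holoP H /H; exact: cder_cont. Qed.

End Calculus.

(** * Integrals over the unit interval *)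

Section RealIntegral.
Context {R : realType}.
Implicit Types (f F : R -> R).
Local Notation mu := (@lebesgue_measure R).

Definition rdiff F (t l : R) : Prop := is_derive t 1 F l.

(** Retraction of the line onto [[0, 1]]: composing with it turns continuity at the points of
    [[0, 1]] into continuity everywhere. *)
Definition clamp (t : R) : R := Num.max 0 (Num.min 1 t).

Lemma clamp_bnd t : 0 <= clamp t <= 1.
Proof. by rewrite /clamp le_max lexx/= ge_max ler01 ge_min lexx. Qed.

Lemma clamp_id t : 0 <= t <= 1 -> clamp t = t.
Proof.
by move=> /andP[t0 t1]; rewrite /clamp (min_idPr t1) (max_idPr t0).
Qed.

Lemma clamp_cont t : {for t, continuous clamp}.
Proof.
apply: (@continuous_max R R (fun=> 0) (fun t => Num.min 1 t)); first exact: cvg_cst.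
by apply: (@continuous_min R R (fun=> 1) id); [exact: cvg_cst|exact: cvg_id].
Qed.

Lemma clamp_comp_cont f : (forall t : R, 0 <= t <= 1 -> {for t, continuous f}) ->
  continuous (f \o clamp).
Proof.
move=> cf t; apply: continuous_comp; first exact: clamp_cont.
by apply: cf; exact: clamp_bnd.
Qed.

Lemma within01_cont f : (forall t : R, 0 <= t <= 1 -> {for t, continuous f}) ->
  {within `[0, 1], continuous f}.
Proof.
move=> cf; apply: continuous_in_subspaceT => t.
by rewrite inE/= in_itv/=; exact: cf.
Qed.

Lemma Rintegral01_FTC f F : (forall t : R, 0 <= t <= 1 -> {for t, continuous f}) ->
  (forall t : R, 0 <= t <= 1 -> rdiff F t (f t)) ->
  Rintegral mu `[0, 1] f = F 1 - F 0.
Proof.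
move=> cf dF; rewrite /Rintegral (@continuous_FTC2 _ f F 0 1)//.
- exact: within01_cont.
- have cF t : 0 <= t <= 1 -> {for t, continuous F}.
    by move=> /dF[d _]; exact/differentiable_continuous/derivable1_diffP.
  split.
  + by move=> t; rewrite in_itv/= => /andP[a b]; have [] := dF t; rewrite ?ltW.
  + by apply: cvg_at_right_filter; apply: cF; rewrite lexx ler01.
  + by apply: cvg_at_left_filter; apply: cF; rewrite lexx ler01.
- move=> t; rewrite in_itv/= => /andP[a b]; have [] := dF t; rewrite ?ltW//.
  by move=> _ <-; rewrite derive1E.
Qed.

(** The integrand extended by [clamp] is integrated from [-1], inside [[-1, 2]], so that [0] and [1]
    are interior points and the derivative there is two-sided. *)
Lemma continuous_primitive01 f : (forall t : R, 0 <= t <= 1 -> {for t, continuous f}) ->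
  exists F, forall t : R, 0 <= t <= 1 -> rdiff F t (f t).
Proof.
move=> /clamp_comp_cont cf.
exists (fun x => (\int[mu]_(t in `[-1, x]) (f \o clamp) t)%R) => t t01.
have [||||d e] := @continuous_FTC1_closed _ (f \o clamp) (-1) t 2.
- by move/andP: t01 => [_ t1]; rewrite (le_lt_trans t1)// ltr1n.
- apply: continuous_compact_integrable; first exact: segment_compact.
  exact: continuous_subspaceT.
- by move/andP: t01 => [t0 _]; rewrite (lt_le_trans _ t0)// ltrN10.
- exact: cf.
split => //; rewrite -derive1E e /= clamp_id//.
Qed.

Lemma integrable01 f : (forall t : R, 0 <= t <= 1 -> {for t, continuous f}) ->
  mu.-integrable `[0, 1] (EFin \o f).
Proof.
move=> cf; apply: continuous_compact_integrable; first exact: segment_compact.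
exact: within01_cont.
Qed.

Lemma le_Rintegral01 f g : (forall t : R, 0 <= t <= 1 -> {for t, continuous f}) ->
  (forall t : R, 0 <= t <= 1 -> {for t, continuous g}) ->
  (forall t : R, 0 <= t <= 1 -> f t <= g t) ->
  Rintegral mu `[0, 1] f <= Rintegral mu `[0, 1] g.
Proof.
move=> cf cg fg; apply: le_Rintegral; [by []|exact: (integrable01 cf)|exact: (integrable01 cg)|].
by move=> t; rewrite /= in_itv/=; exact: fg.
Qed.

Lemma Rintegral01_cst (a : R) : Rintegral mu `[0, 1] (fun=> a) = a.
Proof.
rewrite (@Rintegral01_FTC _ (fun t => a * t)) ?mulr1 ?mulr0 ?subr0//.
  by move=> t _; exact: cvg_cst.
by move=> t _; apply: is_derive_eq; rewrite [_ *: _]mulr1.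
Qed.

Lemma Rintegral01_bound f (B : R) : (forall t : R, 0 <= t <= 1 -> {for t, continuous f}) ->
  (forall t : R, 0 <= t <= 1 -> `|f t| <= B) -> `|Rintegral mu `[0, 1] f| <= B.
Proof.
move=> cf fB; rewrite ler_norml -(Rintegral01_cst B) -(Rintegral01_cst (- Rintegral mu `[0, 1] (fun=> B))).
rewrite [X in (fun => - X)]Rintegral01_cst.
apply/andP; split; apply: le_Rintegral01 => //; try by move=> t _; exact: cvg_cst.
  by move=> t /fB; rewrite ler_norml => /andP[].
by move=> t /fB; rewrite ler_norml => /andP[].
Qed.

Lemma eq_Rintegral01 f g : (forall t : R, 0 <= t <= 1 -> f t = g t) ->
  Rintegral mu `[0, 1] f = Rintegral mu `[0, 1] g.
Proof.
by move=> fg; apply: eq_Rintegral => t; rewrite inE/= in_itv/=; exact: fg.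
Qed.

End RealIntegral.

(** * Integrals of complex-valued functions of a real parameter *)

Section ComplexIntegral.
Context {R : realType}.
Local Notation C := R[i].
Implicit Types (c h H : R -> C).

Lemma rcont_ReIm c t : rcont c t <->
  {for t, continuous (fun s => complex.Re (c s))} /\ {for t, continuous (fun s => complex.Im (c s))}.
Proof.
split=> [H|[/cvgrPdist_le H1 /cvgrPdist_le H2] e e0].
  split; apply/cvgrPdist_le => e e0; have [d d0 dH] := H e e0.
    apply/nbhs_ballP; exists d => //= s; rewrite /ball/= distrC => /dH.
    rewrite distrC -ReN -ReD; apply: le_trans; exact: Re_le_modc.
  apply/nbhs_ballP; exists d => //= s; rewrite /ball/= distrC => /dH.
  rewrite distrC -ImN -ImD; apply: le_trans; exact: Im_le_modc.
have e20 : 0 < e / 2 by rewrite divr_gt0.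
have /nbhs_ballP[d1 /= d10 D1] := H1 _ e20; have /nbhs_ballP[d2 /= d20 D2] := H2 _ e20.
exists (Num.min d1 d2); first by rewrite lt_min d10.
move=> s; rewrite lt_min => /andP[s1 s2].
rewrite (le_trans (modc_le_ReIm _))// (splitr e) lerD//.
  by rewrite ReD ReN distrC; apply: D1; rewrite /ball/= distrC.
by rewrite ImD ImN distrC; apply: D2; rewrite /ball/= distrC.
Qed.

Definition cont01 c := forall t : R, 0 <= t <= 1 -> rcont c t.

Lemma cint01_FTC h H : cont01 h -> (forall t : R, 0 <= t <= 1 -> rder H t (h t)) ->
  ci h = H 1 - H 0.
Proof.
move=> ch dH; rewrite ciE /cint01.
rewrite (@Rintegral01_FTC _ _ (fun t => complex.Re (H t))); last 2 first.
- by move=> t /ch /rcont_ReIm[].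
- by move=> t /dH /rder_ReIm[].
rewrite (@Rintegral01_FTC _ _ (fun t => complex.Im (H t))); last 2 first.
- by move=> t /ch /rcont_ReIm[].
- by move=> t /dH /rder_ReIm[].
by apply: complex_ext; rewrite !(ReD,ReN,ImD,ImN).
Qed.

Lemma cprimitive01 h : cont01 h -> exists H, forall t : R, 0 <= t <= 1 -> rder H t (h t).
Proof.
move=> ch.
have [|F1 H1] := @continuous_primitive01 _ (fun t => complex.Re (h t)).
  by move=> t /ch /rcont_ReIm[].
have [|F2 H2] := @continuous_primitive01 _ (fun t => complex.Im (h t)).
  by move=> t /ch /rcont_ReIm[].
exists (fun t => F1 t +i* F2 t) => t t01; apply/rder_ReIm => /=.
by split; [exact: H1|exact: H2].
Qed.

Lemma eq_cint01 h1 h2 : (forall t : R, 0 <= t <= 1 -> h1 t = h2 t) -> ci h1 = ci h2.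
Proof.
by move=> H; rewrite ciE /cint01; congr (_ +i* _); apply: eq_Rintegral01 => t /H ->.
Qed.

(** The factor [2] is the price of bounding the real and imaginary parts separately. *)
Lemma cint01_bound h (B : R) : cont01 h -> (forall t : R, 0 <= t <= 1 -> modc (h t) <= B) ->
  modc (ci h) <= 2 * B.
Proof.
move=> ch hB; rewrite ciE (le_trans (modc_le_ReIm _))// mulr2n mulrDl mul1r lerD//.
  apply: Rintegral01_bound => t t01; first by have /rcont_ReIm[] := ch t t01.
  by rewrite (le_trans (Re_le_modc _))// hB.
apply: Rintegral01_bound => t t01; first by have /rcont_ReIm[] := ch t t01.
by rewrite (le_trans (Im_le_modc _))// hB.
Qed.

(** Linearity is read off primitives, without returning to real and imaginary parts. *)
Lemma cint01D h1 h2 : cont01 h1 -> cont01 h2 ->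
  ci (fun t => h1 t + h2 t) = ci h1 + ci h2.
Proof.
move=> c1 c2; have [H1 d1] := cprimitive01 c1; have [H2 d2] := cprimitive01 c2.
rewrite (cint01_FTC c1 d1) (cint01_FTC c2 d2).
rewrite (@cint01_FTC _ (fun t => H1 t + H2 t)); first by ring.
  by move=> t t01; apply: rcontD; [exact: c1|exact: c2].
by move=> t t01; apply: rderD; [exact: d1|exact: d2].
Qed.

Lemma cint01Z a h : cont01 h -> ci (fun t => a * h t) = a * ci h.
Proof.
move=> c1; have [H1 d1] := cprimitive01 c1.
rewrite (cint01_FTC c1 d1) (@cint01_FTC _ (fun t => a * H1 t)); first by ring.
  by move=> t t01; apply: rcontM; [exact: rcont_cst|exact: c1].
by move=> t t01; apply: rderZ; exact: d1.
Qed.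

Lemma cint01B h1 h2 : cont01 h1 -> cont01 h2 ->
  ci (fun t => h1 t - h2 t) = ci h1 - ci h2.
Proof.
move=> c1 c2; rewrite -[- ci h2]mulN1r -cint01Z// -cint01D//.
  by apply: eq_cint01 => t _; rewrite mulN1r.
by move=> t t01; apply: rcontM; [exact: rcont_cst|exact: c2].
Qed.

Lemma cint01_cst (a : C) : ci (fun=> a) = a.
Proof. by rewrite ciE /cint01 !Rintegral01_cst; case: a. Qed.

Lemma rder_affine (a b : C) t : rder (fun s => a + s%:C * b) t b.
Proof.
move=> e e0; exists 1 => // s _; rewrite opprD addrACA subrr add0r -mulrBl -rmorphB/=.
by rewrite mulrC subrr modc0 mulr_ge0// ltW.
Qed.

Lemma rder_comp_real (c : R -> C) (a b t : R) l :
  rder c (a + t * b) l -> rder (fun s => c (a + s * b)) t (l * b%:C).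
Proof.
move=> H e e0; have [|d d0 dH] := H (e / (`|b| + 1)); first by rewrite divr_gt0// ltr_wpDl.
have b1 : 0 < `|b| + 1 by rewrite ltr_wpDl.
exists (d / (`|b| + 1)); first by rewrite divr_gt0.
move=> s; rewrite ltr_pdivlMr// => st.
have ab : a + s * b - (a + t * b) = (s - t) * b by ring.
have := dH (a + s * b); rewrite ab normrM => h.
rewrite -mulrA -rmorphM/= [b * _]mulrC.
apply: (le_trans (h _)).
  by rewrite (le_lt_trans _ st)// ler_wpM2l// lerDl.
rewrite [_ * `|b|]mulrC mulrA ler_wpM2r// -mulrA ler_piMr ?ltW//.
by rewrite mulrC ltr_pdivrMr// mul1r ltrDl.
Qed.

Lemma rcont_comp_real (c : R -> C) (a b t : R) :
  rcont c (a + t * b) -> rcont (fun s => c (a + s * b)) t.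
Proof.
move=> H e e0; have [d d0 dH] := H e e0.
have b1 : 0 < `|b| + 1 by rewrite ltr_wpDl.
exists (d / (`|b| + 1)); first by rewrite divr_gt0.
move=> s; rewrite ltr_pdivlMr// => st; apply: dH.
have -> : a + s * b - (a + t * b) = (s - t) * b by ring.
by rewrite normrM (le_lt_trans _ st)// ler_wpM2l// lerDl.
Qed.

(** Bisection of the parameter interval, needed to cut the sides of a triangle at their
    midpoints. *)
Lemma cint01_halves h : cont01 h ->
  ci h = 2^-1 * (ci (fun t => h (0 + t * 2^-1)) + ci (fun t => h (2^-1 + t * 2^-1))).
Proof.
move=> ch; have [H d] := cprimitive01 ch.
have h1 t : 0 <= t <= 1 -> 0 <= 0 + t * 2^-1 <= (1:R) by move=> ?; lra.
have h2 t : 0 <= t <= 1 -> 0 <= 2^-1 + t * 2^-1 <= (1:R) by move=> ?; lra.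
have E1 t : rder H t (h t) -> rder (fun s => 2 * H s) t (2 * h t) by exact: rderZ.
have k : (2 : C) * (2^-1 : R)%:C = 1 by rewrite -[2]/(2%:R) -(rmorph_nat (real_complex R)) -rmorphM/= divff.
rewrite (cint01_FTC ch d).
rewrite (@cint01_FTC _ (fun t => 2 * H (0 + t * 2^-1))); last 2 first.
- by move=> t t01; apply: rcont_comp_real; apply: ch; exact: h1.
- move=> t t01; have := rderZ 2 (rder_comp_real (d _ (h1 _ t01))).
  by move/rder_eq; apply; rewrite mulrCA k mulr1.
rewrite (@cint01_FTC _ (fun t => 2 * H (2^-1 + t * 2^-1))); last 2 first.
- by move=> t t01; apply: rcont_comp_real; apply: ch; exact: h2.
- move=> t t01; have := rderZ 2 (rder_comp_real (d _ (h2 _ t01))).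
  by move/rder_eq; apply; rewrite mulrCA k mulr1.
have -> : 2^-1 + 1 * 2^-1 = 1 :> R by lra.
have -> : 2^-1 + 0 * 2^-1 = 2^-1 :> R by lra.
have -> : 0 + 1 * 2^-1 = 2^-1 :> R by lra.
have -> : 0 + 0 * 2^-1 = 0 :> R by lra.
by field.
Qed.

End ComplexIntegral.

(** * Goursat's theorem and primitives *)

Section Goursat.
Context {R : realType}.
Local Notation C := R[i].
Implicit Types (f g F : C -> C) (a b c z w : C).

(** The intervals of centre [u n] and radius [e n] are nested; the supremum of their left endpoints
    lies in all of them. *)
Lemma nested_limit (u e : nat -> R) : (forall n, 0 <= e n) ->
  (forall n, `|u n.+1 - u n| <= e n - e n.+1) -> exists x, forall n, `|u n - x| <= e n.
Proof.
move=> e0 ue.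
have mono n k : u n - e n <= u (n + k)%N - e (n + k)%N /\
                u (n + k)%N + e (n + k)%N <= u n + e n.
  elim: k => [|k [i1 i2]]; first by rewrite addn0.
  rewrite addnS; have := ue (n + k)%N; rewrite ler_norml => /andP[h1 h2].
  by split; lra.
have cmp n m : u n - e n <= u m + e m.
  have [nm|/ltnW nm] := leqP n m.
    have [+ _] := mono n (m - n)%N; rewrite subnKC//; have := e0 m; lra.
  have [_ +] := mono m (n - m)%N; rewrite subnKC//; have := e0 n; lra.
pose A := [set x | exists n, x = u n - e n].
have Aub m : ubound A (u m + e m) by move=> _ [n ->]; exact: cmp.
have A0 : A (u 0%N - e 0%N) by exists 0%N.
have hA : has_sup A by split; [exists (u 0%N - e 0%N) | exists (u 0%N + e 0%N)].
exists (sup A) => n; rewrite ler_norml.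
have h1 : u n - e n <= sup A by apply: ub_le_sup; [case: hA|exists n].
have h2 : sup A <= u n + e n by apply: ge_sup; [case: hA|exact: Aub].
by apply/andP; split; lra.
Qed.

Definition pt a b (t : R) : C := a + t%:C * (b - a).

Lemma pt0 a b : pt a b 0 = a. Proof. by rewrite /pt mul0r addr0. Qed.
Lemma pt1 a b : pt a b 1 = b. Proof. by rewrite /pt mul1r addrC subrK. Qed.

Lemma modc_pt a b t (r : R) : 0 <= t <= 1 -> modc a <= r -> modc b <= r -> modc (pt a b t) <= r.
Proof.
move=> /andP[t0 t1] ar br.
have -> : pt a b t = (1 - t)%:C * a + t%:C * b by rewrite /pt rmorphB/= ; ring.
rewrite (le_trans (modcD _ _))// !modcM !modc_real !ger0_norm ?subr_ge0//.
have -> : r = (1 - t) * r + t * r by ring.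
by rewrite lerD// ler_wpM2l// subr_ge0.
Qed.

Lemma modc_pt_lt a b t (r : R) : 0 <= t <= 1 -> modc a < r -> modc b < r -> modc (pt a b t) < r.
Proof.
move=> t01 ar br; apply: (@le_lt_trans _ _ (Num.max (modc a) (modc b))).
  by apply: modc_pt => //; rewrite le_max lexx// orbT.
by rewrite gt_max ar br.
Qed.

Lemma modc_pt_dist a b t : 0 <= t <= 1 -> modc (pt a b t - a) <= modc (b - a).
Proof.
move=> /andP[t0 t1]; rewrite /pt addrC addKr modcM modc_real ger0_norm//.
by rewrite ler_piMl ?modc_ge0.
Qed.

Lemma rcont_pt a b t : rcont (pt a b) t.
Proof. exact: rder_cont (rder_affine _ _ _). Qed.

Definition seg f a b : C := ci (fun t => f (pt a b t) * (b - a)).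

Definition ccontD1 f := forall z, modc z < 1 -> ccont f z.

Lemma seg_cont01 f a b : ccontD1 f -> modc a < 1 -> modc b < 1 ->
  cont01 (fun t => f (pt a b t) * (b - a)).
Proof.
move=> cf a1 b1 t t01; apply: rcontM; last exact: rcont_cst.
apply: rcont_comp; last exact: rcont_pt.
by apply: cf; exact: modc_pt_lt.
Qed.

Lemma seg_FTC f F a b : ccontD1 f -> modc a < 1 -> modc b < 1 ->
  (forall z, modc z < 1 -> cder F z (f z)) -> seg f a b = F b - F a.
Proof.
move=> cf a1 b1 dF; rewrite /seg (@cint01_FTC _ _ (F \o pt a b)).
- by rewrite /= pt0 pt1.
- exact: seg_cont01.
- move=> t t01; apply: rder_comp; first exact: rder_affine.
  by apply: dF; exact: modc_pt_lt.
Qed.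

Lemma seg_bound f a b (B : R) : ccontD1 f -> modc a < 1 -> modc b < 1 ->
  (forall t : R, 0 <= t <= 1 -> modc (f (pt a b t)) <= B) ->
  modc (seg f a b) <= 2 * B * modc (b - a).
Proof.
move=> cf a1 b1 fB; rewrite -mulrA; apply: cint01_bound; first exact: seg_cont01.
by move=> t t01; rewrite modcM ler_wpM2r ?modc_ge0// fB.
Qed.

Lemma segB f g a b : ccontD1 f -> ccontD1 g -> modc a < 1 -> modc b < 1 ->
  seg (fun z => f z - g z) a b = seg f a b - seg g a b.
Proof.
move=> cf cg a1 b1; rewrite /seg -cint01B; [|exact: seg_cont01..].
by apply: eq_cint01 => t _; rewrite mulrBl.
Qed.

Lemma seg_rev f a b : ccontD1 f -> modc a < 1 -> modc b < 1 -> seg f b a = - seg f a b.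
Proof.
move=> cf a1 b1; have [H d] := cprimitive01 (seg_cont01 cf a1 b1).
rewrite {2}/seg (cint01_FTC (seg_cont01 cf a1 b1) d).
rewrite /seg (@cint01_FTC _ _ (fun t => H (1 + t * (-1)))).
- by rewrite mul1r subrr mul0r addr0 opprB.
- exact: seg_cont01.
move=> t t01; have [|h _] := conj (rder_comp_real (d (1 + t * (-1)) _)) I.
  by move/andP: t01 => [? ?]; apply/andP; split; lra.
apply: rder_eq h _.
have -> : pt a b (1 + t * -1) = pt b a t by rewrite /pt rmorphD rmorphM rmorphN/= ; ring.
by rewrite rmorphN/=; ring.
Qed.

Definition mid a b : C := (2^-1 : R)%:C * (a + b).

Lemma two_half : (2^-1 : R)%:C + (2^-1 : R)%:C = 1 :> C.
Proof. by rewrite -rmorphD/= -mulr2n -[_ *+ 2]mulr_natr mulVf. Qed.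

Lemma mid_subl a b : mid a b - a = (2^-1 : R)%:C * (b - a).
Proof. by rewrite /mid -{2}[a]mul1r -two_half; ring. Qed.

Lemma mid_subr a b : b - mid a b = (2^-1 : R)%:C * (b - a).
Proof. by rewrite /mid -{1}[b]mul1r -two_half; ring. Qed.

Lemma modc_mid a b (r : R) : modc a <= r -> modc b <= r -> modc (mid a b) <= r.
Proof.
move=> ar br; rewrite modcM modc_real ger0_norm//.
have := modcD a b; have := splitr r; lra.
Qed.

Lemma modc_mid_lt a b (r : R) : modc a < r -> modc b < r -> modc (mid a b) < r.
Proof.
move=> ar br; rewrite modcM modc_real ger0_norm//.
have := modcD a b; have := splitr r; lra.
Qed.

Lemma seg_mid f a b : ccontD1 f -> modc a < 1 -> modc b < 1 ->
  seg f a b = seg f a (mid a b) + seg f (mid a b) b.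
Proof.
move=> cf a1 b1; rewrite /seg cint01_halves; last exact: seg_cont01.
have m1 := modc_mid_lt a1 b1.
have cm1 := seg_cont01 cf a1 m1; have cm2 := seg_cont01 cf m1 b1.
rewrite mulrDr; congr (_ + _).
  rewrite -cint01Z.
    apply: eq_cint01 => t _; rewrite mid_subl.
    have -> : pt a b (0 + t * 2^-1) = pt a (mid a b) t.
      by rewrite /pt mid_subl add0r rmorphM/= mulrA.
    by rewrite mulrCA -[2]/(2%:R) -(rmorph_nat (real_complex R)) -fmorphV.
  move=> t t01; apply: (@rcont_comp_real _ (fun t => f (pt a b t) * (b - a))).
  by apply: seg_cont01 => //; move/andP: t01 => [? ?]; apply/andP; split; lra.
rewrite -cint01Z.
  apply: eq_cint01 => t _; rewrite mid_subr.
  have -> : pt a b (2^-1 + t * 2^-1) = pt (mid a b) b t.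
    rewrite /pt mid_subr -[mid a b](subrK a) mid_subl rmorphD rmorphM/=; ring.
  by rewrite mulrCA -[2]/(2%:R) -(rmorph_nat (real_complex R)) -fmorphV.
move=> t t01; apply: (@rcont_comp_real _ (fun t => f (pt a b t) * (b - a))).
by apply: seg_cont01 => //; move/andP: t01 => [? ?]; apply/andP; split; lra.
Qed.

Definition tri f (T : C * C * C) : C :=
  seg f T.1.1 T.1.2 + seg f T.1.2 T.2 + seg f T.2 T.1.1.

Definition inball (r : R) (T : C * C * C) : bool := [&& modc T.1.1 <= r, modc T.1.2 <= r & modc T.2 <= r].

Definition sides (d : R) (T : C * C * C) : bool :=
  [&& modc (T.1.2 - T.1.1) <= d, modc (T.2 - T.1.2) <= d & modc (T.1.1 - T.2) <= d].

Definition child1 (T : C * C * C) := (T.1.1, mid T.1.1 T.1.2, mid T.2 T.1.1).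
Definition child2 (T : C * C * C) := (mid T.1.1 T.1.2, T.1.2, mid T.1.2 T.2).
Definition child3 (T : C * C * C) := (mid T.2 T.1.1, mid T.1.2 T.2, T.2).
Definition child4 (T : C * C * C) := (mid T.1.1 T.1.2, mid T.1.2 T.2, mid T.2 T.1.1).

(** Each side of the inner triangle [child4] is run through a second time, in the opposite
    direction, by one of the other three. *)
Lemma tri_split f T (r : R) : ccontD1 f -> r < 1 -> inball r T ->
  tri f T = tri f (child1 T) + tri f (child2 T) + tri f (child3 T) + tri f (child4 T).
Proof.
case: T => [[a b] c] cf r1 /and3P[/= ar br cr].
have a1 := le_lt_trans ar r1; have b1 := le_lt_trans br r1; have c1 := le_lt_trans cr r1.
have p1 := modc_mid_lt a1 b1; have q1 := modc_mid_lt b1 c1; have s1 := modc_mid_lt c1 a1.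
rewrite /tri/= (seg_mid cf a1 b1) (seg_mid cf b1 c1) (seg_mid cf c1 a1).
rewrite (seg_rev cf p1 q1) (seg_rev cf q1 s1) (seg_rev cf s1 p1); ring.
Qed.

Lemma modc_half z : modc ((2^-1 : R)%:C * z) = modc z / 2.
Proof. by rewrite modcM modc_real ger0_norm// mulrC. Qed.

(** The last bound, on the displacement of the first vertex, yields the limit point of the nested
    triangles. *)
Lemma child_ok T (r d : R) (T' : C * C * C) : inball r T -> sides d T ->
  (T' = child1 T \/ T' = child2 T \/ T' = child3 T \/ T' = child4 T) ->
  [/\ inball r T', sides (d / 2) T' & modc (T'.1.1 - T.1.1) <= d].
Proof.
case: T => [[a b] c] /and3P[/= ar br cr] /and3P[/= ab bc ca].
have d0 : 0 <= d by apply: le_trans ab; exact: modc_ge0.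
have h (x y : C) : modc (x - y) <= d -> modc ((2^-1 : R)%:C * (x - y)) <= d / 2.
  by rewrite modc_half => ?; rewrite ler_pM2r.
have dd : d / 2 <= d by lra.
have ba : modc (a - b) <= d by rewrite modc_dist.
have cb : modc (b - c) <= d by rewrite modc_dist.
have ac : modc (c - a) <= d by rewrite modc_dist.
have mm (x y z : C) : mid x y - mid y z = (2^-1 : R)%:C * (x - z) by rewrite /mid; ring.
have ma := modc_mid ar br; have mb := modc_mid br cr; have mc := modc_mid cr ar.
have e1 (x y : C) : modc (x - y) <= d -> modc (mid x y - x) <= d / 2.
  by rewrite modc_dist mid_subl => ?; exact: h.
have e2 (x y : C) : modc (x - y) <= d -> modc (y - mid x y) <= d / 2.
  by rewrite modc_dist mid_subr => ?; exact: h.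
have e3 (x y z : C) : modc (x - z) <= d -> modc (mid x y - mid y z) <= d / 2.
  by rewrite mm => ?; exact: h.
have e4 (x y z : C) : modc (x - z) <= d -> modc (mid y z - mid x y) <= d / 2.
  by move=> hxz; rewrite modc_dist; exact: e3.
have e1' (x y : C) : modc (x - y) <= d -> modc (x - mid x y) <= d / 2.
  by move=> hxz; rewrite modc_dist; exact: e1.
have e2' (x y : C) : modc (x - y) <= d -> modc (mid x y - y) <= d / 2.
  by move=> hxz; rewrite modc_dist; exact: e2.
case=> [->|[->|[->|->]]]; rewrite /inball /sides /child1 /child2 /child3 /child4/=.
- rewrite ar ma mc (e1 _ _ ba) (e3 _ _ _ bc) (e2 _ _ ac); split => //.
  by rewrite subrr modc0.
- rewrite br ma mb (e2 _ _ ba) (e1 _ _ cb) (e3 _ _ _ ca); split => //.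
  exact: le_trans (e1 _ _ ba) dd.
- rewrite cr mb mc (e3 _ _ _ ab) (e2 _ _ cb) (e1 _ _ ac); split => //.
  exact: le_trans (e2' _ _ ac) dd.
- rewrite ma mb mc (e4 _ _ _ ca) (e4 _ _ _ ab) (e4 _ _ _ bc); split => //.
  exact: le_trans (e1 _ _ ba) dd.
Qed.

(** [child4] is taken without a test: by [pick_child_le] it qualifies when the other three fail. *)
Definition pick_child f T : C * C * C :=
  if modc (tri f T) / 4 <= modc (tri f (child1 T)) then child1 T else
  if modc (tri f T) / 4 <= modc (tri f (child2 T)) then child2 T else
  if modc (tri f T) / 4 <= modc (tri f (child3 T)) then child3 T else child4 T.

Lemma pick_child_cases f T : pick_child f T = child1 T \/ pick_child f T = child2 T \/
  pick_child f T = child3 T \/ pick_child f T = child4 T.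
Proof.
by rewrite /pick_child; case: ifP => _; [left|right; case: ifP => _; [left|right; case: ifP => _; [left|right]]].
Qed.

Lemma pick_child_le f T (r : R) : ccontD1 f -> r < 1 -> inball r T ->
  modc (tri f T) / 4 <= modc (tri f (pick_child f T)).
Proof.
move=> cf r1 Tr; rewrite /pick_child.
case: ifP => // /negbT; rewrite -ltNge => h1.
case: ifP => // /negbT; rewrite -ltNge => h2.
case: ifP => // /negbT; rewrite -ltNge => h3.
have := modcD (tri f (child1 T) + tri f (child2 T) + tri f (child3 T)) (tri f (child4 T)).
have := modcD (tri f (child1 T) + tri f (child2 T)) (tri f (child3 T)).
have := modcD (tri f (child1 T)) (tri f (child2 T)).
rewrite -(tri_split cf r1 Tr); lra.
Qed.

Lemma triB f g T (r : R) : ccontD1 f -> ccontD1 g -> r < 1 -> inball r T ->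
  tri (fun z => f z - g z) T = tri f T - tri g T.
Proof.
case: T => [[a b] c] cf cg r1 /and3P[/= ar br cr].
have a1 := le_lt_trans ar r1; have b1 := le_lt_trans br r1; have c1 := le_lt_trans cr r1.
by rewrite /tri/= !segB//; ring.
Qed.

Lemma tri_FTC f F T (r : R) : ccontD1 f -> r < 1 -> inball r T ->
  (forall z, modc z < 1 -> cder F z (f z)) -> tri f T = 0.
Proof.
case: T => [[a b] c] cf r1 /and3P[/= ar br cr] dF.
have a1 := le_lt_trans ar r1; have b1 := le_lt_trans br r1; have c1 := le_lt_trans cr r1.
by rewrite /tri/= !(seg_FTC cf _ _ dF)//; ring.
Qed.

(** An explicit primitive of the affine function [u + v (w - z)], whose integrals over triangles
    therefore vanish. *)
Lemma cder_quadratic (u v z w : C) :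
  cder (fun w => u * w + v * ((2^-1 : R)%:C * (w - z) ^+ 2)) w (u + v * (w - z)).
Proof.
have d1 : cder (fun w => w - z) w 1.
  by have := cderB (cder_id w) (cder_cst z w); rewrite subr0.
have := cderD (cderZ u (cder_id w)) (cderZ v (cderZ (2^-1 : R)%:C (cderM d1 d1))).
under [X in cder X]eq_fun do rewrite -expr2.
move/cder_eq; apply; have := two_half; set k := real_complex R _ => kk.
transitivity (u + v * ((k + k) * (w - z))); first by ring.
by rewrite kk mul1r.
Qed.

(** Repeated quartering keeps a triangle of size [d / 2^n] whose integral is at least [eta / 4^n] in
    modulus. Subtracting from [f] its affine part at the limit point does not change the integral
    and leaves an integrand that is negligible with respect to the size, hence an integral
    negligible with respect to [4^(-n)]. *)
Theorem Goursat f T (r : R) : (forall z, modc z < 1 -> exists l, cder f z l) ->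
  r < 1 -> inball r T -> tri f T = 0.
Proof.
move=> df r1 Tr.
have cf : ccontD1 f by move=> z /df[l]; exact: cder_cont.
apply/eqP; rewrite -modc_eq0; apply/negPn/negP => tri0.
have eta0 : 0 < modc (tri f T) by rewrite lt_def tri0 modc_ge0.
set eta := modc (tri f T) in eta0.
pose d := modc (T.1.2 - T.1.1) + modc (T.2 - T.1.2) + modc (T.1.1 - T.2).
have d0 : 0 <= d by rewrite !addr_ge0// modc_ge0.
have Td : sides d T.
  have := modc_ge0 (T.1.2 - T.1.1); have := modc_ge0 (T.2 - T.1.2); have := modc_ge0 (T.1.1 - T.2).
  by move=> *; rewrite /sides /d; apply/and3P; split; lra.
pose U n := iter n (pick_child f) T.
pose dl n : R := d / 2 ^+ n.
have UP n : [/\ inball r (U n), sides (dl n) (U n) & eta / 4 ^+ n <= modc (tri f (U n))].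
  elim: n => [|n [i1 i2 i3]]; first by rewrite /U /dl/= !expr0 !divr1.
  have [j1 j2 j3] := child_ok i1 i2 (pick_child_cases f (U n)).
  split => //.
    by have -> : dl n.+1 = dl n / 2 by rewrite /dl exprSr invfM mulrA.
  apply: (le_trans _ (pick_child_le cf r1 i1)).
  by rewrite exprS invfM mulrCA mulrC ler_pM2r// invr_gt0.
have Ustep n : modc ((U n.+1).1.1 - (U n).1.1) <= dl n.
  have [i1 i2 _] := UP n.
  by have [] := child_ok i1 i2 (pick_child_cases f (U n)).
have dl0 n : 0 <= dl n by rewrite divr_ge0// exprn_ge0.
have dlS n : dl n = 2 * dl n - 2 * dl n.+1.
  rewrite /dl exprS invfM; have : (2:R) ^+ n != 0 by rewrite expf_neq0.
  by move=> ?; field.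
have e0 n : 0 <= 2 * dl n by rewrite mulr_ge0.
have [|x xP] := @nested_limit (fun n => complex.Re (U n).1.1) (fun n => 2 * dl n) e0.
  move=> n; rewrite -dlS -ReN -ReD (le_trans (Re_le_modc _))//.
have [|y yP] := @nested_limit (fun n => complex.Im (U n).1.1) (fun n => 2 * dl n) e0.
  move=> n; rewrite -dlS -ImN -ImD (le_trans (Im_le_modc _))//.
pose z := x +i* y.
have zP n : modc ((U n).1.1 - z) <= 4 * dl n.
  rewrite (le_trans (modc_le_ReIm _))// ReD ReN ImD ImN/=.
  by have := xP n; have := yP n; lra.
have dl_small (e : R) : 0 < e -> exists n, dl n < e.
  move=> ep; have : (fun n => d * (2^-1) ^+ n) @ \oo --> d * 0.
    by apply: cvgM; [exact: cvg_cst|apply: cvg_expr; rewrite ger0_norm// invf_lt1// ltr1n].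
  rewrite mulr0 => /cvgrPdist_lt/(_ e ep)[n _ /(_ n (leqnn _))].
  rewrite /= sub0r normrN ger0_norm ?mulr_ge0 ?exprn_ge0// exprVn.
  by exists n.
have zr : modc z <= r.
  apply/ler_addgt0Pr => e ep; have [|n dn] := dl_small (e / 4); first by rewrite divr_gt0.
  have [/and3P[h _ _] _ _] := UP n.
  have := modcD (U n).1.1 (z - (U n).1.1); rewrite addrCA subrr addr0.
  have := zP n; rewrite modc_dist; lra.
have [l lP] := df z (le_lt_trans zr r1).
(* Here [30] is the [3] sides times the factor [2] of [seg_bound] times the [5] in the distance
   [5 * dl n] from points of the [n]-th triangle to [z]; the [1] covers [d = 0] and makes the final
   inequality strict. *)
pose e := eta / (30 * d ^+ 2 + 1).
have K0 : 0 < 30 * d ^+ 2 + 1 by rewrite ltr_wpDl// mulr_ge0// sqr_ge0.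
have ep : 0 < e by rewrite divr_gt0.
have [dd dd0 ddH] := lP e ep.
have [|n dn] := dl_small (dd / 5); first by rewrite divr_gt0.
have [Ur Us Ut] := UP n.
pose g w := f z + l * (w - z).
have cg : ccontD1 g.
  move=> w _; apply: ccontD; first exact: ccont_cst.
  by apply: ccontM; [exact: ccont_cst|apply: ccontB; [exact: ccont_id|exact: ccont_cst]].
have := triB cf cg r1 Ur.
rewrite (tri_FTC cg r1 Ur (fun w _ => cder_quadratic (f z) l z w)) subr0 => triE.
have cfg : ccontD1 (fun w => f w - g w) by move=> w w1; apply: ccontB; [exact: cf|exact: cg].
have near w : modc (w - (U n).1.1) <= dl n -> modc (f w - g w) <= e * (5 * dl n).
  move=> wU; have wz : modc (w - z) <= 5 * dl n.
    have := modcB_triangle w (U n).1.1 z; have := zP n; lra.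
  rewrite /g opprD addrA (le_trans (ddH _ _))//; first by lra.
  by rewrite ler_wpM2l// ltW.
move: Ut; rewrite -triE; move: Ur Us near; clear -cfg r1 eta0 d0 K0 dl0.
rewrite /tri; case: (U n) => [[a b] c] /and3P[/= ar br cr] /and3P[/= ab bc ca] near.
have a1 := le_lt_trans ar r1; have b1 := le_lt_trans br r1; have c1 := le_lt_trans cr r1.
have L := dl0 n.
have ep : 0 < e by rewrite divr_gt0.
have E0 : 0 <= 2 * (e * (5 * dl n)) by apply: mulr_ge0 => //; apply: mulr_ge0; [exact: ltW|exact: mulr_ge0].
have s1 : modc (seg (fun z0 => f z0 - g z0) a b) <= 2 * (e * (5 * dl n)) * dl n.
  apply: le_trans (seg_bound cfg a1 b1 _) _.
    by move=> t t01; apply: near; rewrite (le_trans (modc_pt_dist _ _ t01)).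
  by rewrite ler_wpM2l.
have s2 : modc (seg (fun z0 => f z0 - g z0) b c) <= 2 * (e * (5 * dl n)) * dl n.
  apply: le_trans (seg_bound cfg b1 c1 _) _.
    move=> t t01; apply: near.
    have -> : pt b c t - a = pt (b - a) (c - a) t by rewrite /pt; ring.
    by apply: modc_pt => //; rewrite modc_dist.
  by rewrite ler_wpM2l.
have s3 : modc (seg (fun z0 => f z0 - g z0) c a) <= 2 * (e * (5 * dl n)) * dl n.
  apply: le_trans (seg_bound cfg c1 a1 _) _.
    move=> t t01; apply: near.
    have -> : pt c a t - a = pt (c - a) 0 t by rewrite /pt; ring.
    by apply: modc_pt => //; rewrite ?modc0// modc_dist.
  by rewrite ler_wpM2l.
move=> h.
have : eta / 4 ^+ n <= 30 * (e * dl n ^+ 2).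
  apply: (le_trans h); apply: (le_trans (modcD _ _)); apply: (le_trans (lerD (modcD _ _) (lexx _))).
  apply: (le_trans (lerD (lerD s1 s2) s3)); rewrite le_eqVlt; apply/orP; left; apply/eqP; ring.
have X0 : 0 < (4 : R) ^+ n by rewrite exprn_gt0.
have -> : dl n ^+ 2 = d ^+ 2 / 4 ^+ n.
  have -> : (4 : R) = 2 ^+ 2 by rewrite -natrX.
  by rewrite /dl expr_div_n -!exprM mulnC.
rewrite ler_pdivrMr//.
have -> : 30 * (e * (d ^+ 2 / 4 ^+ n)) * 4 ^+ n = 30 * e * d ^+ 2.
  by field; rewrite lt0r_neq0.
have ee : e * (30 * d ^+ 2 + 1) = eta by rewrite /e divfK// lt0r_neq0.
lra.
Qed.

(** By Goursat's theorem on the triangle [0, z, w], the increment of the primitive is the integral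
    along the segment from [z] to [w], where [f] is close to [f z]. *)
Theorem holo_primitive f z : analytic f -> modc z < 1 -> cder (seg f 0) z (f z).
Proof.
move=> hf z1.
have cf : ccontD1 f by move=> w w1; exact: holo_cont.
have df w : modc w < 1 -> exists l, cder f w l by have /holoP hf' := hf; move=> w1; exists (der f w); exact: hf'.
move=> e e0; have e20 : 0 < e / 2 by rewrite divr_gt0.
have [d d0 dH] := cf z z1 _ e20.
exists (Num.min d (1 - modc z)); first by rewrite lt_min d0 subr_gt0.
move=> w; rewrite lt_min => /andP[wd wz].
have w1 : modc w < 1 by have := modcBB w z; lra.
have o1 : modc (0 : C) < 1 by rewrite modc0.
pose r := Num.max (modc z) (modc w).
have r1 : r < 1 by rewrite gt_max z1.
have := @Goursat f (0, z, w) r df r1.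
rewrite /inball/= modc0 !le_max !lexx modc_ge0 !orbT/= => /(_ isT).
rewrite /tri/= (seg_rev cf o1 w1) => /eqP; rewrite subr_eq0 => /eqP <-.
rewrite [_ + seg f z w]addrC addrK.
have segc : seg (fun=> f z) z w = f z * (w - z) by rewrite /seg cint01_cst.
have cc : ccontD1 (fun=> f z) by move=> ? _; exact: ccont_cst.
rewrite -segc -segB//.
have cB : ccontD1 (fun w => f w - f z) by move=> ? ?; apply: ccontB; [exact: cf|exact: ccont_cst].
apply: le_trans (seg_bound cB z1 w1 (B := e / 2) _) _.
  by move=> t t01; apply: dH; apply: le_lt_trans wd; exact: modc_pt_dist.
by have -> : 2 * (e / 2) * modc (w - z) = e * modc (w - z) by field.
Qed.

End Goursat.

(** * Cauchy's formula *)

Section DiscCompact.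
Context {R : realType}.
Local Notation C := R[i].

Lemma to_c_continuous : continuous (@to_c R : R * R -> C^o).
Proof.
move=> u; apply/cvgrPdist_le => e /gt0_complexP[r r0 ->].
have r2 : 0 < r / 2 by rewrite divr_gt0.
exists (ball u.1 (r / 2), ball u.2 (r / 2)) => [|v [/= v1 v2]].
  by split; exact: nbhsx_ballx.
rewrite norm_modc lecR (le_trans (modc_le_ReIm _))// (splitr r).
by rewrite lerD// ?ReD ?ReN ?ImD ?ImN ltW.
Qed.

Lemma compact_disc2 (r : R) : compact [set u : R * R | modc (to_c u) <= r].
Proof.
have [r0|r0] := ltP r 0.
  have -> : [set u : R * R | modc (to_c u) <= r] = set0; last exact: compact0.
  by apply/seteqP; split=> // z /=; rewrite leNgt (lt_le_trans r0)// modc_ge0.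
pose A := `[-r, r]%classic `*` `[-r, r]%classic : set (R * R).
have cA : compact A by apply: compact_setX; exact: segment_compact.
pose B := [set u : R * R | u.1 ^+ 2 + u.2 ^+ 2 <= r ^+ 2].
have cB : closed B.
  have -> : B = (fun u : R * R => u.1 ^+ 2 + u.2 ^+ 2) @^-1` [set x | x <= r ^+ 2] by [].
  have c1 : continuous (fun u : R * R => u.1 ^+ 2).
    by move=> u; under eq_fun do rewrite expr2; apply: cvgM; exact: cvg_fst.
  have c2 : continuous (fun u : R * R => u.2 ^+ 2).
    by move=> u; under eq_fun do rewrite expr2; apply: cvgM; exact: cvg_snd.
  apply: preimage_closed; last exact: closed_le.
  by move=> u _; apply: cvgD; [exact: c1|exact: c2].
have cAB : compact (A `&` B) by apply: compact_closedI.
have -> // : [set u : R * R | modc (to_c u) <= r] = A `&` B.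
apply/seteqP; split => [[x y] /= zr|[x y] [_ xy]] /=; last first.
  by rewrite -(@ler_pXn2r _ 2)// ?nnegrE ?modc_ge0// modc_sqr.
split; last by rewrite /B/= -(modc_sqr (x +i* y)) ler_pXn2r// nnegrE modc_ge0.
split; rewrite /= in_itv/= -ler_norml.
  exact: le_trans (Re_le_modc (x +i* y)) zr.
exact: le_trans (Im_le_modc (x +i* y)) zr.
Qed.

(** Compactness is needed in the topology of [C^o], in which [test_kernels] states uniform
    convergence on compact sets. *)
Lemma compact_cdisc (r : R) : compact ([set z | modc z <= r] : set C^o).
Proof.
have -> : [set z | modc z <= r] = (@to_c R) @` [set u | modc (to_c u) <= r] :> set C^o.
  apply/seteqP; split => [z zr|_ [u ur <-]] //=.
  by exists (complex.Re z, complex.Im z); case: z zr.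
apply: continuous_compact; last exact: compact_disc2.
exact/continuous_subspaceT/to_c_continuous.
Qed.

Lemma ccont_bounded (f : C -> C) (r : R) : (forall z, modc z <= r -> ccont f z) ->
  exists2 B : R, 0 <= B & forall z, modc z <= r -> modc (f z) <= B.
Proof.
move=> cf.
have : compact ((fun u : R * R => modc (f (to_c u))) @` [set u | modc (to_c u) <= r]).
  apply: continuous_compact; last exact: compact_disc2.
  apply: continuous_in_subspaceT => u; rewrite inE/= => /cf cfu.
  apply/cvgrPdist_le => e e0; have [d d0 dH] := cfu e e0.
  have d2 : 0 < d / 2 by rewrite divr_gt0.
  exists (ball u.1 (d / 2), ball u.2 (d / 2)) => [|v [/= v1 v2]].
    by split; exact: nbhsx_ballx.
  have h : modc (f (to_c v) - f (to_c u)) <= e.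
    apply: dH; rewrite (le_lt_trans (modc_le_ReIm _))// (splitr d).
    by rewrite ltrD// ?ReD ?ReN ?ImD ?ImN distrC.
  have h1 := modcBB (f (to_c v)) (f (to_c u)).
  have h2 := modcBB (f (to_c u)) (f (to_c v)).
  by rewrite ler_norml; move: h2; rewrite modc_dist => h2; apply/andP; split; lra.
move=> /compact_bounded [M [Mr MH]].
exists (`|M| + 1); first by rewrite addr_ge0.
move=> z zr; have M1 : M < `|M| + 1 by rewrite (le_lt_trans (ler_norm _))// ltrDl.
have := MH _ M1 (modc (f z)).
rewrite /= ger0_norm ?modc_ge0//; apply.
by exists (complex.Re z, complex.Im z); case: z zr.
Qed.

End DiscCompact.

(** * Differentiation under the integral sign in a real parameter *)

Section DUI.
Context {R : realType}.
Local Notation C := R[i].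
Local Notation mu := (@lebesgue_measure R).

Lemma Rintegral01_DUI (f f' : R -> R -> R) (x0 d B : R) : 0 < d ->
  (forall x (t : R), `|x - x0| < d -> 0 <= t <= 1 -> {for t, continuous (f x)}) ->
  (forall x (t : R), `|x - x0| < d -> 0 <= t <= 1 -> rdiff (f ^~ t) x (f' x t)) ->
  (forall x (t : R), `|x - x0| < d -> 0 <= t <= 1 -> `|f' x t| <= B) ->
  rdiff (fun x => Rintegral mu `[0, 1] (f x)) x0 (Rintegral mu `[0, 1] (f' x0)).
Proof.
move=> d0 cf df f'B.
have I x : `](x0 - d), (x0 + d)[%classic x -> `|x - x0| < d.
  by rewrite /= in_itv/= => ?; rewrite ltr_norml; apply/andP; split; lra.
have I0 : `](x0 - d), (x0 + d)[%classic x0.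
  by rewrite /= in_itv/=; apply/andP; split; lra.
have m01 : measurable (`[0, 1]%classic : set (measurableTypeR R)) by [].
have d1 x (t : R) : `|x - x0| < d -> 0 <= t <= 1 -> partial1of2 f x t = f' x t.
  move=> xd t01; rewrite partial1of2E; by have [_ <-] := df x t xd t01.
pose G (t : R) := `|B|.
have G0 t : 0 <= G t by rewrite /G.
have iG : mu.-integrable `[0, 1] (EFin \o G).
  by apply: integrable01 => t _; exact: cvg_cst.
have intf x : `](x0 - d), (x0 + d)[%classic x -> mu.-integrable `[0, 1] (EFin \o f x).
  by move=> /I xd; apply: integrable01 => t; exact: cf.
have derf x t : `](x0 - d), (x0 + d)[%classic x -> `[0, 1]%classic t -> derivable (f ^~ t) x 1.
  by move=> /I xd; rewrite /= in_itv/= => t01; have [] := df x t xd t01.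
have ubf x t : `](x0 - d), (x0 + d)[%classic x -> `[0, 1]%classic t -> `|partial1of2 f x t| <= G t.
  move=> /I xd; rewrite /= in_itv/= => t01; rewrite d1//.
  by rewrite (le_trans (f'B _ _ xd t01))// ler_norm.
split; first exact: (@derivable_under_integral R _ _ mu f _ m01 _ _ _ I0 intf derf G G0 iG ubf).
rewrite -derive1E (@differentiation_under_integral R _ _ mu f _ m01 _ _ _ I0 intf derf G G0 iG ubf).
by apply: eq_Rintegral01 => t t01; rewrite d1// subrr normr0.
Qed.

Lemma cint01_DUI (f f' : R -> R -> C) (x0 d B : R) : 0 < d ->
  (forall x, `|x - x0| < d -> cont01 (f x)) ->
  (forall x (t : R), `|x - x0| < d -> 0 <= t <= 1 -> rder (f ^~ t) x (f' x t)) ->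
  (forall x (t : R), `|x - x0| < d -> 0 <= t <= 1 -> modc (f' x t) <= B) ->
  rder (fun x => ci (f x)) x0 (ci (f' x0)).
Proof.
move=> d0 cf df f'B; rewrite ciE; apply/rder_ReIm; split.
  apply: (@Rintegral01_DUI (fun x t => complex.Re (f x t)) (fun x t => complex.Re (f' x t)) x0 d B) => //.
  - by move=> x t xd t01; have /rcont_ReIm[] := cf x xd t t01.
  - by move=> x t xd t01; have /rder_ReIm[] := df x t xd t01.
  - by move=> x t xd t01; apply: le_trans (Re_le_modc _) _; exact: f'B.
apply: (@Rintegral01_DUI (fun x t => complex.Im (f x t)) (fun x t => complex.Im (f' x t)) x0 d B) => //.
- by move=> x t xd t01; have /rcont_ReIm[] := cf x xd t t01.
- by move=> x t xd t01; have /rder_ReIm[] := df x t xd t01.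
- by move=> x t xd t01; apply: le_trans (Im_le_modc _) _; exact: f'B.
Qed.

End DUI.

(** * Parametrization of circles *)

Section Circle.
Context {R : realType}.
Local Notation C := R[i].

(** This is [exp(2 pi i t)]: with the angle in turns, means over circles are integrals over [[0, 1]]
    without a normalizing factor. *)
Definition expi (t : R) : C := cos (2 * pi * t) +i* sin (2 * pi * t).
Definition tpi : C := 0 +i* (2 * pi).

Lemma tpi_neq0 : tpi != 0.
Proof. by rewrite eq_complex/= eqxx/= mulf_neq0// gt_eqF// pi_gt0. Qed.

Lemma rder_expi t : rder expi t (tpi * expi t).
Proof.
apply/rder_ReIm; rewrite /expi/=; split.
  apply: is_derive_eq; rewrite [_ *: _]mulr1 !mul0r sub0r.
  by rewrite mulNr mulrC.
apply: is_derive_eq; rewrite [_ *: _]mulr1 !mul0r add0r.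
by rewrite mulrC.
Qed.

Lemma expi0 : expi 0 = 1.
Proof. by rewrite /expi mulr0 cos0 sin0. Qed.

Lemma expiD s t : expi (s + t) = expi s * expi t.
Proof.
by apply: complex_ext; rewrite ?ReM ?ImM /expi/= mulrDr ?cosD ?sinD// addrC [X in _ + X]mulrC addrC.
Qed.

Lemma expi1 : expi 1 = 1.
Proof. by rewrite /expi mulr1 mulr_natl cos2pi sin2pi. Qed.

Lemma modc_expi t : modc (expi t) = 1.
Proof. by rewrite /modc/= cos2Dsin2 sqrtr1. Qed.

Lemma rcont_expi t : rcont expi t.
Proof. exact: rder_cont (rder_expi t). Qed.

Lemma expi_surj z : modc z = 1 -> exists t, expi t = z.
Proof.
case: z => x y; rewrite /modc/= => h.
have xy : x ^+ 2 + y ^+ 2 = 1.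
  by rewrite -(@sqr_sqrtr _ (x ^+ 2 + y ^+ 2)) ?h ?expr1n// addr_ge0 ?sqr_ge0.
have x1 : -1 <= x <= 1.
  by rewrite -ler_norml -[leRHS](normr1 R) -ler_sqr ?nnegrE// ?normr_ge0// !real_normK ?num_real// expr1n; have := sqr_ge0 y; lra.
have y2 : Num.sqrt (1 - x ^+ 2) = `|y|.
  have -> : 1 - x ^+ 2 = y ^+ 2 by lra.
  by rewrite sqrtr_sqr.
have pp : 2 * pi != 0 :> R by rewrite mulf_neq0// gt_eqF// pi_gt0.
have [y0|y0] := leP 0 y.
  exists (acos x / (2 * pi)); rewrite /expi mulrCA divff// mulr1.
  by rewrite acosK// sin_acos// y2 ger0_norm.
exists (- acos x / (2 * pi)); rewrite /expi mulrCA divff// mulr1.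
by rewrite cosN sinN acosK// sin_acos// y2 ltr0_norm// opprK.
Qed.

Lemma polar z : exists t, z = (modc z)%:C * expi t.
Proof.
have [->|z0] := eqVneq z 0; first by exists 0; rewrite modc0 mul0r.
have m0 : modc z != 0 by rewrite modc_eq0.
have [|t tE] := @expi_surj ((modc z)^-1%:C * z).
  by rewrite modcM modc_real ger0_norm ?invr_ge0 ?modc_ge0// mulVf.
by exists t; rewrite tE mulrA -rmorphM/= divff// mul1r.
Qed.

End Circle.

(** * The Cauchy kernel, and Cauchy's formula for functions with a continuous derivative *)

Section CauchyKernel.
Context {R : realType}.
Local Notation C := R[i].
Implicit Types (f F : C -> C) (z w zeta : C).

Definition kk zeta z : C := (zeta - z)^-1.

Lemma kk_sub zeta z w : zeta != z -> zeta != w ->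
  kk zeta w - kk zeta z = (w - z) * kk zeta w * kk zeta z.
Proof. by move=> zz zw; rewrite /kk; field; rewrite !subr_eq0 zz zw. Qed.

(** First-order expansion in [z] of the powers of the kernel, with a remainder uniform in [zeta];
    the induction splits off one factor [1 / (zeta - w)] and uses [kk_sub]. *)
Lemma kkX_quad n (U : R) : 0 <= U -> exists2 M : R, 0 <= M & forall zeta z w,
  zeta != z -> zeta != w -> modc (kk zeta z) <= U -> modc (kk zeta w) <= U ->
  modc (kk zeta w ^+ n - kk zeta z ^+ n - n%:R * kk zeta z ^+ n.+1 * (w - z)) <= M * modc (w - z) ^+ 2.
Proof.
move=> U0; elim: n => [|n [M M0 MH]].
  by exists 0 => // zeta z w _ _ _ _; rewrite !expr0 subrr !mul0r subr0 modc0.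
exists (U * M + U ^+ n * U ^+ 3 + n%:R * U ^+ n.+1 * U ^+ 2).
  by rewrite !addr_ge0// !mulr_ge0// ?exprn_ge0.
move=> zeta z w zz zw kz kw.
set a := kk zeta w; set b := kk zeta z; set h := w - z.
have ab : a - b = h * a * b by exact: kk_sub.
have ab2 : a - b - b ^+ 2 * h = h ^+ 2 * (a * b ^+ 2).
  rewrite -[X in X - _]/(a - b) ab.
  have -> : h * a * b - b ^+ 2 * h = h * b * (a - b) by ring.
  by rewrite ab; ring.
have -> : a ^+ n.+1 - b ^+ n.+1 - n.+1%:R * b ^+ n.+2 * h =
  a * (a ^+ n - b ^+ n - n%:R * b ^+ n.+1 * h) + b ^+ n * (a - b - b ^+ 2 * h)
  + n%:R * b ^+ n.+1 * h * (a - b).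
  by rewrite -(natr1 n) !exprS; ring.
have MHi : modc (a ^+ n - b ^+ n - n%:R * b ^+ n.+1 * h) <= M * modc h ^+ 2 by exact: MH.
rewrite ab2 ab; have [ka kb] : modc a <= U /\ modc b <= U by [].
clearbody a b h; clear MH ab ab2.
have h0 : 0 <= modc h ^+ 2 by rewrite exprn_ge0// modc_ge0.
have pw (c : C) k : modc c <= U -> modc c ^+ k <= U ^+ k.
  by move=> cU; rewrite lerXn2r// nnegrE modc_ge0.
rewrite (le_trans (modcD _ _))// [leRHS]mulrDl lerD//.
  rewrite (le_trans (modcD _ _))// [leRHS]mulrDl lerD//.
    by rewrite modcM -(mulrA U); apply: ler_pM; rewrite ?modc_ge0.
  have -> : b ^+ n * (h ^+ 2 * (a * b ^+ 2)) = b ^+ n * (a * b ^+ 2) * h ^+ 2 by ring.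
  rewrite modcM modcX; apply: ler_wpM2r => //.
  rewrite modcM; apply: ler_pM; rewrite ?modc_ge0//; first by rewrite modcX pw.
  by rewrite modcM [U ^+ 3]exprS; apply: ler_pM; rewrite ?modc_ge0// modcX pw.
have -> : n%:R * b ^+ n.+1 * h * (h * a * b) = n%:R * b ^+ n.+1 * (a * b) * h ^+ 2 by ring.
rewrite modcM modcX; apply: ler_wpM2r => //.
rewrite modcM; apply: ler_pM; rewrite ?modc_ge0//.
  rewrite modcM; apply: ler_pM; rewrite ?modc_ge0//.
    by rewrite -(rmorph_nat (real_complex R)) modc_real ger0_norm.
  by rewrite modcX pw.
by rewrite modcM expr2; apply: ler_pM; rewrite ?modc_ge0.
Qed.

(** A quadratic remainder uniform in [t] survives integration, so the complex derivative passes
    under the integral by a direct estimate. *)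
Lemma cint01_cder_quad (phi : C -> R -> C) (phi' : R -> C) z (d M : R) : 0 < d -> 0 <= M ->
  (forall w, modc (w - z) < d -> cont01 (phi w)) -> cont01 phi' ->
  (forall w (t : R), modc (w - z) < d -> 0 <= t <= 1 ->
     modc (phi w t - phi z t - phi' t * (w - z)) <= M * modc (w - z) ^+ 2) ->
  cder (fun w => ci (phi w)) z (ci phi').
Proof.
move=> d0 M0 cphi cphi' H e e0.
exists (Num.min d (e / (2 * M + 1))).
  by rewrite lt_min d0 divr_gt0// ltr_wpDl// mulr_ge0.
move=> w; rewrite lt_min => /andP[wd we].
have czd : modc (z - z) < d by rewrite subrr modc0.
have cc : cont01 (fun t => phi' t * (w - z)).
  by move=> t t01; apply: rcontM; [exact: cphi'|exact: rcont_cst].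
rewrite mulrC -cint01Z// -cint01B; [|exact: cphi..].
rewrite -cint01B; last 2 first.
- by move=> t t01; apply: rcontB; apply: cphi.
- by move=> t t01; apply: rcontM; [exact: rcont_cst|exact: cphi'].
apply: le_trans (cint01_bound (B := M * modc (w - z) ^+ 2) _ _) _.
- move=> t t01; apply: rcontB; first by apply: rcontB; apply: cphi.
  by apply: rcontM; [exact: rcont_cst|exact: cphi'].
- by move=> t t01; rewrite [(w - z) * _]mulrC; exact: H.
rewrite expr2 !mulrA ler_wpM2r ?modc_ge0//.
move: we; rewrite ltr_pdivlMr ?ltr_wpDl ?mulr_ge0// => /ltW; apply: le_trans.
by rewrite mulrDr mulr1 [modc _ * _]mulrC lerDl modc_ge0.
Qed.

Section Kernel.
Variables (rho : R) (psi : R -> C).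
Hypotheses (rho0 : 0 < rho) (cpsi : cont01 psi).

Definition zt (t : R) : C := rho%:C * expi t.

Lemma modc_zt t : modc (zt t) = rho.
Proof. by rewrite modcM modc_expi modc_real mulr1 gtr0_norm. Qed.

Lemma zt_neq t z : modc z < rho -> zt t != z.
Proof. by apply: contraTneq => <-; rewrite modc_zt ltxx. Qed.

Lemma modc_kk t z (r : R) : modc z <= r -> r < rho -> modc (kk (zt t) z) <= (rho - r)^-1.
Proof.
move=> zr rr; rewrite modcV lef_pV2 ?posrE ?subr_gt0//.
  by have := modcBB (zt t) z; rewrite modc_zt; lra.
by rewrite modc_gt0 subr_eq0 zt_neq// (le_lt_trans zr).
Qed.

Lemma rcont_zt t : rcont zt t.
Proof. by apply: rcontM; [exact: rcont_cst|exact: rcont_expi]. Qed.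

Lemma rcont_kk z t : modc z < rho -> rcont (fun t => kk (zt t) z) t.
Proof.
move=> zr; apply: (@rcont_comp _ (fun w => w^-1) (fun t => zt t - z)).
  by apply: cder_cont; apply: cderV; rewrite subr_eq0 zt_neq.
by apply: rcontB; [exact: rcont_zt|exact: rcont_cst].
Qed.

Lemma rcontX (c : R -> C) n t : rcont c t -> rcont (fun t => c t ^+ n) t.
Proof.
move=> cc; elim: n => [|n ih]; first exact: rcont_cst.
by under eq_fun do rewrite exprS; apply: rcontM.
Qed.

Lemma kernel_cont01 n z : modc z < rho -> cont01 (fun t => psi t * kk (zt t) z ^+ n).
Proof.
by move=> zr t t01; apply: rcontM; [exact: cpsi|apply: rcontX; exact: rcont_kk].
Qed.

(** The density [psi] is arbitrary because the lemma serves both for [zt] alone, in [kernel_mean],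
    and for [F] times [zt], in Cauchy's formula. *)
Lemma kernel_cder n z : modc z < rho ->
  cder (fun z => ci (fun t => psi t * kk (zt t) z ^+ n)) z
       (n%:R * ci (fun t => psi t * kk (zt t) z ^+ n.+1)).
Proof.
(* On [|w| <= r] the kernel is bounded by [1 / (rho - r)], uniformly in [t]. *)
move=> zr; pose r := (modc z + rho) / 2.
have rr : r < rho by rewrite /r; lra.
have zr' : modc z <= r by rewrite /r; lra.
have U0 : 0 <= (rho - r)^-1 by rewrite invr_ge0 subr_ge0 ltW.
have [M M0 MH] := kkX_quad n U0.
have [Bp Bp0 BpH] : exists2 B : R, 0 <= B & forall t : R, 0 <= t <= 1 -> modc (psi t) <= B.
  have cre (t : R) : 0 <= t <= 1 -> {for t, continuous (fun t => complex.Re (psi t))} by move=> /cpsi/rcont_ReIm[].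
  have cim (t : R) : 0 <= t <= 1 -> {for t, continuous (fun t => complex.Im (psi t))} by move=> /cpsi/rcont_ReIm[].
  have [c1 _ h1] := @EVT_max R _ 0 1 ler01 (within01_cont (fun t h => cvg_norm (cre t h))).
  have [c2 _ h2] := @EVT_max R _ 0 1 ler01 (within01_cont (fun t h => cvg_norm (cim t h))).
  exists (`|complex.Re (psi c1)| + `|complex.Im (psi c2)|); first by rewrite addr_ge0.
  move=> t t01; rewrite (le_trans (modc_le_ReIm _))// lerD//.
    by have := h1 t; rewrite in_itv/=; apply.
  by have := h2 t; rewrite in_itv/=; apply.
rewrite -cint01Z; last exact: kernel_cont01.
apply: (@cint01_cder_quad _ _ z (r - modc z) (Bp * M)).
- by rewrite /r; lra.
- by rewrite mulr_ge0.
- move=> w wz; apply: kernel_cont01; apply: le_lt_trans rr.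
  by have := modcBB w z; lra.
- by move=> t t01; apply: rcontM; [exact: rcont_cst|exact: kernel_cont01].
move=> w t wz t01.
have wr : modc w <= r by have := modcBB w z; lra.
set a := kk _ w ^+ n; set b := kk _ z ^+ n; set c := kk _ z ^+ n.+1.
have -> : psi t * a - psi t * b - n%:R * (psi t * c) * (w - z) =
  psi t * (a - b - n%:R * c * (w - z)) by ring.
rewrite modcM -(mulrA Bp) ler_pM ?modc_ge0//; first exact: BpH.
by apply: MH; rewrite ?zt_neq// ?(le_lt_trans wr)// modc_kk.
Qed.

End Kernel.

(** As a function of [z] the mean has derivative [0], because the differentiated integrand
    [zt * kk^2] is, up to the factor [tpi], the [t]-derivative of the periodic function [- kk]. At
    [z = 0] the integrand is [1]. *)
Lemma kernel_mean (rho : R) z : 0 < rho -> modc z < rho ->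
  ci (fun t => zt rho t * kk (zt rho t) z) = 1.
Proof.
move=> rho0 zr.
have cz : cont01 (zt rho) by move=> t _; exact: rcont_zt.
pose W w := ci (fun t => zt rho t * kk (zt rho t) w ^+ 1).
have W' w : modc w < rho -> cder W w 0.
  move=> wr; have := kernel_cder rho0 cz 1 wr; move/cder_eq; apply.
  rewrite mul1r.
  have := @cint01_FTC _ (fun t => tpi * (zt rho t * kk (zt rho t) w ^+ 2)) (fun t => - kk (zt rho t) w) _ _.
  rewrite cint01Z; last exact: kernel_cont01.
  rewrite /zt expi0 expi1 subrr => /(_ _ _)/eqP.
  rewrite mulf_eq0 (negbTE tpi_neq0)/= => h; apply/eqP; apply: h.
    by move=> t t01; apply: rcontM; [exact: rcont_cst|exact: (kernel_cont01 rho0 cz)].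
  move=> t _.
  have d1 : rder (fun t => zt rho t - w) t (rho%:C * (tpi * expi t)).
    have := rderD (rderZ rho%:C (rder_expi t)) (rder_comp (rder_affine 0 0 t) (cder_cst (- w) _)).
    by rewrite mul0r addr0.
  have nz : zt rho t - w != 0 by rewrite subr_eq0 zt_neq.
  have := rder_comp (f := fun w => - w^-1) d1 (cderN (cderV nz)).
  by move/rder_eq; apply; rewrite opprK /kk /zt exprVn; ring.
transitivity (W z); first by apply: eq_cint01 => t _; rewrite expr1.
have path : ci (fun=> 0) = W (pt 0 z 1) - W (pt 0 z 0).
  apply: (@cint01_FTC _ _ (W \o pt 0 z)); first by move=> t _; exact: rcont_cst.
  move=> t t01; have := rder_comp (rder_affine 0 (z - 0) t) (W' (pt 0 z t) _).
  rewrite mul0r; apply; apply: modc_pt_lt => //; by rewrite ?modc0.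
move: path; rewrite cint01_cst pt0 pt1 => /esym/eqP; rewrite subr_eq0 => /eqP ->.
rewrite /W -[RHS](cint01_cst (1 : C)); apply: eq_cint01 => t _.
by rewrite expr1 /kk subr0 divff// zt_neq// modc0.
Qed.

(** The mean over the circle of [f (z + s (zeta - z)) zeta / (zeta - z)] is [f z] at [s = 0] and the
    Cauchy integral at [s = 1]. Its derivative in [s] is the mean of [f' zeta], which vanishes: for
    nonzero [s] it is, up to a constant, the integral of the [t]-derivative of a periodic function.
    Continuity of [der f] enters in the differentiation under the integral; [holo_cderiv] provides
    it. *)
Lemma Cauchy_C1 f (rho : R) z : analytic f -> ccontD1 (der f) -> 0 < rho -> rho < 1 -> modc z < rho ->
  f z = ci (fun t => f (zt rho t) * zt rho t * kk (zt rho t) z).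
Proof.
move=> hf cf' rho0 rho1 zr.
have /holoP df := hf.
pose k t := zt rho t * kk (zt rho t) z.
have ck : cont01 k by move=> t _; apply: rcontM; [exact: rcont_zt|exact: rcont_kk].
pose g s t : C := f (pt z (zt rho t) s) * k t.
pose g' s t : C := der f (pt z (zt rho t) s) * zt rho t.
(* Room for differentiating in [s] at the endpoints of [[0, 1]]: for [s] in [[- eta, 1 + eta]] the
   points stay in the disc of radius [rho + 2 eta < 1]. *)
pose eta := (1 - rho) / 4.
have eta0 : 0 < eta by rewrite /eta; lra.
pose r := rho + 2 * eta.
have r1 : r < 1 by rewrite /r /eta; lra.
have inD s t : - eta <= s <= 1 + eta -> modc (pt z (zt rho t) s) <= r.
  move=> s01.
  have [s0|s0] := leP s 0.
    have -> : pt z (zt rho t) s = z + s%:C * (zt rho t - z) by [].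
    rewrite (le_trans (modcD _ _))// modcM modc_real ler0_norm//.
    have zz : modc (zt rho t - z) <= 2 by have := modcB (zt rho t) z; rewrite modc_zt//; lra.
    have : - s * modc (zt rho t - z) <= eta * 2 by apply: ler_pM => //; rewrite ?modc_ge0//; lra.
    by rewrite /r; lra.
  have [s1|s1] := leP 1 s.
    have -> : pt z (zt rho t) s = zt rho t + (s - 1)%:C * (zt rho t - z).
      by rewrite /pt rmorphB/=; ring.
    rewrite (le_trans (modcD _ _))// modcM modc_real ger0_norm ?subr_ge0// modc_zt//.
    have zz : modc (zt rho t - z) <= 2 by have := modcB (zt rho t) z; rewrite modc_zt//; lra.
    have : (s - 1) * modc (zt rho t - z) <= eta * 2 by apply: ler_pM => //; rewrite ?modc_ge0//; lra.
    by rewrite /r; lra.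
  apply: modc_pt; first by rewrite !ltW.
    by rewrite /r; lra.
  by rewrite modc_zt// /r; lra.
have inD1 s t : - eta <= s <= 1 + eta -> modc (pt z (zt rho t) s) < 1.
  by move=> h; exact: le_lt_trans (inD s t h) r1.
have [B B0 BH] : exists2 B : R, 0 <= B & forall w, modc w <= r -> modc (der f w) <= B.
  by apply: ccont_bounded => w wr; apply: cf'; exact: le_lt_trans r1.
have rptt s t : rcont (fun t => pt z (zt rho t) s) t.
  apply: rcontD; first exact: rcont_cst.
  apply: rcontM; first exact: rcont_cst.
  by apply: rcontB; [exact: rcont_zt|exact: rcont_cst].
have cg s : - eta <= s <= 1 + eta -> cont01 (g s).
  move=> sI t t01; apply: rcontM; last exact: ck.
  apply: (@rcont_comp _ f (fun t => pt z (zt rho t) s)); last exact: rptt.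
  by apply: holo_cont => //; exact: inD1.
have cg' s : - eta <= s <= 1 + eta -> cont01 (g' s).
  move=> sI t t01; apply: rcontM; last exact: rcont_zt.
  apply: (@rcont_comp _ (der f) (fun t => pt z (zt rho t) s)); last exact: rptt.
  by apply: cf'; exact: inD1.
have dI s : 0 <= s <= 1 -> rder (fun s => ci (g s)) s (ci (g' s)).
  move=> s01; apply: (@cint01_DUI _ _ _ _ eta (B * rho)) => //.
  - move=> x; rewrite ltr_norml => xs; apply: cg; apply/andP; split; lra.
  - move=> x t; rewrite ltr_norml => xs t01.
    have xI : - eta <= x <= 1 + eta by apply/andP; split; lra.
    have := rder_comp (rder_affine z (zt rho t - z) x) (df _ (inD1 _ t xI)).
    move/(rderZ (k t)); under eq_fun do rewrite mulrC; move/rder_eq; apply.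
    rewrite /g' mulrCA; congr (_ * _); rewrite /k -mulrA /kk mulVf ?mulr1//.
    by rewrite subr_eq0 zt_neq.
  - move=> x t; rewrite ltr_norml => xs t01.
    have xI : - eta <= x <= 1 + eta by apply/andP; split; lra.
    by rewrite /g' modcM modc_zt// ler_wpM2r ?(ltW rho0)// BH// inD.
have I'0 s : 0 <= s <= 1 -> ci (g' s) = 0.
  move=> s01; have sI : - eta <= s <= 1 + eta by apply/andP; split; lra.
  have [->|s0] := eqVneq s 0.
    have -> : ci (g' 0) = ci (fun t => der f z * rho%:C * expi t).
      by apply: eq_cint01 => t _; rewrite /g' pt0 mulrA.
    rewrite (@cint01Z _ _ expi); last by move=> t _; exact: rcont_expi.
    have := @cint01_FTC R (fun t => tpi * expi t) expi _ _.
    rewrite (@cint01Z _ _ expi); last by move=> t _; exact: rcont_expi.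
    rewrite expi1 expi0 subrr => /(_ _ _)/eqP.
    rewrite mulf_eq0 (negbTE tpi_neq0)/= => h.
    have /eqP -> : ci (expi (R := R)) == 0; last by rewrite mulr0.
    apply: h; last by move=> t _; exact: rder_expi.
    by move=> t _; apply: rcontM; [exact: rcont_cst|exact: rcont_expi].
  have s00 : s%:C != 0 :> C by rewrite -modc_eq0 modc_real normr_eq0.
  have := @cint01_FTC _ (fun t => tpi * s%:C * g' s t) (fun t => f (pt z (zt rho t) s)) _ _.
  rewrite cint01Z; last exact: cg'.
  rewrite /zt expi0 expi1 subrr => /(_ _ _)/eqP.
  rewrite !mulf_eq0 (negbTE tpi_neq0) (negbTE s00)/= => h; apply/eqP; apply: h.
    by move=> t t01; apply: rcontM; [exact: rcont_cst|exact: cg'].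
  move=> t t01.
  have d1 : rder (fun t => pt z (zt rho t) s) t (s%:C * (rho%:C * (tpi * expi t))).
    have := rderD (rderZ s%:C (rderZ rho%:C (rder_expi t))) (rder_comp (rder_affine 0 0 t) (cder_cst (z - s%:C * z) _)).
    rewrite mul0r addr0; congr rder; apply/funext => x.
    by rewrite /pt /zt/=; ring.
  have := rder_comp d1 (df _ (inD1 s t sI)).
  by move/rder_eq; apply; rewrite /g' /zt; ring.
have := @cint01_FTC _ (fun=> 0) (fun s => ci (g s)) _ _.
rewrite cint01_cst => /(_ _ _)/eqP; rewrite eq_sym subr_eq0 => h.
have /eqP h1 : ci (g 1) == ci (g 0).
  apply: h; first by move=> t _; exact: rcont_cst.
  by move=> s s01; rewrite -(I'0 _ s01); exact: dI.
transitivity (ci (g 0)).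
  transitivity (ci (fun t => f z * k t)); last by apply: eq_cint01 => t _; rewrite /g pt0.
  by rewrite cint01Z// kernel_mean// mulr1.
by rewrite -h1; apply: eq_cint01 => t _; rewrite /g pt1 mulrA.
Qed.

End CauchyKernel.

(** * Regularity of analytic functions, Cauchy estimates and analytic parameter integrals *)

Section Holomorphic.
Context {R : realType}.
Local Notation C := R[i].
Implicit Types (f g F : C -> C) (z w : C).

Definition eqD f g := forall z, modc z < 1 -> f z = g z.

Lemma modc_near z w (r : R) : modc z < r -> modc (w - z) < r - modc z -> modc w < r.
Proof. by have := modcBB w z; move=> ? ? ?; lra. Qed.

Lemma cder_eqD f g z l : eqD f g -> modc z < 1 -> cder f z l -> cder g z l.
Proof.
move=> fg z1; apply: (@cder_ext _ _ _ _ _ (1 - modc z)); first by rewrite subr_gt0.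
by move=> w /(modc_near z1); exact: fg.
Qed.

Lemma cder_eq_ball f g z l (r : R) : (forall w, modc w < r -> f w = g w) -> modc z < r ->
  cder f z l -> cder g z l.
Proof.
move=> fg z1; apply: (@cder_ext _ _ _ _ _ (r - modc z)); first by rewrite subr_gt0.
by move=> w /(modc_near z1); exact: fg.
Qed.

Lemma eqD_sym f g : eqD f g -> eqD g f. Proof. by move=> H z /H. Qed.

Lemma holo_eqD f g : eqD f g -> analytic f -> analytic g.
Proof.
move=> fg /holoP hf; apply: (@holo_cder _ _ (der f)) => z z1.
by apply: cder_eqD (hf z z1).
Qed.

Lemma cderiv_eqD f g : eqD f g -> analytic f -> eqD (der f) (der g).
Proof.
by move=> fg /holoP hf z z1; rewrite (cder_cderiv (cder_eqD fg z1 (hf z z1))).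
Qed.

Lemma Cauchy_form_cder F (rho : R) z : analytic F -> ccontD1 (der F) -> 0 < rho -> rho < 1 ->
  modc z < rho ->
  cder F z (ci (fun t => F (zt rho t) * zt rho t * kk (zt rho t) z ^+ 2)).
Proof.
move=> hF cF r0 r1 zr.
have cpsi : cont01 (fun t => F (zt rho t) * zt rho t).
  move=> t t01; apply: rcontM; last exact: rcont_zt.
  by apply: (@rcont_comp _ F); [apply: holo_cont => //; rewrite modc_zt|exact: rcont_zt].
have := kernel_cder r0 cpsi 1 zr; rewrite mul1r.
apply: cder_eq_ball zr => w wr.
by rewrite (Cauchy_C1 hF cF r0 r1 wr); apply: eq_cint01 => t _; rewrite expr1.
Qed.

(** A primitive [F] of [f] has a continuous derivative, so [Cauchy_C1] applies to [F]. Hence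
    [f = F'] is an integral of the squared kernel, which can be differentiated twice more. *)
Theorem holo_cderiv f : analytic f -> analytic (der f).
Proof.
move=> hf; pose F := seg f 0.
have dF z : modc z < 1 -> cder F z (f z) by exact: holo_primitive.
have hF : analytic F by exact: holo_cder dF.
have F'f : eqD f (der F) by move=> z z1; rewrite (cder_cderiv (dF z z1)).
have cF : ccontD1 (der F).
  by move=> z z1; apply: holo_cont => //; apply: holo_eqD hf.
pose psi rho t := F (zt rho t) * zt rho t.
pose rho z := (modc z + 1) / 2.
have rhoP z : modc z < 1 -> [/\ 0 < rho z, rho z < 1 & modc z < rho z].
  by move=> z1; rewrite /rho; have := modc_ge0 z; split; lra.
have cpsi r : 0 < r -> r < 1 -> cont01 (psi r).
  move=> r0 r1 t t01; apply: rcontM; last exact: rcont_zt.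
  by apply: (@rcont_comp _ F); [apply: holo_cont => //; rewrite modc_zt|exact: rcont_zt].
have f2 r w : 0 < r -> r < 1 -> modc w < r ->
    f w = ci (fun t => psi r t * kk (zt r t) w ^+ 2).
  move=> r0 r1 wr; have w1 := lt_trans wr r1.
  by rewrite (F'f w w1) (cder_cderiv (Cauchy_form_cder hF cF r0 r1 wr)).
have f3 r w : 0 < r -> r < 1 -> modc w < r ->
    der f w = 2%:R * ci (fun t => psi r t * kk (zt r t) w ^+ 3).
  move=> r0 r1 wr; apply: cder_cderiv.
  by apply: cder_eq_ball wr (kernel_cder r0 (cpsi _ r0 r1) 2 wr) => v vr; rewrite -f2.
apply: (@holo_cder _ _ (fun z => 2%:R * (3%:R * ci (fun t => psi (rho z) t * kk (zt (rho z) t) z ^+ 4)))).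
move=> z z1; have [r0 r1 zr] := rhoP z z1.
apply: cder_eq_ball zr (cderZ _ (kernel_cder r0 (cpsi _ r0 r1) 3 zr)) => v vr.
by rewrite -f3.
Qed.

Lemma holo_ccont f : analytic f -> ccontD1 f.
Proof. by move=> hf z; exact: holo_cont. Qed.

Theorem Cauchy f (rho : R) z : analytic f -> 0 < rho -> rho < 1 -> modc z < rho ->
  f z = ci (fun t => f (zt rho t) * zt rho t * kk (zt rho t) z).
Proof. by move=> hf; apply: Cauchy_C1 => //; apply/holo_ccont/holo_cderiv. Qed.

Theorem Cauchy_cderiv f (rho : R) z : analytic f -> 0 < rho -> rho < 1 -> modc z < rho ->
  der f z = ci (fun t => f (zt rho t) * zt rho t * kk (zt rho t) z ^+ 2).
Proof.
move=> hf r0 r1 zr; apply: cder_cderiv.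
by apply: Cauchy_form_cder => //; apply/holo_ccont/holo_cderiv.
Qed.

Lemma circle_cont01 f (rho : R) : analytic f -> 0 < rho -> rho < 1 ->
  cont01 (fun t => f (zt rho t) * zt rho t).
Proof.
move=> hf r0 r1 t t01; apply: rcontM; last exact: rcont_zt.
by apply: (@rcont_comp _ f); [apply: holo_cont => //; rewrite modc_zt|exact: rcont_zt].
Qed.

Lemma Cauchy_estimate (r rho : R) : 0 <= r -> r < rho -> rho < 1 -> exists2 M : R, 0 <= M &
  forall f (B : R), analytic f -> (forall z, modc z <= rho -> modc (f z) <= B) ->
  (forall z, modc z <= r -> modc (der f z) <= M * B) /\
  (forall z w, modc z <= r -> modc w <= r ->
     modc (f w - f z - der f z * (w - z)) <= M * B * modc (w - z) ^+ 2).
Proof.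
move=> r0 rr r1; have rho0 : 0 < rho by lra.
set U := (rho - r)^-1; have U0 : 0 <= U by rewrite invr_ge0 subr_ge0 ltW.
have [M1 M10 M1H] := kkX_quad 1 U0.
exists (2 * (rho * (U ^+ 2 + M1))).
  apply: mulr_ge0 => //; apply: mulr_ge0; first exact: ltW.
  by apply: addr_ge0 => //; exact: exprn_ge0.
move=> f B hf fB.
have B0 : 0 <= B by apply: le_trans (fB 0 _); rewrite ?modc_ge0// modc0 ltW.
have cpsi := circle_cont01 hf rho0 r1.
have psiB t : modc (f (zt rho t) * zt rho t) <= B * rho.
  by rewrite modcM modc_zt// ler_wpM2r ?(ltW rho0)// fB// modc_zt.
have zr z : modc z <= r -> modc z < rho by move=> ?; lra.
have ck2 z : modc z <= r -> cont01 (fun t => f (zt rho t) * zt rho t * kk (zt rho t) z ^+ 2).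
  by move=> ?; apply: kernel_cont01 => //; exact: zr.
have ck1 z : modc z <= r -> cont01 (fun t => f (zt rho t) * zt rho t * kk (zt rho t) z).
  move=> zr1; have := kernel_cont01 rho0 cpsi 1 (zr _ zr1).
  by under [X in cont01 X]eq_fun do rewrite expr1.
have E : 2 * (rho * (U ^+ 2 + M1)) * B = 2 * (B * rho * (U ^+ 2 + M1)) by ring.
split=> [z zr1|z w zr1 wr1].
  rewrite (Cauchy_cderiv hf rho0 r1 (zr _ zr1)) E.
  apply: cint01_bound; first exact: ck2.
  move=> t _; rewrite modcM; apply: ler_pM; rewrite ?modc_ge0//.
  rewrite modcX; apply: (@le_trans _ _ (U ^+ 2)); last by rewrite lerDl.
  by rewrite lerXn2r ?nnegrE ?modc_ge0// modc_kk.
rewrite (Cauchy_cderiv hf rho0 r1 (zr _ zr1)) (Cauchy hf rho0 r1 (zr _ zr1)).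
rewrite (Cauchy hf rho0 r1 (zr _ wr1)) mulrC -cint01Z; last exact: ck2.
rewrite -cint01B; [|exact: ck1..].
rewrite -cint01B; last 2 first.
- by move=> t t01; apply: rcontB; [exact: ck1|exact: ck1].
- by move=> t t01; apply: rcontM; [exact: rcont_cst|exact: ck2].
rewrite E -mulrA; apply: cint01_bound.
  move=> t t01; apply: rcontB; first by apply: rcontB; exact: ck1.
  by apply: rcontM; [exact: rcont_cst|exact: ck2].
move=> t _; set a := f _ * _.
have -> : a * kk (zt rho t) w - a * kk (zt rho t) z - (w - z) * (a * kk (zt rho t) z ^+ 2) =
  a * (kk (zt rho t) w ^+ 1 - kk (zt rho t) z ^+ 1 - 1%:R * kk (zt rho t) z ^+ 2 * (w - z)) by ring.
rewrite modcM -(mulrA (B * rho)); apply: ler_pM; rewrite ?modc_ge0//; first exact: psiB.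
apply: le_trans (M1H _ _ _ _ _ _ _) _; rewrite ?zt_neq ?zr// ?modc_kk//.
by rewrite ler_wpM2r ?exprn_ge0 ?modc_ge0// lerDr exprn_ge0.
Qed.

Lemma cont01_clamp (c : R -> C) : cont01 c -> forall t, rcont (c \o clamp) t.
Proof.
move=> cc t; have /rcont_ReIm[h1 h2] := cc (clamp t) (clamp_bnd t).
apply/rcont_ReIm; split.
  by apply: (@continuous_comp _ _ _ clamp (fun s => complex.Re (c s))); [exact: clamp_cont|exact: h1].
by apply: (@continuous_comp _ _ _ clamp (fun s => complex.Im (c s))); [exact: clamp_cont|exact: h2].
Qed.

(** Separate regularity and a local bound suffice: Cauchy estimates, with a constant independent of
    [t], give the quadratic remainder needed to differentiate under the integral. *)
Lemma holo_cint01 (phi : C -> R -> C) :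
  (forall t : R, 0 <= t <= 1 -> analytic (phi ^~ t)) ->
  (forall z, modc z < 1 -> cont01 (phi z)) ->
  (forall r : R, r < 1 -> exists B : R, forall z (t : R), modc z <= r -> 0 <= t <= 1 -> modc (phi z t) <= B) ->
  analytic (fun z => ci (phi z)).
Proof.
move=> hphi0 cphi0 bphi0.
pose psi z t := phi z (clamp t).
have hphi t : analytic (psi ^~ t) by apply: hphi0; exact: clamp_bnd.
have cphi z t : modc z < 1 -> rcont (psi z) t by move=> /cphi0 /cont01_clamp; exact.
have bphi r : r < 1 -> exists B : R, forall z t, modc z <= r -> modc (psi z t) <= B.
  by move=> /bphi0[B BH]; exists B => z t zr; apply: BH => //; exact: clamp_bnd.
have -> : (fun z => ci (phi z)) = (fun z => ci (psi z)).
  by apply/funext => z; apply: eq_cint01 => t t01; rewrite /psi clamp_id.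
clearbody psi; clear hphi0 cphi0 bphi0.
apply: (@holo_cder _ _ (fun z => ci (fun t => der (psi ^~ t) z))) => z z1.
pose r := modc z + (1 - modc z) / 3; pose rho := modc z + 2 * (1 - modc z) / 3.
have zm := modc_ge0 z.
have r0 : 0 <= r by rewrite /r; lra.
have rr : r < rho by rewrite /r /rho; lra.
have rho1 : rho < 1 by rewrite /rho; lra.
have [M M0 MH] := Cauchy_estimate r0 rr rho1.
have [B BH] := bphi rho rho1.
have zr : modc z <= r by rewrite /r; lra.
have B0 : 0 <= B by apply: le_trans (BH 0 0 _); rewrite ?modc_ge0// modc0; lra.
have H t w : modc w <= r -> modc (psi w t - psi z t - der (psi ^~ t) z * (w - z)) <= M * B * modc (w - z) ^+ 2.
  by move=> wr; have [_ h] := MH _ B (hphi t) (BH^~ t); exact: h.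
apply: (@cint01_cder_quad _ psi _ z (r - modc z) (M * B)).
- by rewrite /r; lra.
- exact: mulr_ge0.
- move=> w wz t _; apply: cphi; have := modc_near (_ : modc z < r) wz; rewrite /r; lra.
- move=> t _ e e0.
  (* Continuity in [t] of the [z]-derivative: it is approximated, uniformly in [t], by the
     difference quotient between [z] and [w = z + h], which is continuous in [t]. The two remainders
     and the two variations each cost [e h / 4]. *)
  pose h := Num.min (e / (4 * (M * B + 1))) ((1 - modc z) / 3).
  have MB1 : 0 < 4 * (M * B + 1) by rewrite mulr_gt0// ltr_wpDl// mulr_ge0.
  have h0 : 0 < h by rewrite /h lt_min divr_gt0//=; lra.
  pose w := z + h%:C.
  have wz : modc (w - z) = h by rewrite /w addrC addKr modc_real gtr0_norm.
  have wr : modc w <= r.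
    rewrite (le_trans (modcD _ _))// modc_real gtr0_norm// lerD2l /h.
    by rewrite ge_min lexx orbT.
  have w1 : modc w < 1 by lra.
  have eh : 0 < e * h / 4 by rewrite divr_gt0// mulr_gt0.
  have [d1 d10 D1] := cphi w t w1 _ eh.
  have [d2 d20 D2] := cphi z t z1 _ eh.
  exists (Num.min d1 d2); first by rewrite lt_min d10.
  move=> s; rewrite lt_min => /andP[/D1 s1 /D2 s2].
  have hs := H s w wr; have ht := H t w wr; rewrite wz in hs ht.
  have MBh : M * B * h ^+ 2 <= e / 4 * h.
    have hh : h * (4 * (M * B + 1)) <= e.
      by rewrite -ler_pdivlMr// /h ge_min lexx.
    have h3 : M * B * h <= e / 4 by lra.
    by rewrite expr2 mulrA; apply: ler_wpM2r => //; exact: ltW.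
  have E : (der (psi ^~ s) z - der (psi ^~ t) z) * (w - z) =
     (psi w t - psi z t - der (psi ^~ t) z * (w - z))
     - (psi w s - psi z s - der (psi ^~ s) z * (w - z))
     + (psi w s - psi w t) - (psi z s - psi z t) by ring.
  have : modc ((der (psi ^~ s) z - der (psi ^~ t) z) * (w - z)) <= e * h.
    rewrite E; apply: (le_trans (modcB _ _)).
    apply: (le_trans (lerD (modcD _ _) (lexx _))).
    apply: (le_trans (lerD (lerD (modcB _ _) (lexx _)) (lexx _))).
    by clear -hs ht s1 s2 MBh; lra.
  by rewrite modcM wz ler_pM2r.
- move=> w t wz _; apply: H; have := modcBB w z; lra.
Qed.

Lemma holoD f g : analytic f -> analytic g -> analytic (fun z => f z + g z).
Proof. by move=> /holoP a /holoP b; apply: holo_cder => z z1; apply: cderD; [exact: a|exact: b]. Qed.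
Lemma holoB f g : analytic f -> analytic g -> analytic (fun z => f z - g z).
Proof. by move=> /holoP a /holoP b; apply: holo_cder => z z1; apply: cderB; [exact: a|exact: b]. Qed.
Lemma holoM f g : analytic f -> analytic g -> analytic (fun z => f z * g z).
Proof. by move=> /holoP a /holoP b; apply: holo_cder => z z1; apply: cderM; [exact: a|exact: b]. Qed.
Lemma holo_cst (a : C) : analytic (fun=> a).
Proof. by apply: holo_cder => z z1; exact: cder_cst. Qed.
Lemma holo_id : analytic (fun z : C => z).
Proof. by apply: holo_cder => z z1; exact: cder_id. Qed.
Lemma holoZ (a : C) f : analytic f -> analytic (fun z => a * f z).
Proof. by move=> hf; apply: holoM => //; exact: holo_cst. Qed.
Lemma holoX f n : analytic f -> analytic (fun z => f z ^+ n).
Proof.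
move=> hf; elim: n => [|n ih]; first exact: holo_cst.
by under eq_fun do rewrite exprS; exact: holoM.
Qed.

Lemma holo_comp f g : analytic f -> analytic g -> (forall z, modc z < 1 -> modc (g z) < 1) ->
  analytic (f \o g).
Proof.
move=> /holoP a /holoP b gD; apply: holo_cder => z z1.
by apply: cder_comp; [exact: b|apply: a; exact: gD].
Qed.

Lemma modc_scale (a z : C) : modc a <= 1 -> modc z < 1 -> modc (a * z) < 1.
Proof.
by move=> a1 z1; rewrite modcM (le_lt_trans _ z1)// ler_piMl ?modc_ge0.
Qed.

Definition dil (a : C) f : C -> C := fun z => f (a * z).

Lemma cder_dil (a : C) f z l : cder f (a * z) l -> cder (dil a f) z (a * l).
Proof.
move=> H; have := @cder_comp _ f (fun z => a * z) z a l _ H.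
rewrite mulrC; apply; have := cderZ a (cder_id z); by rewrite mulr1.
Qed.

Lemma holo_dil (a : C) f : modc a <= 1 -> analytic f -> analytic (dil a f).
Proof.
move=> a1 /holoP hf; apply: (@holo_cder _ _ (fun z => a * der f (a * z))) => z z1.
by apply: cder_dil; apply: hf; exact: modc_scale.
Qed.

Lemma cderiv_dil (a : C) f z : modc a <= 1 -> analytic f -> modc z < 1 ->
  der (dil a f) z = a * der f (a * z).
Proof.
move=> a1 /holoP hf z1; apply: cder_cderiv; apply: cder_dil.
by apply: hf; exact: modc_scale.
Qed.

Lemma primitive_uniq f F G : analytic f -> (forall z, modc z < 1 -> cder F z (f z)) ->
  (forall z, modc z < 1 -> cder G z (f z)) -> F 0 = G 0 -> eqD F G.
Proof.
move=> /holo_ccont cf dF dG FG z z1.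
have o1 : modc (0 : C) < 1 by rewrite modc0.
have := seg_FTC cf o1 z1 dF; rewrite (seg_FTC cf o1 z1 dG) FG => /eqP.
by rewrite (inj_eq (addIr _)) => /eqP.
Qed.

End Holomorphic.

(** * The operators S and T *)

Section Operators.
Context {R : realType}.
Local Notation C := R[i].
Implicit Types (f g h : C -> C) (z w : C).

(** Opaque copies of [Sop] and [Top], for the same reason as [der] and [ci]. *)
Fact SS_key : {S : (C -> C) -> (C -> C) -> C -> C | S = @Sop R}.
Proof. by exists (@Sop R). Qed.
Definition SS := sval SS_key.
Lemma SSE : SS = @Sop R. Proof. exact: (svalP SS_key). Qed.

Fact TT_key : {T : (C -> C) -> (C -> C) -> C -> C | T = @Top R}.
Proof. by exists (@Top R). Qed.
Definition TT := sval TT_key.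
Lemma TTE : TT = @Top R. Proof. exact: (svalP TT_key). Qed.

Lemma pt0E z t : pt (0 : C) z t = t%:C * z.
Proof. by rewrite /pt subr0 add0r. Qed.

Lemma Sop_seg g f z : SS g f z = seg (fun z => der f z * g z) 0 z.
Proof. by rewrite SSE /Sop -ciE -derE /seg; apply: eq_cint01 => t _; rewrite pt0E subr0. Qed.

Lemma Top_seg g f z : TT g f z = seg (fun z => f z * der g z) 0 z.
Proof. by rewrite TTE /Top -ciE -derE /seg; apply: eq_cint01 => t _; rewrite pt0E subr0. Qed.

Lemma cder_Sop g f z : analytic g -> analytic f -> modc z < 1 -> cder (SS g f) z (der f z * g z).
Proof.
move=> hg hf z1; have -> : SS g f = seg (fun z => der f z * g z) 0.
  by apply/funext => w; exact: Sop_seg.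
by apply: (@holo_primitive _ (fun z => der f z * g z)) => //; apply: holoM => //; exact: holo_cderiv.
Qed.

Lemma cder_Top g f z : analytic g -> analytic f -> modc z < 1 -> cder (TT g f) z (f z * der g z).
Proof.
move=> hg hf z1; have -> : TT g f = seg (fun z => f z * der g z) 0.
  by apply/funext => w; exact: Top_seg.
by apply: (@holo_primitive _ (fun z => f z * der g z)) => //; apply: holoM => //; exact: holo_cderiv.
Qed.

Lemma holo_Sop g f : analytic g -> analytic f -> analytic (SS g f).
Proof. by move=> hg hf; apply: holo_cder => z; exact: cder_Sop. Qed.

Lemma holo_Top g f : analytic g -> analytic f -> analytic (TT g f).
Proof. by move=> hg hf; apply: holo_cder => z; exact: cder_Top. Qed.

Lemma cint01_0 (h : R -> C) : (forall t : R, 0 <= t <= 1 -> h t = 0) -> ci h = 0.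
Proof. by move=> h0; rewrite (eq_cint01 (h2 := fun=> 0)) ?cint01_cst. Qed.

Lemma Sop0 g f : SS g f 0 = 0.
Proof. by rewrite Sop_seg /seg; apply: cint01_0 => t _; rewrite subrr mulr0. Qed.

Lemma Top0 g f : TT g f 0 = 0.
Proof. by rewrite Top_seg /seg; apply: cint01_0 => t _; rewrite subrr mulr0. Qed.

Lemma Sop_uniq g f F : analytic g -> analytic f -> F 0 = 0 ->
  (forall z, modc z < 1 -> cder F z (der f z * g z)) -> eqD F (SS g f).
Proof.
move=> hg hf F0 dF; apply: (@primitive_uniq _ (fun z => der f z * g z)) => //.
- by apply: holoM => //; exact: holo_cderiv.
- by move=> z; exact: cder_Sop.
- by rewrite Sop0.
Qed.

Lemma Top_uniq g f F : analytic g -> analytic f -> F 0 = 0 ->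
  (forall z, modc z < 1 -> cder F z (f z * der g z)) -> eqD F (TT g f).
Proof.
move=> hg hf F0 dF; apply: (@primitive_uniq _ (fun z => f z * der g z)) => //.
- by apply: holoM => //; exact: holo_cderiv.
- by move=> z; exact: cder_Top.
- by rewrite Top0.
Qed.

Lemma modc_tz (t : R) z : 0 <= t <= 1 -> modc z < 1 -> modc (t%:C * z) < 1.
Proof.
by move=> /andP[t0 t1]; apply: modc_scale; rewrite modc_real ger0_norm.
Qed.

Lemma Sop_congr g f1 f2 : analytic f1 -> eqD f1 f2 -> eqD (SS g f1) (SS g f2).
Proof.
move=> h1 f12 z z1; rewrite !Sop_seg /seg; apply: eq_cint01 => t t01.
by rewrite pt0E (cderiv_eqD f12 h1) ?modc_tz.
Qed.

Lemma Top_congr g f1 f2 : eqD f1 f2 -> eqD (TT g f1) (TT g f2).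
Proof.
by move=> f12 z z1; rewrite !Top_seg /seg; apply: eq_cint01 => t t01; rewrite pt0E f12 ?modc_tz.
Qed.

(** Integration by parts; it transfers both bounds and analytic dependence on parameters between
    [SS] and [TT]. *)
Lemma Top_parts g f : analytic g -> analytic f ->
  eqD (TT g f) (fun z => f z * g z - f 0 * g 0 - SS g f z).
Proof.
move=> hg hf; have /holoP dg := hg; have /holoP df := hf.
apply: eqD_sym; apply: Top_uniq => // [|z z1]; first by rewrite Sop0 subrr subr0.
have := cderB (cderB (cderM (df z z1) (dg z z1)) (cder_cst (f 0 * g 0) z)) (cder_Sop hg hf z1).
by move/cder_eq; apply; ring.
Qed.

(** Both sides vanish at [0] and have derivative [2 (S_g f) f' g]. *)
Lemma Sop_sqr g f : analytic g -> analytic f ->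
  eqD (fun z => SS g f z ^+ 2)
      (fun z => 2 * SS g (fun z => SS g f z * f z) z - SS g (SS g (fun z => f z ^+ 2)) z).
Proof.
move=> hg hf; set F := SS g f; have hF : analytic F by exact: holo_Sop.
have hFf : analytic (fun z => F z * f z) by exact: holoM.
have hf2 : analytic (fun z => f z ^+ 2) by exact: holoX.
have hS2 : analytic (SS g (fun z => f z ^+ 2)) by exact: holo_Sop.
have /holoP df := hf.
apply: (@primitive_uniq _ (fun z => 2 * (F z * (der f z * g z)))).
- by apply: holoZ; apply: holoM => //; apply: holoM => //; exact: holo_cderiv.
- move=> z z1; have := cderM (cder_Sop hg hf z1) (cder_Sop hg hf z1).
  by under [X in cder X _ _ -> _]eq_fun do rewrite -expr2; move/cder_eq; apply; rewrite -/F; ring.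
- move=> z z1.
  have d1 := cderZ 2 (cder_Sop hg hFf z1); have d2 := cder_Sop hg hS2 z1.
  move/cder_eq: (cderB d1 d2); apply.
  rewrite (cder_cderiv (cderM (cder_Sop hg hf z1) (df z z1))).
  rewrite (cder_cderiv (cder_Sop hg hf2 z1)).
  have -> : der (fun z => f z ^+ 2) z = 2 * f z * der f z.
    apply: cder_cderiv; have := cderM (df z z1) (df z z1).
    by under [X in cder X _ _ -> _]eq_fun do rewrite -expr2; move/cder_eq; apply; ring.
  by rewrite -/F; ring.
- by rewrite /F !Sop0 expr0n/= mulr0 subrr.
Qed.

(** Moves the symbol into the function, so that only the symbol [z] has to be studied. *)
Lemma Top_mul_id g h : analytic g -> analytic h -> eqD (TT g h) (TT id (fun z => h z * der g z)).
Proof.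
move=> hg hh; have hk : analytic (fun z => h z * der g z) by apply: holoM => //; exact: holo_cderiv.
apply: Top_uniq => // [||z z1]; first exact: holo_id.
  exact: Top0.
by apply: cder_eq (cder_Top hg hh z1) _; rewrite (cder_cderiv (cder_id z)) mulr1.
Qed.

(** Source of the gain [1 / (n + 1)]: the symbol [z^(n+1)] on the right is bounded by [1] for every
    [n]. *)
Lemma Top_id_pow n h : analytic h ->
  eqD (TT id (fun z => z ^+ n * h z)) (fun z => (n.+1%:R)^-1 * TT (fun z => z ^+ n.+1) h z).
Proof.
move=> hh; have hz : analytic (fun z : C => z ^+ n.+1) by apply: holoX; exact: holo_id.
have hzh : analytic (fun z : C => z ^+ n * h z) by apply: holoM => //; apply: holoX; exact: holo_id.
apply: eqD_sym; apply: Top_uniq => // [||z z1]; first exact: holo_id.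
  by rewrite Top0 mulr0.
apply: cder_eq (cderZ _ (cder_Top hz hh z1)) _.
rewrite (cder_cderiv (cderX n.+1 z)) (cder_cderiv (cder_id z)) mulr1.
have : n.+1%:R != 0 :> C by rewrite pnatr_eq0.
by rewrite /=; set k := n.+1%:R => k0; field.
Qed.

(** The quotient [(f z - f 0) / z], written as an integral of the derivative so as to be analytic at
    [0]. *)
Definition dvz f : C -> C := fun z => ci (fun t => der f (t%:C * z)).

Lemma rcont_mulr (a : C) t : rcont (fun t => t%:C * a) t.
Proof. by have := rder_cont (rder_affine 0 a t); under [X in rcont X]eq_fun do rewrite add0r. Qed.

Lemma dvz_cont f z : analytic f -> modc z < 1 -> cont01 (fun t => der f (t%:C * z)).
Proof.
move=> hf z1 t t01; apply: (@rcont_comp _ (der f) (fun t => t%:C * z)); last exact: rcont_mulr.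
by apply: holo_cont; [exact: holo_cderiv|exact: modc_tz].
Qed.

Lemma holo_dvz f : analytic f -> analytic (dvz f).
Proof.
move=> hf; apply: (@holo_cint01 _ (fun z t => der f (t%:C * z))).
- move=> t /andP[t0 t1]; apply: (@holo_dil _ t%:C); last exact: holo_cderiv.
  by rewrite modc_real ger0_norm.
- by move=> z z1; exact: dvz_cont.
- move=> r r1; have [B B0 BH] := @ccont_bounded _ (der f) r (fun z zr => holo_ccont (holo_cderiv hf) (le_lt_trans zr r1)).
  exists B => z t zr /andP[t0 t1]; apply: BH; rewrite modcM modc_real ger0_norm//.
  by rewrite (le_trans _ zr)// ler_piMl ?modc_ge0.
Qed.

Lemma dvzE f z : analytic f -> modc z < 1 -> z * dvz f z = f z - f 0.
Proof.
move=> hf z1; have o1 : modc (0 : C) < 1 by rewrite modc0.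
rewrite -(seg_FTC (holo_ccont (holo_cderiv hf)) o1 z1 (iffLR (holoP f) hf)).
rewrite /dvz -cint01Z; last exact: dvz_cont.
by apply: eq_cint01 => t _; rewrite pt0E subr0 mulrC.
Qed.

Lemma SopD g f1 f2 : analytic g -> analytic f1 -> analytic f2 ->
  eqD (SS g (fun z => f1 z + f2 z)) (fun z => SS g f1 z + SS g f2 z).
Proof.
move=> hg h1 h2; apply: eqD_sym; apply: Sop_uniq => //; first exact: holoD.
  by rewrite !Sop0 addr0.
move=> z z1; apply: cder_eq (cderD (cder_Sop hg h1 z1) (cder_Sop hg h2 z1)) _.
have /holoP d1 := h1; have /holoP d2 := h2.
by rewrite (cder_cderiv (cderD (d1 z z1) (d2 z z1))) mulrDl.
Qed.

Lemma SopZ g f (a : C) : analytic g -> analytic f ->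
  eqD (SS g (fun z => a * f z)) (fun z => a * SS g f z).
Proof.
move=> hg h1; apply: eqD_sym; apply: Sop_uniq => //; first exact: holoZ.
  by rewrite Sop0 mulr0.
move=> z z1; apply: cder_eq (cderZ a (cder_Sop hg h1 z1)) _.
have /holoP d1 := h1.
by rewrite (cder_cderiv (cderZ a (d1 z z1))) mulrA.
Qed.

Lemma TopD g f1 f2 : analytic g -> analytic f1 -> analytic f2 ->
  eqD (TT g (fun z => f1 z + f2 z)) (fun z => TT g f1 z + TT g f2 z).
Proof.
move=> hg h1 h2; apply: eqD_sym; apply: Top_uniq => //; first exact: holoD.
  by rewrite !Top0 addr0.
move=> z z1; apply: cder_eq (cderD (cder_Top hg h1 z1) (cder_Top hg h2 z1)) _.
by rewrite mulrDl.
Qed.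

Lemma TopZ g f (a : C) : analytic g -> analytic f ->
  eqD (TT g (fun z => a * f z)) (fun z => a * TT g f z).
Proof.
move=> hg h1; apply: eqD_sym; apply: Top_uniq => //; first exact: holoZ.
  by rewrite Top0 mulr0.
by move=> z z1; apply: cder_eq (cderZ a (cder_Top hg h1 z1)) _; rewrite mulrA.
Qed.

End Operators.

(** * Laplacians and circle means *)

Section RealDiff.
Context {R : realType}.
Implicit Types (f g : R -> R) (t : R).
Local Notation mu := (@lebesgue_measure R).

Lemma rdiffD f g t a b : rdiff f t a -> rdiff g t b -> rdiff (fun s => f s + g s) t (a + b).
Proof. by move=> h1 h2; exact: (@is_deriveD _ _ _ f g t 1 a b h1 h2). Qed.

Lemma rdiffM f g t a b : rdiff f t a -> rdiff g t b ->
  rdiff (fun s => f s * g s) t (a * g t + f t * b).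
Proof.
move=> h1 h2; apply: is_derive_eq (@is_deriveM _ _ f g t 1 a b h1 h2) _.
by rewrite addrC ![_ *: _]mulrC [b * _]mulrC.
Qed.

Lemma rdiff_cst (a : R) t : rdiff (fun=> a) t 0.
Proof. exact: is_derive_cst. Qed.

Lemma rdiff_id t : rdiff id t 1.
Proof. exact: is_derive_id. Qed.

Lemma rdiffZ (c : R) f t a : rdiff f t a -> rdiff (fun s => c * f s) t (c * a).
Proof. by move=> h; have := rdiffM (rdiff_cst c t) h; rewrite mul0r add0r. Qed.

Lemma rdiff_eq f t a b : rdiff f t a -> a = b -> rdiff f t b.
Proof. by move=> ? <-. Qed.

Lemma rdiff_powR f t a (q : R) : 0 < f t -> rdiff f t a ->
  rdiff (fun s => f s `^ q) t (q * f t `^ (q - 1) * a).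
Proof.
by move=> f0 h; exact: (@is_derive1_comp _ (fun x => x `^ q) f t _ _ (is_derive1_powR q f0) h).
Qed.

Lemma rdiff_cont f t a : rdiff f t a -> {for t, continuous f}.
Proof. by move=> [d _]; exact/differentiable_continuous/derivable1_diffP. Qed.

Lemma continuous_powR f t (q : R) : 0 < f t -> {for t, continuous f} ->
  {for t, continuous (fun s => f s `^ q)}.
Proof.
move=> f0 cf; apply: (@continuous_comp _ _ _ f (fun x => x `^ q)) => //.
exact: (rdiff_cont (is_derive1_powR q f0)).
Qed.

Lemma rdiff_mono f df (a b : R) : a <= b ->
  (forall x, a <= x <= b -> rdiff f x (df x)) ->
  (forall x, a < x < b -> 0 <= df x) -> f a <= f b.
Proof.
rewrite le_eqVlt => /predU1P[->//|ab] dF df0.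
have [||c] := @MVT _ f df a b ab.
- by move=> x; rewrite in_itv/= => /andP[h1 h2]; apply: dF; rewrite !ltW.
- apply: continuous_in_subspaceT => x; rewrite inE/= in_itv/= => h.
  exact: rdiff_cont (dF x h).
rewrite in_itv/= => /df0 c0 E.
by rewrite -subr_ge0 E mulr_ge0// subr_ge0 ltW.
Qed.

Lemma Rintegral01D f g : (forall t : R, 0 <= t <= 1 -> {for t, continuous f}) ->
  (forall t : R, 0 <= t <= 1 -> {for t, continuous g}) ->
  Rintegral mu `[0, 1] (fun t => f t + g t) = Rintegral mu `[0, 1] f + Rintegral mu `[0, 1] g.
Proof.
move=> cf cg; have [F dF] := continuous_primitive01 cf; have [G dG] := continuous_primitive01 cg.
rewrite (Rintegral01_FTC cf dF) (Rintegral01_FTC cg dG).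
rewrite (@Rintegral01_FTC _ _ (fun t => F t + G t)); first by ring.
  by move=> t t01; apply: cvgD; [exact: cf|exact: cg].
by move=> t t01; apply: rdiffD; [exact: dF|exact: dG].
Qed.

Lemma Rintegral01Z (c : R) f : (forall t : R, 0 <= t <= 1 -> {for t, continuous f}) ->
  Rintegral mu `[0, 1] (fun t => c * f t) = c * Rintegral mu `[0, 1] f.
Proof.
move=> cf; have [F dF] := continuous_primitive01 cf.
rewrite (Rintegral01_FTC cf dF) (@Rintegral01_FTC _ _ (fun t => c * F t)); first by ring.
  by move=> t t01; apply: cvgM; [exact: cvg_cst|exact: cf].
by move=> t t01; apply: rdiffZ; exact: dF.
Qed.

Lemma Rintegral01_ge0 f : (forall t : R, 0 <= t <= 1 -> 0 <= f t) -> 0 <= Rintegral mu `[0, 1] f.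
Proof. by move=> f0; apply: Rintegral_ge0 => t; rewrite /= in_itv/=; exact: f0. Qed.

End RealDiff.

(** * Polar Laplacian and monotonicity of circle means *)

Section PolarLaplacian.
Context {R : realType}.
Local Notation mu := (@lebesgue_measure R).
Local Notation k := ((2 * pi : R) ^+ 2).

(* [V r t] is a function of polar coordinates, [t] being the angle in turns. *)
Record jet (rho : R) (V V1 V11 Vt Vtt : R -> R -> R) : Prop := Jet {
  jet1 : forall r (t : R), `|r| < rho -> rdiff (V ^~ t) r (V1 r t);
  jet11 : forall r (t : R), `|r| < rho -> rdiff (V1 ^~ t) r (V11 r t);
  jett : forall r (t : R), `|r| < rho -> rdiff (V r) t (Vt r t);
  jettt : forall r (t : R), `|r| < rho -> rdiff (Vt r) t (Vtt r t);
  jetc1 : forall r (t : R), `|r| < rho -> {for t, continuous (V1 r)};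
  jetc11 : forall r (t : R), `|r| < rho -> {for t, continuous (V11 r)};
  jetctt : forall r (t : R), `|r| < rho -> {for t, continuous (Vtt r)};
  jetb : exists B, forall r (t : R), `|r| < rho -> `|V1 r t| <= B /\ `|V11 r t| <= B;
  jetp : forall r, `|r| < rho -> Vt r 1 = Vt r 0 }.

(** The Laplacian times [(2 pi r)^2], the angle being in turns; the factor removes the singularity
    at [r = 0]. *)
Definition lap (V1 V11 Vtt : R -> R -> R) r t :=
  k * (r * V1 r t + r ^+ 2 * V11 r t) + Vtt r t.

Lemma k_gt0 : 0 < k. Proof. by rewrite exprn_gt0// mulr_gt0// pi_gt0. Qed.

(* Averaging over the angle kills [Vtt], so that [(r m')'] has the sign of the Laplacian. *)
Lemma circle_mean_mono (rho : R) V V1 V11 Vt Vtt : jet rho V V1 V11 Vt Vtt ->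
  (forall r (t : R), 0 < r < rho -> 0 <= t <= 1 -> 0 <= lap V1 V11 Vtt r t) ->
  forall r s : R, 0 <= r -> r <= s -> s < rho ->
  Rintegral mu `[0, 1] (V r) <= Rintegral mu `[0, 1] (V s).
Proof.
move=> [d1 d11 dt dtt c1 c11 ctt [B BH] per] L.
have cV r t : `|r| < rho -> {for t, continuous (V r)} by move=> /dt H; exact: rdiff_cont (H t).
pose m r := Rintegral mu `[0, 1] (V r).
pose m1 r := Rintegral mu `[0, 1] (V1 r).
pose m11 r := Rintegral mu `[0, 1] (V11 r).
have near (r x : R) : `|r| < rho -> `|x - r| < rho - `|r| -> `|x| < rho.
  move=> h1 h2; have := ler_normD (x - r) r; rewrite subrK; lra.
have dm r : `|r| < rho -> rdiff m r (m1 r).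
  move=> rr; apply: (@Rintegral01_DUI _ V V1 r (rho - `|r|) B); first by rewrite subr_gt0.
  - by move=> x t /(near _ _ rr) xr _; exact: cV.
  - by move=> x t /(near _ _ rr) xr _; exact: d1.
  - by move=> x t /(near _ _ rr) xr _; have [] := BH x t xr.
have dm1 r : `|r| < rho -> rdiff m1 r (m11 r).
  move=> rr; apply: (@Rintegral01_DUI _ V1 V11 r (rho - `|r|) B); first by rewrite subr_gt0.
  - by move=> x t /(near _ _ rr) xr _; exact: c1.
  - by move=> x t /(near _ _ rr) xr _; exact: d11.
  - by move=> x t /(near _ _ rr) xr _; have [] := BH x t xr.
have ge0n r : 0 <= r -> r < rho -> `|r| < rho by move=> ? ?; rewrite ger0_norm.
have n'0 r : 0 < r -> r < rho -> 0 <= m1 r + r * m11 r.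
  move=> r0 rr; have rr' := ge0n _ (ltW r0) rr.
  have Itt : Rintegral mu `[0, 1] (Vtt r) = 0.
    rewrite (@Rintegral01_FTC _ _ (Vt r)); first by rewrite per// subrr.
      by move=> t _; exact: ctt.
    by move=> t _; exact: dtt.
  have c2 t : {for t, continuous (fun t => r * V1 r t + r ^+ 2 * V11 r t)}.
    apply: cvgD; apply: cvgM; try exact: cvg_cst; [exact: c1|exact: c11].
  have : 0 <= Rintegral mu `[0, 1] (lap V1 V11 Vtt r).
    by apply: Rintegral01_ge0 => t t01; apply: L => //; rewrite r0.
  rewrite /lap Rintegral01D; last 2 first.
  - by move=> t _; apply: cvgM; [exact: cvg_cst|exact: c2].
  - by move=> t _; exact: ctt.
  rewrite Itt addr0 Rintegral01Z; last by move=> t _; exact: c2.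
  rewrite pmulr_rge0; last exact: k_gt0.
  rewrite Rintegral01D; last 2 first.
  - by move=> t _; apply: cvgM; [exact: cvg_cst|exact: c1].
  - by move=> t _; apply: cvgM; [exact: cvg_cst|exact: c11].
  rewrite Rintegral01Z; last by move=> t _; exact: c1.
  rewrite Rintegral01Z; last by move=> t _; exact: c11.
  rewrite -/(m1 r) -/(m11 r).
  have -> : r * m1 r + r ^+ 2 * m11 r = r * (m1 r + r * m11 r) by ring.
  by rewrite pmulr_rge0.
have n0 r : 0 <= r -> r < rho -> 0 <= r * m1 r.
  move=> r0 rr.
  have := @rdiff_mono _ (fun r => r * m1 r) (fun r => m1 r + r * m11 r) 0 r r0.
  rewrite mul0r; apply.
    move=> x /andP[x0 xr]; have xr' := ge0n _ x0 (le_lt_trans xr rr).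
    by apply: rdiff_eq (rdiffM (rdiff_id x) (dm1 x xr')) _; rewrite mul1r.
  by move=> x /andP[x0 xr]; apply: n'0 => //; exact: lt_trans rr.
move=> r s r0 rs sr; apply: (@rdiff_mono _ m m1) => //.
  by move=> x /andP[x0 xr]; apply: dm; apply: ge0n; [exact: le_trans x0|exact: le_lt_trans sr].
move=> x /andP[x0 xs]; have x00 := le_lt_trans r0 x0.
by have := n0 x (ltW x00) (lt_trans xs sr); rewrite pmulr_rge0.
Qed.

Lemma jet_comb (rho a b : R) V V1 V11 Vt Vtt W W1 W11 Wt Wtt :
  jet rho V V1 V11 Vt Vtt -> jet rho W W1 W11 Wt Wtt ->
  jet rho (fun r t => a * V r t + b * W r t) (fun r t => a * V1 r t + b * W1 r t)
    (fun r t => a * V11 r t + b * W11 r t) (fun r t => a * Vt r t + b * Wt r t)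
    (fun r t => a * Vtt r t + b * Wtt r t).
Proof.
move=> [d1 d11 dt dtt c1 c11 ctt [B BH] per] [d1' d11' dt' dtt' c1' c11' ctt' [B' BH'] per'].
split.
- by move=> r t rr; apply: rdiffD; apply: rdiffZ; [exact: d1|exact: d1'].
- by move=> r t rr; apply: rdiffD; apply: rdiffZ; [exact: d11|exact: d11'].
- by move=> r t rr; apply: rdiffD; apply: rdiffZ; [exact: dt|exact: dt'].
- by move=> r t rr; apply: rdiffD; apply: rdiffZ; [exact: dtt|exact: dtt'].
- by move=> r t rr; apply: cvgD; apply: cvgM; try exact: cvg_cst; [exact: c1|exact: c1'].
- by move=> r t rr; apply: cvgD; apply: cvgM; try exact: cvg_cst; [exact: c11|exact: c11'].
- by move=> r t rr; apply: cvgD; apply: cvgM; try exact: cvg_cst; [exact: ctt|exact: ctt'].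
- exists (`|a| * B + `|b| * B') => r t rr.
  have [h1 h2] := BH r t rr; have [h1' h2'] := BH' r t rr.
  by split; rewrite (le_trans (ler_normD _ _))// lerD// normrM ler_wpM2l.
- by move=> r rr; rewrite per// per'.
Qed.

End PolarLaplacian.

Section Dot.
Context {R : realType}.
Local Notation C := R[i].

Definition dot (a b : C) : R := complex.Re a * complex.Re b + complex.Im a * complex.Im b.

Lemma dotC a b : dot a b = dot b a. Proof. by rewrite /dot mulrC [X in _ + X]mulrC. Qed.

Lemma dot_modc a : dot a a = modc a ^+ 2.
Proof. by rewrite modc_sqr. Qed.

Lemma le_dot a b : `|dot a b| <= modc a * modc b.
Proof.
rewrite -(@ler_pXn2r _ 2) ?nnegrE ?mulr_ge0 ?modc_ge0// real_normK ?num_real//.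
rewrite exprMn !modc_sqr /dot -subr_ge0.
set x := complex.Re a; set y := complex.Im a; set u := complex.Re b; set v := complex.Im b.
have -> : (x ^+ 2 + y ^+ 2) * (u ^+ 2 + v ^+ 2) - (x * u + y * v) ^+ 2 = (x * v - y * u) ^+ 2 by ring.
exact: sqr_ge0.
Qed.

Lemma rdiff_dot (c1 c2 : R -> C) t l1 l2 : rder c1 t l1 -> rder c2 t l2 ->
  rdiff (fun s => dot (c1 s) (c2 s)) t (dot l1 (c2 t) + dot (c1 t) l2).
Proof.
move=> /rder_ReIm[a1 b1] /rder_ReIm[a2 b2].
apply: rdiff_eq (rdiffD (rdiffM a1 a2) (rdiffM b1 b2)) _; rewrite /dot; ring.
Qed.

Lemma cont_dot (c1 c2 : R -> C) t : rcont c1 t -> rcont c2 t ->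
  {for t, continuous (fun s => dot (c1 s) (c2 s))}.
Proof.
move=> /rcont_ReIm[a1 b1] /rcont_ReIm[a2 b2].
by apply: cvgD; apply: cvgM.
Qed.

Lemma cont_modc2 (c : R -> C) t : rcont c t -> {for t, continuous (fun s => modc (c s) ^+ 2)}.
Proof.
move=> cc; rewrite (_ : (fun s => _) = fun s => dot (c s) (c s)); first exact: cont_dot.
by apply/funext => s; rewrite dot_modc.
Qed.

End Dot.

(** * Laplacian and gradient of [|f|^2] and of powers *)

Section PowerJet.
Context {R : realType}.
Local Notation C := R[i].
Local Notation k := ((2 * pi : R) ^+ 2).

Lemma le_powR_neg (e x q : R) : 0 < e -> e <= x -> q <= 0 -> x `^ q <= e `^ q.
Proof.
move=> e0 ex q0; have x0 := lt_le_trans e0 ex.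
rewrite -(opprK q) !(powRN _ (- q)) lef_pV2 ?posrE ?powR_gt0//.
by apply: ge0_ler_powR; rewrite ?oppr_ge0// nnegrE ltW.
Qed.

Lemma jet_cst (rho a : R) : jet rho (fun _ _ => a) (fun _ _ => 0) (fun _ _ => 0) (fun _ _ => 0) (fun _ _ => 0).
Proof.
split=> //; try (by move=> r t _; exact: rdiff_cst); try (by move=> r t _; exact: cvg_cst).
by exists 0 => r t _; rewrite normr0.
Qed.

Definition pow1 (q : R) (S S1 : R -> R -> R) r t := q * S r t `^ (q - 1) * S1 r t.
Definition pow11 (q : R) (S S1 S11 : R -> R -> R) r t :=
  q * (q - 1) * S r t `^ (q - 1 - 1) * S1 r t ^+ 2 + q * S r t `^ (q - 1) * S11 r t.

Lemma rdiff_pow1 (q : R) (c d : R -> R) t a b : 0 < c t -> rdiff c t a -> rdiff d t b -> d t = a ->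
  rdiff (fun s => q * c s `^ (q - 1) * d s) t
    (q * (q - 1) * c t `^ (q - 1 - 1) * a ^+ 2 + q * c t `^ (q - 1) * b).
Proof.
move=> c0 dc dd da.
apply: rdiff_eq (rdiffM (rdiffZ q (rdiff_powR (q - 1) c0 dc)) dd) _.
by rewrite da; ring.
Qed.

(** The bound [e <= S] controls the powers with exponents [q - 1] and [q - 2] that appear in the
    derivatives, both exponents being nonpositive as [q <= 1]. *)
Lemma jet_pow (rho e q : R) S S1 S11 St Stt : 0 < e -> 0 < q -> q <= 1 ->
  jet rho S S1 S11 St Stt -> (forall r (t : R), `|r| < rho -> e <= S r t) ->
  (forall r, `|r| < rho -> S r 1 = S r 0) ->
  jet rho (fun r t => S r t `^ q) (pow1 q S S1) (pow11 q S S1 S11) (pow1 q S St) (pow11 q S St Stt).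
Proof.
move=> e0 q0 q1 [d1 d11 dt dtt c1 c11 ctt [B BH] per] Se per0.
have S0 r t : `|r| < rho -> 0 < S r t by move=> rr; exact: lt_le_trans e0 (Se r t rr).
have cS r t : `|r| < rho -> {for t, continuous (S r)} by move=> /dt H; exact: rdiff_cont (H t).
have cSt r t : `|r| < rho -> {for t, continuous (St r)} by move=> /dtt H; exact: rdiff_cont (H t).
have cpw p r t : `|r| < rho -> {for t, continuous (fun t => S r t `^ p)}.
  by move=> rr; apply: continuous_powR; [exact: S0|exact: cS].
have cp11 (T1 T11 : R -> R -> R) r t : `|r| < rho -> {for t, continuous (T1 r)} ->
    {for t, continuous (T11 r)} -> {for t, continuous (pow11 q S T1 T11 r)}.
  move=> rr cT1 cT11; apply: cvgD.
    apply: cvgM; last by under eq_fun do rewrite expr2; apply: cvgM.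
    by apply: cvgM; [exact: cvg_cst|exact: cpw].
  by apply: cvgM => //; apply: cvgM; [exact: cvg_cst|exact: cpw].
split.
- by move=> r t rr; apply: rdiff_powR; [exact: S0|exact: d1].
- by move=> r t rr; apply: rdiff_pow1; [exact: S0|exact: d1|exact: d11|].
- by move=> r t rr; apply: rdiff_powR; [exact: S0|exact: dt].
- by move=> r t rr; apply: rdiff_pow1; [exact: S0|exact: dt|exact: dtt|].
- by move=> r t rr; apply: cvgM; [apply: cvgM; [exact: cvg_cst|exact: cpw]|exact: c1].
- by move=> r t rr; apply: cp11; [exact: rr|exact: c1|exact: c11].
- by move=> r t rr; apply: cp11; [exact: rr|exact: cSt|exact: ctt].
- exists (q * e `^ (q - 1) * B + (`|q * (q - 1)| * e `^ (q - 1 - 1) * B ^+ 2)) => r t rr.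
  have [h1 h2] := BH r t rr.
  have B0 : 0 <= B by apply: le_trans h1.
  have p1 : S r t `^ (q - 1) <= e `^ (q - 1) by apply: le_powR_neg; rewrite ?Se// subr_le0.
  have p2 : S r t `^ (q - 1 - 1) <= e `^ (q - 1 - 1) by apply: le_powR_neg; rewrite ?Se//; lra.
  have E2 : 0 <= `|q * (q - 1)| * e `^ (q - 1 - 1) * B ^+ 2.
    by rewrite !mulr_ge0 ?powR_ge0// exprn_ge0.
  have pos1 : 0 <= q * S r t `^ (q - 1) by rewrite mulr_ge0 ?powR_ge0// ltW.
  have H1 x : `|x| <= B -> `|q * S r t `^ (q - 1) * x| <= q * e `^ (q - 1) * B.
    move=> xB; rewrite normrM ger0_norm//; apply: ler_pM => //.
    by apply: ler_wpM2l => //; exact: ltW.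
  split; first by rewrite (le_trans (H1 _ h1))// lerDl.
  rewrite addrC (le_trans (ler_normD _ _))// lerD ?H1//.
  rewrite normrM normrM [`|_ `^ _|]ger0_norm ?powR_ge0// normrX.
  apply: ler_pM; rewrite ?mulr_ge0 ?powR_ge0 ?exprn_ge0//.
    by apply: ler_wpM2l.
  by rewrite lerXn2r// nnegrE.
- by move=> r rr; rewrite /pow1 per// per0.
Qed.

(** Chain rule [Delta (S^q) = q S^(q-1) Delta S + q (q - 1) S^(q-2) |grad S|^2] in the scaling of
    [lap]; the last bracket is the squared gradient in polar coordinates. *)
Lemma lap_pow q S S1 S11 St Stt (r t : R) :
  lap (pow1 q S S1) (pow11 q S S1 S11) (pow11 q S St Stt) r t =
  q * S r t `^ (q - 1) * lap S1 S11 Stt r t +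
  q * (q - 1) * S r t `^ (q - 1 - 1) * (k * r ^+ 2 * S1 r t ^+ 2 + St r t ^+ 2).
Proof. by rewrite /lap /pow1 /pow11; ring. Qed.

Section Square.
Variables (f : C -> C) (z0 : C) (rho : R).
Hypotheses (hf : analytic f) (rz : rho * modc z0 < 1).

Definition up (r t : R) : C := r%:C * (z0 * expi t).

(** [|f|^2] along the circles [|z| = r |z0|], followed by its first and second partial derivatives
    in [r] and in [t]. *)
Definition sq r t := dot (f (up r t)) (f (up r t)).
Definition sq1 r t := 2 * dot (z0 * expi t * der f (up r t)) (f (up r t)).
Definition sq11 r t :=
  2 * (dot ((z0 * expi t) ^+ 2 * der (der f) (up r t)) (f (up r t))
       + modc (z0 * expi t * der f (up r t)) ^+ 2).
Definition sqt r t := 2 * dot (tpi * (up r t * der f (up r t))) (f (up r t)).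
Definition sqtt r t :=
  2 * (dot (tpi ^+ 2 * (up r t * der f (up r t) + up r t ^+ 2 * der (der f) (up r t))) (f (up r t))
       + modc (tpi * (up r t * der f (up r t))) ^+ 2).

Lemma modc_up r t : modc (up r t) = `|r| * modc z0.
Proof. by rewrite /up !modcM modc_real modc_expi mulr1. Qed.

Lemma up_lt1 r t : `|r| < rho -> modc (up r t) < 1.
Proof.
move=> rr; rewrite modc_up (le_lt_trans _ rz)// ler_wpM2r ?modc_ge0//.
exact: ltW.
Qed.

Lemma rder_upr r t : rder (up ^~ t) r (z0 * expi t).
Proof.
have := rder_affine 0 (z0 * expi t) r.
by under [X in rder X]eq_fun do rewrite add0r.
Qed.

Lemma rder_upt r t : rder (up r) t (tpi * up r t).
Proof.
have := rderZ r%:C (rderZ z0 (rder_expi t)).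
by move/rder_eq; apply; rewrite /up; ring.
Qed.

Lemma rcont_up r t : rcont (up r) t.
Proof. exact: rder_cont (rder_upt r t). Qed.

Lemma jet_sq : jet rho sq sq1 sq11 sqt sqtt.
Proof.
have hf' := holo_cderiv hf; have hf'' := holo_cderiv hf'.
have /holoP df := hf; have /holoP df' := hf'.
have dr (g : C -> C) r t : analytic g -> `|r| < rho ->
    rder (fun r => g (up r t)) r (z0 * expi t * der g (up r t)).
  move=> /holoP dg rr; have := rder_comp (rder_upr r t) (dg _ (up_lt1 t rr)).
  by move/rder_eq; apply; rewrite mulrC.
have dt (g : C -> C) r t : analytic g -> `|r| < rho ->
    rder (fun t => g (up r t)) t (tpi * (up r t * der g (up r t))).
  move=> /holoP dg rr; have := rder_comp (rder_upt r t) (dg _ (up_lt1 t rr)).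
  by move/rder_eq; apply; ring.
have c (g : C -> C) r t : analytic g -> `|r| < rho -> rcont (fun t => g (up r t)) t.
  by move=> hg rr; exact: rder_cont (dt g r t hg rr).
have cz t : rcont (fun t => z0 * expi t) t.
  by apply: rcontM; [exact: rcont_cst|exact: rcont_expi].
have c1 r t : `|r| < rho -> rcont (fun t => z0 * expi t * der f (up r t)) t.
  by move=> rr; apply: rcontM; [exact: cz|exact: c].
have hzf : analytic (fun z => z * der f z) by apply: holoM => //; exact: holo_id.
have dzf z : modc z < 1 -> der (fun z => z * der f z) z = der f z + z * der (der f) z.
  by move=> z1; apply: cder_cderiv; apply: cder_eq (cderM (cder_id z) (df' _ z1)) _; rewrite mul1r.
split.
- move=> r t rr; have h := dr f r t hf rr.
  by apply: rdiff_eq (rdiff_dot h h) _; rewrite /sq1 dotC; ring.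
- move=> r t rr; have h := dr f r t hf rr; have h' := dr (der f) r t hf' rr.
  have h2 := rderZ (z0 * expi t) h'.
  apply: rdiff_eq (rdiffZ 2 (rdiff_dot h2 h)) _; rewrite /sq11 dot_modc; congr (2 * (dot _ _ + _)).
  by ring.
- move=> r t rr; have h := dt f r t hf rr.
  by apply: rdiff_eq (rdiff_dot h h) _; rewrite /sqt dotC; ring.
- move=> r t rr; have h := dt f r t hf rr; have h' := dt _ r t hzf rr.
  have h2 := rderZ tpi h'.
  apply: rdiff_eq (rdiffZ 2 (rdiff_dot h2 h)) _; rewrite /sqtt dot_modc; congr (2 * (dot _ _ + _)).
  by rewrite dzf ?up_lt1//; ring.
- by move=> r t rr; apply: cvgM; [exact: cvg_cst|apply: cont_dot; [exact: c1|exact: c]].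
- move=> r t rr; apply: cvgM; first exact: cvg_cst.
  apply: cvgD.
    apply: cont_dot; last exact: c.
    by apply: rcontM; [apply: rcontX; exact: cz|exact: c].
  by apply: cont_modc2; exact: c1.
- move=> r t rr; apply: cvgM; first exact: cvg_cst.
  have cu : rcont (fun t => up r t * der f (up r t)) t by apply: rcontM; [exact: rcont_up|exact: c].
  apply: cvgD.
    apply: cont_dot; last exact: c.
    apply: rcontM; first exact: rcont_cst.
    apply: rcontD; first exact: cu.
    by apply: rcontM; [apply: rcontX; exact: rcont_up|exact: c].
  by apply: cont_modc2; apply: rcontM; [exact: rcont_cst|exact: cu].
- have [rho0|rho0] := leP rho 0.
    by exists 0 => r t rr; have := lt_le_trans rr rho0; rewrite ltNge normr_ge0.
  have bnd (g : C -> C) : analytic g -> exists2 B : R, 0 <= B & forall z, modc z <= rho * modc z0 -> modc (g z) <= B.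
    by move=> hg; apply: ccont_bounded => z zr; apply: holo_cont => //; exact: le_lt_trans rz.
  have [B0 B00 H0] := bnd f hf; have [B1 B10 H1] := bnd _ hf'; have [B2 B20 H2] := bnd _ hf''.
  pose z1 := modc z0.
  have z10 : 0 <= z1 by exact: modc_ge0.
  exists (2 * (z1 * B1 * B0) + 2 * (z1 ^+ 2 * B2 * B0 + (z1 * B1) ^+ 2)) => r t rr.
  have ur : modc (up r t) <= rho * modc z0 by rewrite modc_up ler_wpM2r ?modc_ge0// ltW.
  have h0 := H0 _ ur; have h1 := H1 _ ur; have h2 := H2 _ ur.
  have e1 : modc (z0 * expi t * der f (up r t)) <= z1 * B1.
    by rewrite !modcM modc_expi mulr1 ler_wpM2l.
  have P0 : 0 <= z1 ^+ 2 * B2 * B0 by rewrite !mulr_ge0// exprn_ge0.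
  have P1 : 0 <= z1 * B1 * B0 by rewrite !mulr_ge0.
  have P2 : 0 <= (z1 * B1) ^+ 2 by rewrite sqr_ge0.
  split.
    rewrite /sq1 normrM ger0_norm// (@le_trans _ _ (2 * (z1 * B1 * B0)))//; last by rewrite lerDl mulr_ge0// addr_ge0.
    rewrite ler_pM2l// (le_trans (le_dot _ _))//.
    by apply: ler_pM; rewrite ?modc_ge0.
  rewrite /sq11 normrM ger0_norm// (@le_trans _ _ (2 * (z1 ^+ 2 * B2 * B0 + (z1 * B1) ^+ 2)))//; last by rewrite lerDr mulr_ge0.
  rewrite ler_pM2l// (le_trans (ler_normD _ _))// lerD//.
    rewrite (le_trans (le_dot _ _))//; apply: ler_pM; rewrite ?modc_ge0//.
    by rewrite modcM modcX modcM modc_expi mulr1 ler_wpM2l// exprn_ge0.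
  rewrite ger0_norm ?exprn_ge0 ?modc_ge0// lerXn2r// nnegrE ?modc_ge0//.
  by rewrite mulr_ge0.
- by move=> r rr; rewrite /sqt /up expi1 expi0.
Qed.

Lemma modc_tpi : modc (tpi : C) = 2 * pi.
Proof.
by rewrite /modc/= expr0n add0r sqrtr_sqr ger0_norm// mulr_ge0// pi_ge0.
Qed.

(** The identity [Delta |f|^2 = 4 |f'|^2]: the terms in [f''] cancel, as for every analytic, hence
    harmonic, function. *)
Lemma lap_sq r t : lap sq1 sq11 sqtt r t = k * (4 * modc (up r t * der f (up r t)) ^+ 2).
Proof.
rewrite /lap /sq1 /sq11 /sqtt [modc (tpi * _)]modcM modc_tpi [(2 * pi * modc _) ^+ 2]exprMn.
rewrite /up; set zt := z0 * expi t; set a := der f _; set b := der (der f) _; set x := f _.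
have -> : modc (r%:C * zt * a) ^+ 2 = r ^+ 2 * modc (zt * a) ^+ 2.
  by rewrite -mulrA modcM modc_real exprMn real_normK ?num_real.
have -> : dot (tpi ^+ 2 * (r%:C * zt * a + (r%:C * zt) ^+ 2 * b)) x =
   - k * (r * dot (zt * a) x + r ^+ 2 * dot (zt ^+ 2 * b) x).
  rewrite /dot /tpi; case: zt a b x => [z1 z2] [a1 a2] [b1 b2] [x1 x2].
  by rewrite !expr2/=; ring.
by ring.
Qed.

(** The identity [|grad |f|^2|^2 = 4 |f|^2 |f'|^2], scaled as in [lap]. *)
Lemma grad_sq r t : k * r ^+ 2 * sq1 r t ^+ 2 + sqt r t ^+ 2 =
  k * (4 * modc (up r t * der f (up r t)) ^+ 2 * sq r t).
Proof.
rewrite /sq1 /sqt /sq modc_sqr /up; set zt := z0 * expi t; set a := der f _; set x := f _.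
rewrite /dot /tpi; case: zt a x => [z1 z2] [a1 a2] [x1 x2].
by rewrite /=; ring.
Qed.

End Square.
End PowerJet.

(** * Circle means of powers *)

Section PowerFacts.
Context {R : realType}.
Implicit Types (x y p q e : R).

Lemma powR_sqr x p : 0 <= x -> (x ^+ 2) `^ p = x `^ (2 * p).
Proof. by move=> x0; rewrite powRrM powR_mulrn. Qed.

(** A ratio [t <= 1] satisfies [t <= t^q]; this is applied to [x / (x + y)] and [y / (x + y)], whose
    sum is [1]. *)
Lemma powR_subadd x y q : 0 <= x -> 0 <= y -> 0 < q -> q <= 1 -> (x + y) `^ q <= x `^ q + y `^ q.
Proof.
move=> x0 y0 q0 q1; have [xy0|xy0] := eqVneq (x + y) 0.
  by rewrite xy0 powR0 ?gt_eqF// addr_ge0 ?powR_ge0.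
have s0 : 0 < x + y by rewrite lt_def xy0 addr_ge0.
have key u : 0 <= u -> u <= x + y -> u / (x + y) * (x + y) `^ q <= u `^ q.
  rewrite le_eqVlt => /predU1P[<- _|u0 us]; first by rewrite !mul0r powR_ge0.
  have {2}-> : u = u / (x + y) * (x + y) by rewrite divfK// gt_eqF.
  rewrite [leRHS]powRM; [|by rewrite divr_ge0// ltW|exact: ltW].
  apply: ler_wpM2r; first exact: powR_ge0.
  by apply: ger1_powR => //; rewrite divr_gt0//= ler_pdivrMr// mul1r.
have -> : (x + y) `^ q = x / (x + y) * (x + y) `^ q + y / (x + y) * (x + y) `^ q.
  by rewrite -mulrDl -mulrDl divff// mul1r.
by rewrite lerD// key// ?lerDl ?lerDr.
Qed.

Lemma powR_le_mono x y p : 0 <= p -> 0 <= x -> x <= y -> x `^ p <= y `^ p.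
Proof.
by move=> p0 x0 xy; apply: ge0_ler_powR => //; rewrite nnegrE//; exact: le_trans xy.
Qed.

(** Plays the role of Minkowski's inequality for all [p > 0] at once, at the cost of a constant. *)
Lemma powR_quasi x y z p : 0 < p -> 0 <= x -> 0 <= y -> 0 <= z -> z <= x + y ->
  z `^ p <= 2 `^ p * (x `^ p + y `^ p).
Proof.
move=> p0; wlog xy : x y / x <= y.
  move=> H x0 y0 z0 zxy; have [xy|/ltW yx] := leP x y; first exact: H.
  by rewrite addrC; apply: H => //; rewrite addrC.
move=> x0 y0 z0 zxy; apply: (@le_trans _ _ ((2 * y) `^ p)).
  by apply: powR_le_mono => //; [exact: ltW|rewrite (le_trans zxy)// mulr2n mulrDl mul1r lerD2r].
by rewrite powRM// ler_wpM2l ?powR_ge0// lerDr powR_ge0.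
Qed.

Lemma powR_pred x p : 0 < x -> x `^ p = x * x `^ (p - 1).
Proof.
move=> x0; rewrite -{1}(subrK 1 p) addrC (powRD (r := 1) (s := p - 1)); last by rewrite (gt_eqF x0) implybT.
by rewrite powRr1 ?ltW.
Qed.

Lemma powR_small p e : 0 < p -> 0 < e -> exists2 d, 0 < d & forall x, 0 <= x -> x <= d -> x `^ p <= e.
Proof.
move=> p0 e0; exists (e `^ p^-1); first by rewrite powR_gt0.
move=> x x0 xd; rewrite (le_trans (powR_le_mono (ltW p0) x0 xd))//.
by rewrite -powRrM mulVf ?gt_eqF// powRr1// ltW.
Qed.

(** At a zero of [c] the power need not be differentiable; continuity there comes from
    [powR_small]. *)
Lemma cont_powR (c : R -> R) t p : 0 < p -> (forall s, 0 <= c s) -> {for t, continuous c} ->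
  {for t, continuous (fun s => c s `^ p)}.
Proof.
move=> p0 c0 cc; have := c0 t; rewrite le_eqVlt => /predU1P[ct0|]; last first.
  by move=> ct; exact: continuous_powR.
apply/cvgrPdist_le => e e0; have [d d0 dH] := powR_small p0 e0.
move/cvgrPdist_lt: cc => /(_ d d0); apply: filterS => s.
rewrite -ct0 sub0r normrN ger0_norm// => cd.
by rewrite powR0 ?gt_eqF// sub0r normrN ger0_norm ?powR_ge0// dH// ltW.
Qed.

End PowerFacts.

(** * Circle means, and the Laplacian inequalities for exponents [q <= 1] of [|f|^2] *)

Section CircleMeans.
Context {R : realType}.
Local Notation C := R[i].
Local Notation mu := (@lebesgue_measure R).
Implicit Types (f g F : C -> C) (z : C) (p q e : R).

(* [mp p f z] is the mean of [|f|^p] over the circle through [z]; it is kept opaque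
   because unification would otherwise unfold the integral. *)
Fact mp_key : {m : R -> (C -> C) -> C -> R |
  m = fun p f z => Rintegral mu `[0, 1] (fun t => modc (f (z * expi t)) `^ p)}.
Proof. by eexists. Qed.
Definition mp := sval mp_key.
Lemma mpE p f z : mp p f z = Rintegral mu `[0, 1] (fun t => modc (f (z * expi t)) `^ p).
Proof. by rewrite /mp (svalP mp_key). Qed.

Lemma modc_zexpi z t : modc (z * expi t) = modc z.
Proof. by rewrite modcM modc_expi mulr1. Qed.

Lemma cont_modc (c : R -> C) t : rcont c t -> {for t, continuous (fun s => modc (c s))}.
Proof.
move=> cc; apply/cvgrPdist_le => e /cc[d d0 dH].
apply/nbhs_ballP; exists d => //= s; rewrite /ball/= distrC => /dH.
apply: le_trans; rewrite ler_norml; apply/andP; split.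
  by have := modcBB (c s) (c t); lra.
by have := modcBB (c t) (c s); rewrite modc_dist; lra.
Qed.

Lemma rcont_zexpi z t : rcont (fun t => z * expi t) t.
Proof. by apply: rcontM; [exact: rcont_cst|exact: rcont_expi]. Qed.

Lemma circle_cont f z t : ccontD1 f -> modc z < 1 -> rcont (fun t => f (z * expi t)) t.
Proof.
move=> cf z1; apply: (@rcont_comp _ f (fun t => z * expi t)); last exact: rcont_zexpi.
by apply: cf; rewrite modc_zexpi.
Qed.

Lemma mp_cont p f z t : 0 < p -> ccontD1 f -> modc z < 1 ->
  {for t, continuous (fun t => modc (f (z * expi t)) `^ p)}.
Proof.
move=> p0 cf z1; apply: cont_powR => //; first by move=> s; exact: modc_ge0.
exact/cont_modc/circle_cont.
Qed.

Lemma mp_ge0 p f z : 0 <= mp p f z.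
Proof. by rewrite mpE; apply: Rintegral01_ge0 => t _; exact: powR_ge0. Qed.

Lemma mp_le p f g z (a : R) : 0 < p -> ccontD1 f -> ccontD1 g -> modc z < 1 -> 0 <= a ->
  (forall w, modc w < 1 -> modc w = modc z -> modc (f w) `^ p <= a * modc (g w) `^ p) ->
  mp p f z <= a * mp p g z.
Proof.
move=> p0 cf cg z1 a0 H; rewrite !mpE -Rintegral01Z; last by move=> t _; exact: mp_cont.
apply: le_Rintegral01.
- by move=> t _; exact: mp_cont.
- by move=> t _; apply: cvgM; [exact: cvg_cst|exact: mp_cont].
- by move=> t _; apply: H; rewrite modc_zexpi.
Qed.

Lemma mp_eqD p f g z : eqD f g -> modc z < 1 -> mp p f z = mp p g z.
Proof.
by move=> fg z1; rewrite !mpE; apply: eq_Rintegral01 => t _; rewrite fg// modc_zexpi.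
Qed.

Lemma mp_sqr p f z : mp p (fun z => f z ^+ 2) z = mp (2 * p) f z.
Proof. by rewrite !mpE; apply: eq_Rintegral01 => t _; rewrite modcX powR_sqr ?modc_ge0. Qed.

Lemma mpZ p f z (a : C) : 0 < p -> ccontD1 f -> modc z < 1 ->
  mp p (fun z => a * f z) z = modc a `^ p * mp p f z.
Proof.
move=> p0 cf z1; rewrite !mpE -Rintegral01Z; last by move=> t _; exact: mp_cont.
by apply: eq_Rintegral01 => t _; rewrite modcM powRM ?modc_ge0.
Qed.

Lemma mp_triangle p f g h z : 0 < p -> ccontD1 f -> ccontD1 g -> ccontD1 h -> modc z < 1 ->
  (forall w, modc w < 1 -> modc (h w) <= modc (f w) + modc (g w)) ->
  mp p h z <= 2 `^ p * (mp p f z + mp p g z).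
Proof.
move=> p0 cf cg ch z1 H; rewrite !mpE -Rintegral01D; [|by move=> t _; exact: mp_cont..].
rewrite -Rintegral01Z; last by move=> t _; apply: cvgD; exact: mp_cont.
apply: le_Rintegral01.
- by move=> t _; exact: mp_cont.
- by move=> t _; apply: cvgM; [exact: cvg_cst|apply: cvgD; exact: mp_cont].
- by move=> t _; apply: powR_quasi; rewrite ?modc_ge0//; apply: H; rewrite modc_zexpi.
Qed.

Section SmallExponent.
Variable (q : R).
Hypotheses (q0 : 0 < q) (q1 : q <= 1).

(** The shift [e] keeps the base of the power away from [0], where the power is not smooth; the
    factors [1] reproduce the shape of [jet_comb]. *)
Definition Aeps e f z r t := 1 * sq f z r t + 1 * e.
Definition Seps e f F z r t := 1 * Aeps e f z r t + 1 * sq F z r t.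

Lemma sq_ge0 f z r t : 0 <= sq f z r t.
Proof. by rewrite /sq dot_modc sqr_ge0. Qed.

(** The circle through [z] corresponds to [r = 1]; jets are needed on a slightly larger range of
    [r]. *)
Lemma exists_rho z : modc z < 1 -> exists2 rho : R, 1 < rho & rho * modc z < 1.
Proof.
move=> z1; have z0 := modc_ge0 z; exists (2 / (1 + modc z)).
  by rewrite ltr_pdivlMr; lra.
by rewrite mulrAC ltr_pdivrMr; lra.
Qed.

Lemma jet_A e f z (rho : R) : analytic f -> rho * modc z < 1 ->
  exists A1 A11 At Att, jet rho (Aeps e f z) A1 A11 At Att /\
  (forall r t, lap A1 A11 Att r t = (2 * pi) ^+ 2 * (4 * modc (up z r t * der f (up z r t)) ^+ 2)) /\
  (forall r t, (2 * pi) ^+ 2 * r ^+ 2 * A1 r t ^+ 2 + At r t ^+ 2 =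
     (2 * pi) ^+ 2 * (4 * modc (up z r t * der f (up z r t)) ^+ 2 * sq f z r t)).
Proof.
move=> hf rz; have j := jet_comb 1 1 (jet_sq hf rz) (jet_cst rho e).
do 4 eexists; split; first exact: j.
split=> r t.
  by rewrite -lap_sq /lap; ring.
by rewrite -grad_sq; ring.
Qed.

(** With [s = |f|^2] and [A = s + e], the Laplacian of [A^q] is a nonnegative multiple of
    [A - (1 - q) s], and [s <= A]. *)
Lemma mean_mono_eps e f z r : 0 < e -> analytic f -> modc z < 1 -> 0 <= r <= 1 ->
  Rintegral mu `[0, 1] (fun t => Aeps e f z r t `^ q) <=
  Rintegral mu `[0, 1] (fun t => Aeps e f z 1 t `^ q).
Proof.
move=> e0 hf z1 /andP[r0 r1]; have [rho rho1 rz] := exists_rho z1.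
have [A1 [A11 [At [Att [jA [lapA gradA]]]]]] := jet_A e hf rz.
have Ae r' t : `|r'| < rho -> e <= Aeps e f z r' t.
  by move=> _; rewrite /Aeps !mul1r lerDr sq_ge0.
have Aper r' : `|r'| < rho -> Aeps e f z r' 1 = Aeps e f z r' 0.
  by move=> _; rewrite /Aeps /sq /up expi1 expi0.
apply: (circle_mean_mono (jet_pow e0 q0 q1 jA Ae Aper)) => // r' t r'rho _.
rewrite lap_pow lapA gradA.
set A := Aeps e f z r' t; set a := modc _ ^+ 2; set s := sq f z r' t.
have A0 : 0 < A by rewrite (lt_le_trans e0)// Ae// ger0_norm; case/andP: r'rho => // /ltW.
have a0 : 0 <= a by rewrite sqr_ge0.
have sA : s <= A by rewrite /A /Aeps !mul1r lerDl ltW.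
have -> : A `^ (q - 1) = A * A `^ (q - 1 - 1).
  exact: powR_pred.
set w := A `^ (q - 1 - 1); have w0 : 0 <= w by exact: powR_ge0.
have -> : q * (A * w) * ((2 * pi) ^+ 2 * (4 * a)) +
   q * (q - 1) * w * ((2 * pi) ^+ 2 * (4 * a * s)) =
   (2 * pi) ^+ 2 * 4 * q * w * a * (q * A + (1 - q) * (A - s)) by ring.
have B0 : 0 <= q * A + (1 - q) * (A - s).
  by apply: addr_ge0; apply: mulr_ge0; rewrite ?subr_ge0// ltW.
have kk0 := ltW (@k_gt0 R).
move: kk0 B0; set k := (2 * pi) ^+ 2; set X := q * A + _ => kk0 B0.
have q0' := ltW q0; have h4 : 0 <= 4 :> R by [].
by do 5!apply: mulr_ge0 => //.
Qed.

(* For [A = |f|^2 + e] and [S = A + |F|^2] the Laplacian of [(2 / q) A^q - S^q] is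
   nonnegative as soon as [|F'| <= |f'|], so its circle means increase. *)
Lemma mean_S_eps e f F z : 0 < e -> analytic f -> analytic F -> F 0 = 0 ->
  (forall w, modc w < 1 -> modc (der F w) <= modc (der f w)) -> modc z < 1 ->
  Rintegral mu `[0, 1] (fun t => Seps e f F z 1 t `^ q) <=
  2 / q * Rintegral mu `[0, 1] (fun t => Aeps e f z 1 t `^ q).
Proof.
move=> e0 hf hF F0 dFf z1; have [rho rho1 rz] := exists_rho z1.
have [A1 [A11 [At [Att [jA [lapA gradA]]]]]] := jet_A e hf rz.
have jS : jet rho (Seps e f F z) _ _ _ _ := jet_comb 1 1 jA (jet_sq hF rz).
have Ae r' t : e <= Aeps e f z r' t by rewrite /Aeps !mul1r lerDr sq_ge0.
have AS r' t : Aeps e f z r' t <= Seps e f F z r' t by rewrite /Seps !mul1r lerDl sq_ge0.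
have Aper r' : `|r'| < rho -> Aeps e f z r' 1 = Aeps e f z r' 0.
  by move=> _; rewrite /Aeps /sq /up expi1 expi0.
have Sper r' : `|r'| < rho -> Seps e f F z r' 1 = Seps e f F z r' 0.
  by move=> _; rewrite /Seps /Aeps /sq /up expi1 expi0.
have jAq := jet_pow e0 q0 q1 jA (fun r t _ => Ae r t) Aper.
have jSq := jet_pow e0 q0 q1 jS (fun r t _ => le_trans (Ae r t) (AS r t)) Sper.
have jV := jet_comb (2 / q) (-1) jAq jSq.
have := circle_mean_mono jV _ (lexx 0) ler01 rho1.
have cA t : {for t, continuous (fun t => Aeps e f z 1 t `^ q)}.
  by have [_ _ dt _ _ _ _ _ _] := jAq; apply: rdiff_cont (dt 1 t _); rewrite normr1.
have cS t : {for t, continuous (fun t => Seps e f F z 1 t `^ q)}.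
  by have [_ _ dt _ _ _ _ _ _] := jSq; apply: rdiff_cont (dt 1 t _); rewrite normr1.
move=> H.
have {H} : Rintegral mu `[0, 1] (fun t => 2 / q * Aeps e f z 0 t `^ q + -1 * Seps e f F z 0 t `^ q) <=
   Rintegral mu `[0, 1] (fun t => 2 / q * Aeps e f z 1 t `^ q + -1 * Seps e f F z 1 t `^ q).
  apply: H.
move=> r t /andP[r0 rr] t01.
rewrite [lap _ _ _ _ _](_ : _ = 2 / q * lap (pow1 q (Aeps e f z) A1) (pow11 q (Aeps e f z) A1 A11) (pow11 q (Aeps e f z) At Att) r t
   - lap (pow1 q (Seps e f F z) (fun r t => 1 * A1 r t + 1 * sq1 F z r t))
      (pow11 q (Seps e f F z) (fun r t => 1 * A1 r t + 1 * sq1 F z r t) (fun r t => 1 * A11 r t + 1 * sq11 F z r t))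
      (pow11 q (Seps e f F z) (fun r t => 1 * At r t + 1 * sqt F z r t) (fun r t => 1 * Att r t + 1 * sqtt F z r t)) r t); last first.
  by rewrite /lap; ring.
rewrite !lap_pow lapA gradA.
have -> : lap (fun r t => 1 * A1 r t + 1 * sq1 F z r t) (fun r t => 1 * A11 r t + 1 * sq11 F z r t)
   (fun r t => 1 * Att r t + 1 * sqtt F z r t) r t =
   lap A1 A11 Att r t + lap (sq1 F z) (sq11 F z) (sqtt F z) r t by rewrite /lap; ring.
rewrite lapA lap_sq.
set A := Aeps e f z r t; set S := Seps e f F z r t.
set a := modc (_ * der f _) ^+ 2; set b := modc (_ * der F _) ^+ 2; set s := sq f z r t.
set G := (2 * pi) ^+ 2 * r ^+ 2 * _ ^+ 2 + _.
have A0 : 0 < A by exact: lt_le_trans e0 (Ae r t).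
have S0 : 0 < S by exact: lt_le_trans A0 (AS r t).
have a0 : 0 <= a by rewrite sqr_ge0.
have ba : b <= a.
  rewrite /a /b lerXn2r ?nnegrE ?modc_ge0//.
  rewrite [modc (_ * der F _)]modcM [modc (_ * der f _)]modcM; apply: ler_wpM2l; first exact: modc_ge0.
  by apply: dFf; apply: (up_lt1 rz); rewrite ger0_norm// ltW.
have sA : s <= A by rewrite /A /Aeps !mul1r lerDl ltW.
have G0 : 0 <= G.
  apply: addr_ge0; last exact: sqr_ge0.
  apply: mulr_ge0; last exact: sqr_ge0.
  by apply: mulr_ge0; [exact: ltW (k_gt0)|exact: sqr_ge0].
have SA : S `^ (q - 1) <= A `^ (q - 1) by apply: le_powR_neg; rewrite ?AS// subr_le0.
have EA : A `^ (q - 1) = A * A `^ (q - 1 - 1).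
  exact: powR_pred.
have w0 : 0 <= A `^ (q - 1 - 1) by exact: powR_ge0.
have v0 : 0 <= S `^ (q - 1 - 1) by exact: powR_ge0.
have u0 : 0 <= S `^ (q - 1) by exact: powR_ge0.
set w := A `^ (q - 1 - 1) in EA w0 *; set v := S `^ (q - 1 - 1) in v0 *.
set u := S `^ (q - 1) in SA u0 *; rewrite EA in SA *.
have kk0 := ltW (@k_gt0 R); set k := (2 * pi) ^+ 2 in kk0 G0 *.
clearbody k.
have A0' := ltW A0; have q0' := ltW q0.
have q1' : 0 <= 1 - q by rewrite subr_ge0.
have As0 : 0 <= A - s by rewrite subr_ge0.
have ab0 : 0 <= a - b by rewrite subr_ge0.
have Au0 : 0 <= A * w - u by rewrite subr_ge0.
have h4 : 0 <= 4 :> R by []. have h8 : 0 <= 8 :> R by [].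
have T1 : 0 <= q * (1 - q) * v * G by apply: mulr_ge0 => //; apply: mulr_ge0 => //; exact: mulr_ge0.
have T2 : 0 <= 8 * (1 - q) * w * k * a * (A - s).
  by do 4!(apply: mulr_ge0 => //); exact: mulr_ge0.
have T3 : 0 <= q * 4 * k * u * (a - b).
  by do 3!(apply: mulr_ge0 => //); exact: mulr_ge0.
have T4 : 0 <= q * 8 * k * a * (A * w - u).
  by do 3!(apply: mulr_ge0 => //); exact: mulr_ge0.
(* The four terms have a sign because, in order, [q <= 1], [s <= A], [|F'| <= |f'|] and
   [S^(q-1) <= A^(q-1)]. The coefficient [2 / q] compensates for the factor [q] left by the gradient
   term of [A] and for the two Laplacians, of [|f|^2] and [|F|^2], contained in that of [S]. *)
have -> : 2 / q * (q * (A * w) * (k * (4 * a)) + q * (q - 1) * w * (k * (4 * a * s))) -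
   (q * u * (k * (4 * a) + k * (4 * b)) + q * (q - 1) * v * G) =
   q * (1 - q) * v * G + 8 * (1 - q) * w * k * a * (A - s) + q * 4 * k * u * (a - b)
   + q * 8 * k * a * (A * w - u).
  by field; rewrite gt_eqF.
by rewrite !addr_ge0.
rewrite [leRHS]Rintegral01D; last 2 first.
- by move=> t _; apply: cvgM; [exact: cvg_cst|exact: cA].
- by move=> t _; apply: cvgM; [exact: cvg_cst|exact: cS].
rewrite Rintegral01Z; last by move=> t _; exact: cA.
rewrite Rintegral01Z; last by move=> t _; exact: cS.
move=> H; rewrite -subr_ge0; move: H; rewrite mulN1r; apply: le_trans; last first.
  (* At the centre [F] vanishes, so [S = A] there and the combination is [(2 / q - 1) A^q >= 0]. *)
  apply: Rintegral01_ge0 => t _.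
  have -> : Seps e f F z 0 t = Aeps e f z 0 t.
    by rewrite /Seps /Aeps [X in _ + 1 * X]/sq /up mul0r F0 /dot !mul0r addr0 mulr0 addr0 mul1r.
  rewrite -mulrDl mulr_ge0 ?powR_ge0// subr_ge0 ler_pdivlMr// mul1r.
  by rewrite (le_trans q1)// ler1n.
Qed.

End SmallExponent.

End CircleMeans.

(** * Circle estimates for all exponents *)

Section CircleEstimates.
Context {R : realType}.
Local Notation C := R[i].
Local Notation mu := (@lebesgue_measure R).
Implicit Types (f g F h : C -> C) (z : C) (p q e : R).

(** The base case is [p <= 2] because [|f|^p] is handled as the power [p / 2] of [|f|^2], and the
    Laplacian computations require an exponent at most [1]. *)
Lemma doubling_ind (P : R -> Prop) : (forall p, 0 < p -> p <= 2 -> P p) ->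
  (forall p, 0 < p -> P p -> P (2 * p)) -> forall p, 0 < p -> P p.
Proof.
move=> small dbl p p0.
have [n pn] : exists n : nat, p <= 2 * 2 ^+ n.
  exists (Num.truncn p).+1; apply: ltW; apply: (lt_le_trans (truncnS_gt p)).
  apply: (@le_trans _ _ (2 ^+ (Num.truncn p).+1)).
    by rewrite -natrX ler_nat ltnW// ltn_expl.
  by rewrite ler_peMl ?exprn_ge0// ler1n.
elim: n p p0 pn => [|n IH] p p0 pn; first by apply: small => //; rewrite expr0 mulr1 in pn.
have -> : p = 2 * (p / 2) by field.
apply: dbl; first by rewrite divr_gt0.
by apply: IH; [rewrite divr_gt0|rewrite ler_pdivrMr//; move: pn; rewrite exprS; lra].
Qed.

Lemma powR_half x p : 0 <= x -> x `^ p = (x ^+ 2) `^ (p / 2).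
Proof. by move=> x0; rewrite powR_sqr//; congr (_ `^ _); field. Qed.

Lemma sqE f z r t : sq f z r t = modc (f (r%:C * z * expi t)) ^+ 2.
Proof. by rewrite /sq dot_modc /up mulrA. Qed.

Lemma cont_Aeps e f z t q (r : R) : 0 < e -> analytic f -> modc (r%:C * z) < 1 ->
  {for t, continuous (fun t => Aeps e f z r t `^ q)}.
Proof.
move=> e0 hf z1; apply: continuous_powR.
  by rewrite /Aeps !mul1r ltr_wpDl// sq_ge0.
rewrite /Aeps; apply: cvgD; last exact: cvg_cst.
apply: cvgM; first exact: cvg_cst.
have -> : sq f z r = fun t => modc (f (r%:C * z * expi t)) ^+ 2 by apply/funext => u; rewrite sqE.
by apply: cont_modc2; apply: circle_cont => //; exact: holo_ccont.
Qed.

Lemma Aeps_ge e f z t p (r : R) : 0 < e -> 0 < p ->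
  modc (f (r%:C * z * expi t)) `^ p <= Aeps e f z r t `^ (p / 2).
Proof.
move=> e0 p0; rewrite powR_half ?modc_ge0// -sqE.
apply: powR_le_mono; [by rewrite divr_ge0// ltW|exact: sq_ge0|].
by rewrite /Aeps !mul1r lerDl ltW.
Qed.

Lemma Aeps_le e f z p : 0 < e -> 0 < p -> p <= 2 -> analytic f -> modc z < 1 ->
  Rintegral mu `[0, 1] (fun t => Aeps e f z 1 t `^ (p / 2)) <= mp p f z + e `^ (p / 2).
Proof.
move=> e0 p0 p2 hf z1; rewrite mpE -[X in _ <= _ + X](Rintegral01_cst (e `^ (p / 2))).
have cf t := @mp_cont R p f z t p0 (holo_ccont hf) z1.
rewrite -Rintegral01D; [|by move=> t _; exact: cf|by move=> t _; exact: cvg_cst].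
apply: le_Rintegral01.
- by move=> t _; apply: cont_Aeps => //; rewrite mul1r.
- by move=> t _; apply: cvgD; [exact: cf|exact: cvg_cst].
move=> t _; rewrite /Aeps !mul1r sqE mul1r.
rewrite [_ `^ p]powR_half ?modc_ge0//; apply: powR_subadd; [exact: sqr_ge0|exact: ltW|lra|lra].
Qed.

(** For [p <= 2] it is the limit of [mean_mono_eps] as [e] tends to [0], the error being at most
    [e^(p / 2)]; the doubling step applies the statement to [f^2]. *)
Lemma mp_mono p f z r : 0 < p -> analytic f -> modc z < 1 -> 0 <= r <= 1 ->
  mp p f (r%:C * z) <= mp p f z.
Proof.
move=> p0; move: p p0 f z r; apply: doubling_ind => [p p0 p2|p p0 IH] f z r hf z1 r01; last first.
  by rewrite -!mp_sqr; apply: IH => //; exact: holoX.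
apply/ler_addgt0Pr => d d0.
have p20 : 0 < p / 2 by rewrite divr_gt0.
have p21 : p / 2 <= 1 by lra.
have [e e0 eH] := powR_small p20 d0.
apply: (@le_trans _ _ (mp p f z + e `^ (p / 2))); last by rewrite lerD2l eH// ltW.
apply: le_trans (Aeps_le e0 p0 p2 hf z1).
apply: le_trans (mean_mono_eps p20 p21 e0 hf z1 r01).
have rz1 := modc_tz r01 z1.
rewrite mpE; apply: le_Rintegral01.
- by move=> t _; apply: mp_cont => //; exact: holo_ccont.
- by move=> t _; exact: cont_Aeps.
- by move=> t _; exact: Aeps_ge.
Qed.

Lemma mp0 p f : mp p f 0 = modc (f 0) `^ p.
Proof.
by rewrite mpE -[RHS]Rintegral01_cst; apply: eq_Rintegral01 => t _; rewrite mul0r.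
Qed.

Lemma mp_center p f z : 0 < p -> analytic f -> modc z < 1 -> modc (f 0) `^ p <= mp p f z.
Proof.
move=> p0 hf z1; rewrite -mp0 -(mul0r z); apply: (mp_mono (r := 0)) => //.
by rewrite lexx ler01.
Qed.

(** The parameter [a] lets [mp_Sop] absorb the first term of the right-hand side, whatever constant
    precedes the mean of the product. *)
Lemma mp_AMGM p f g z (a : R) : 0 < p -> ccontD1 f -> ccontD1 g -> modc z < 1 ->
  a * mp p (fun z => f z * g z) z <= 2^-1 * mp (2 * p) f z + 2^-1 * a ^+ 2 * mp (2 * p) g z.
Proof.
move=> p0 cf cg z1; have pp0 : 0 < 2 * p by rewrite mulr_gt0.
have cfg : ccontD1 (fun z => f z * g z) by move=> w w1; apply: ccontM; [exact: cf|exact: cg].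
have c1 t := @mp_cont R _ f z t pp0 cf z1.
have c2 t := @mp_cont R _ g z t pp0 cg z1.
have c3 t := @mp_cont R _ _ z t p0 cfg z1.
rewrite !mpE -(Rintegral01Z a (fun t _ => c3 t)) -(Rintegral01Z _ (fun t _ => c1 t)).
rewrite -(Rintegral01Z _ (fun t _ => c2 t)) -Rintegral01D; last 2 first.
- by move=> t _; apply: cvgM; [exact: cvg_cst|exact: c1].
- by move=> t _; apply: cvgM; [exact: cvg_cst|exact: c2].
apply: le_Rintegral01 => t _.
- by apply: cvgM; [exact: cvg_cst|exact: c3].
- by apply: cvgD; (apply: cvgM; first exact: cvg_cst); [exact: c1|exact: c2].
rewrite modcM powRM ?modc_ge0// [2 * p]mulrC !powRrM !powR_mulrn ?powR_ge0//.
set x := _ `^ p; set y := _ `^ p.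
have := sqr_ge0 (x - a * y); lra.
Qed.

(* Passing from [p] to [2 p] uses [Sop_sqr]: the term containing [S_g f] on the right
   is absorbed in the left-hand side by AM-GM. *)
Lemma mp_Sop p : 0 < p -> exists2 c : R, 0 <= c & forall f g z (M : R),
  analytic f -> analytic g -> (forall w, modc w < 1 -> modc (g w) <= M) -> modc z < 1 ->
  mp p (SS g f) z <= c * M `^ p * mp p f z.
Proof.
move: p; apply: doubling_ind => [p p0 p2|p p0 [c c0 IH]].
  (* [4 / p] is the [2 / q] of [mean_S_eps] for [q = p / 2]. *)
  exists (4 / p); first by rewrite divr_ge0// ltW.
  move=> f g z M hf hg gM z1.
  have M0 : 0 <= M by apply: le_trans (modc_ge0 (g 0)) (gM _ _); rewrite modc0.
  have p20 : 0 < p / 2 by rewrite divr_gt0.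
  have p21 : p / 2 <= 1 by lra.
  have hS := holo_Sop hg hf.
  (* The comparison function is [M f]: since [(S_g f)' = f' g], its derivative dominates that of
     [S_g f]. *)
  have hMf := holoZ (M%:C) hf.
  have E := mpZ (M%:C) p0 (holo_ccont hf) z1; rewrite modc_real ger0_norm// in E.
  rewrite -mulrA -E.
  have dom w : modc w < 1 -> modc (der (SS g f) w) <= modc (der (fun z => M%:C * f z) w).
    move=> w1; rewrite (cder_cderiv (cder_Sop hg hf w1)).
    have/holoP/(_ w w1) df := hf.
    rewrite (cder_cderiv (cderZ M%:C df)) mulrC !modcM modc_real ger0_norm//.
    by apply: ler_wpM2r; [exact: modc_ge0|exact: gM].
  apply/ler_addgt0Pr => d d0.
  have d'0 : 0 < d / (4 / p) by rewrite !divr_gt0.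
  have [e e0 eH] := powR_small p20 d'0.
  apply: (@le_trans _ _ (4 / p * (mp p (fun z => M%:C * f z) z + e `^ (p / 2)))); last first.
    rewrite mulrDr lerD2l mulrC -ler_pdivlMr ?divr_gt0//; exact/eH/lexx/ltW.
  apply: (@le_trans _ _ (4 / p * Rintegral mu `[0, 1] (fun t => Aeps e (fun z => M%:C * f z) z 1 t `^ (p / 2)))); last first.
    apply: ler_wpM2l; first by rewrite divr_ge0// ltW.
    exact: Aeps_le.
  have -> : 4 / p = 2 / (p / 2) by field; rewrite gt_eqF.
  apply: le_trans (mean_S_eps p20 p21 e0 hMf hS (Sop0 g f) dom z1).
  have cS t : {for t, continuous (fun t => Seps e (fun z => M%:C * f z) (SS g f) z 1 t `^ (p / 2))}.
    apply: continuous_powR.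
      rewrite /Seps /Aeps !mul1r; apply: ltr_wpDr; first exact: sq_ge0.
      by apply: ltr_wpDl => //; exact: sq_ge0.
    rewrite /Seps /Aeps.
    apply: cvgD; [apply: cvgM; [exact: cvg_cst|apply: cvgD; last exact: cvg_cst]|]; (apply: cvgM; first exact: cvg_cst).
    - have -> : sq (fun z => M%:C * f z) z 1 = fun t => modc (M%:C * f (1%:C * z * expi t)) ^+ 2.
        by apply/funext => u; rewrite sqE.
      apply: cont_modc2; apply: (@circle_cont _ (fun z => M%:C * f z)); [exact: holo_ccont|by rewrite mul1r].
    - have -> : sq (SS g f) z 1 = fun t => modc (SS g f (1%:C * z * expi t)) ^+ 2.
        by apply/funext => u; rewrite sqE.
      by apply: cont_modc2; apply: circle_cont; [exact: holo_ccont|rewrite mul1r].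
  rewrite mpE; apply: le_Rintegral01 => [t _|t _|t _].
  - by apply: mp_cont => //; exact: holo_ccont.
  - exact: cS.
  - rewrite powR_half ?modc_ge0//; apply: powR_le_mono; [exact: ltW|exact: sqr_ge0|].
    rewrite /Seps /Aeps !mul1r [sq (SS g f) _ _ _]sqE mul1r lerDr.
    by apply: addr_ge0; [exact: sq_ge0|exact: ltW].
(* With [A = 4^p c M^p], the estimates below give [X <= X / 2 + A^2 Y / 2 + 2^p c^2 M^(2 p) Y];
   absorbing [X / 2] doubles the other terms. *)
exists ((2 `^ p * 2 `^ p * c) ^+ 2 + 2 * (2 `^ p * c ^+ 2)).
  by rewrite addr_ge0 ?sqr_ge0// !mulr_ge0 ?powR_ge0 ?sqr_ge0.
move=> f g z M hf hg gM z1.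
have M0 : 0 <= M by apply: le_trans (modc_ge0 (g 0)) (gM _ _); rewrite modc0.
have hS := holo_Sop hg hf.
have hf2 := holoX 2 hf.
have hFf := holoM hS hf.
have hSf2 := holo_Sop hg hf2.
have hSFf := holo_Sop hg hFf.
have hSS := holo_Sop hg hSf2.
have c2 : 0 <= 2 `^ p :> R by exact: powR_ge0.
have Mp0 : 0 <= M `^ p by exact: powR_ge0.
set X := mp (2 * p) (SS g f) z; set Y := mp (2 * p) f z.
have H1 : X <= 2 `^ p * (2 `^ p * mp p (SS g (fun z => SS g f z * f z)) z + mp p (SS g (SS g (fun z => f z ^+ 2))) z).
  rewrite /X -mp_sqr.
  have -> : 2 `^ p * mp p (SS g (fun z => SS g f z * f z)) z = mp p (fun z => 2%:C * SS g (fun z => SS g f z * f z) z) z.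
    rewrite mpZ//; first by rewrite modc_real ger0_norm.
    exact: holo_ccont.
  apply: mp_triangle => //; try exact: holo_ccont.
  - exact/holo_ccont/holoZ.
  - exact/holo_ccont/holoX.
  - move=> w w1; rewrite (Sop_sqr hg hf w1); apply: le_trans (modcB _ _) _.
    by rewrite (_ : 2%:C = 2)// rmorphMn.
have H2 := IH _ _ _ _ hFf hg gM z1.
have H3 := IH _ _ _ _ hSf2 hg gM z1.
have H4 := IH _ _ _ _ hf2 hg gM z1.
rewrite mp_sqr -/Y in H4.
set A := 2 `^ p * 2 `^ p * c * M `^ p.
have A0 : 0 <= A by rewrite !mulr_ge0.
have H5 := mp_AMGM A p0 (holo_ccont hS) (holo_ccont hf) z1; rewrite -/X -/Y in H5.
have Y0 : 0 <= Y by exact: mp_ge0.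
have M2 : M `^ (2 * p) = M `^ p ^+ 2 by rewrite mulrC powRrM powR_mulrn ?powR_ge0.
rewrite M2.
have H6 : mp p (SS g (SS g (fun z => f z ^+ 2))) z <= c * M `^ p * (c * M `^ p * Y).
  by apply: le_trans H3 _; apply: ler_wpM2l => //; rewrite mulr_ge0.
have H7 : X <= A * mp p (fun z => SS g f z * f z) z + 2 `^ p * (c * M `^ p * (c * M `^ p * Y)).
  apply: le_trans H1 _; rewrite mulrDr; apply: lerD; last by apply: ler_wpM2l.
  rewrite mulrA /A -[2 `^ p * _ * c * _]mulrA -[leRHS]mulrA.
  by apply: ler_wpM2l => //; exact: mulr_ge0.
move: H5 H7; rewrite /A; clear; set u := M `^ p; set k := 2 `^ p.
have -> : (k * k * c * u) ^+ 2 = (k * k * c) ^+ 2 * u ^+ 2 by ring.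
lra.
Qed.

End CircleEstimates.

(** * Rotation invariance of circle means and operators bounded on them *)

Section CircleOperators.
Context {R : realType}.
Local Notation C := R[i].
Local Notation mu := (@lebesgue_measure R).
Implicit Types (f g F h : C -> C) (z : C) (p q e : R).

Lemma rdiff0_cst (F : R -> R) (a b : R) : a <= b -> (forall x, a <= x <= b -> rdiff F x 0) -> F a = F b.
Proof.
move=> ab dF; apply/eqP; rewrite eq_le; apply/andP; split.
  by apply: (rdiff_mono ab dF) => x _; exact: lexx.
have dN x : a <= x <= b -> rdiff (fun y => -1 * F y) x 0.
  by move=> /dF d; apply: rdiff_eq (rdiffZ (-1) d) _; rewrite mulr0.
have := rdiff_mono ab dN (fun x _ => lexx 0).
by rewrite !mulN1r lerN2.
Qed.

Lemma cont_primitive (h : R -> R) (n : R) : 0 < n -> (forall t, {for t, continuous h}) ->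
  exists V : R -> R, forall x, -n <= x <= n -> rdiff V x (h x).
Proof.
move=> n0 ch.
exists (fun x => (\int[mu]_(t in `[- n - 1, x]) h t)%R) => t /andP[t0 t1].
have [||||d e] := @continuous_FTC1_closed _ h (- n - 1) t (n + 1).
- by rewrite (le_lt_trans t1)// ltrDl.
- apply: continuous_compact_integrable; first exact: segment_compact.
  exact: continuous_subspaceT.
- by rewrite (lt_le_trans _ t0)// ltrBlDr ltrDl.
- exact: ch.
by split; [exact: d|rewrite -derive1E; exact: e].
Qed.

Lemma rdiff_shift (F : R -> R) (x a l : R) : rdiff F (x + a) l -> rdiff (fun y => F (y + a)) x l.
Proof.
rewrite /rdiff => /is_derive1P dF; apply/is_derive1P => e /dF[d d0 dH]; exists d => // y yd.
have E : (y + a) - (x + a) = y - x by rewrite opprD addrACA subrr addr0.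
by have := dH (y + a); rewrite E; exact.
Qed.

(** For a primitive [V] of [h], the function [V (x + 1) - V x] has derivative
    [h (x + 1) - h x = 0]. *)
Lemma periodic_mean (h : R -> R) (s : R) : (forall t, {for t, continuous h}) ->
  (forall t, h (t + 1) = h t) ->
  Rintegral mu `[0, 1] (fun t => h (s + t)) = Rintegral mu `[0, 1] h.
Proof.
move=> ch per; pose n := `|s| + 1.
have n0 : 0 < n by rewrite ltr_wpDl.
have [V dV] := cont_primitive n0 ch.
have sn : -n <= s - 1 /\ s + 1 <= n.
  by have := ler_norm s; have := ler_norm (- s); rewrite normrN /n; lra.
have chs t : {for t, continuous (fun t => h (s + t))}.
  apply: (@continuous_comp _ _ _ (fun t : R => s + t) h); last exact: ch.
  by apply: cvgD; [exact: cvg_cst|exact: cvg_id].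
have n1 : 1 <= n by rewrite /n lerDr.
have -> : Rintegral mu `[0, 1] (fun t => h (s + t)) = V (1 + s) - V (0 + s).
  apply: (@Rintegral01_FTC _ _ (fun t => V (t + s))) => [t _|t /andP[t0 t1]]; first exact: chs.
  by rewrite addrC; apply: rdiff_shift; apply: dV; lra.
have -> : Rintegral mu `[0, 1] h = V 1 - V 0.
  by apply: Rintegral01_FTC => [t _|t /andP[t0 t1]]; [exact: ch|apply: dV; lra].
pose D x := V (x + 1) + -1 * V x.
have dD x : - `|s| <= x <= `|s| -> rdiff D x 0.
  move=> /andP[x0 x1]; have -> : 0 = h (x + 1) + -1 * h x by rewrite per mulN1r subrr.
  apply: rdiffD; last by apply: rdiffZ; apply: dV; rewrite /n; lra.
  by apply: rdiff_shift; apply: dV; rewrite /n; lra.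
have : D s = D 0.
  have ab := ler_norm s; have an := ler_norm (- s); rewrite normrN in an.
  have [s0|s0] := leP 0 s.
    by apply/esym; apply: rdiff0_cst => // x /andP[x0 xs]; apply: dD; lra.
  by apply: rdiff0_cst => [|x /andP[x0 xs]]; [exact: ltW|apply: dD; lra].
rewrite /D add0r [1 + s]addrC add0r; lra.
Qed.

Lemma mp_radial p f z w : 0 < p -> ccontD1 f -> modc z < 1 -> modc w = modc z ->
  mp p f w = mp p f z.
Proof.
move=> p0 cf z1 wz; have [s zs] := polar z; have [s' ws] := polar w.
have red x u : x = (modc z)%:C * expi u -> mp p f x = mp p f (modc z)%:C.
  move=> xu; rewrite !mpE.
  have m1 : modc (modc z)%:C < 1 by rewrite modc_real ger0_norm ?modc_ge0.
  rewrite -(@periodic_mean (fun t => modc (f ((modc z)%:C * expi t)) `^ p) u).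
  - by apply: eq_Rintegral01 => t _; rewrite xu -mulrA -expiD.
  - by move=> t; exact: mp_cont.
  - by move=> t; rewrite expiD expi1 mulr1.
by rewrite (red _ _ zs) (red _ s')// -wz.
Qed.

Lemma mp_mono_le p f z w : 0 < p -> analytic f -> modc z < 1 -> modc w <= modc z ->
  mp p f w <= mp p f z.
Proof.
move=> p0 hf z1; have [z0|z0] := eqVneq (modc z) 0.
  move=> wz; have -> : w = 0.
    by apply/eqP; rewrite -modc_eq0 eq_le modc_ge0 andbT -z0.
  by rewrite mp0 mp_center.
have zp : 0 < modc z by rewrite lt_def z0 modc_ge0.
move=> wz; pose r := modc w / modc z.
have r0 : 0 <= r by rewrite divr_ge0 ?modc_ge0.
have r1 : r <= 1 by rewrite ler_pdivrMr ?mul1r.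
have rw : modc w = modc (r%:C * z) by rewrite modcM modc_real ger0_norm// /r divfK.
have rz1 : modc (r%:C * z) < 1 by rewrite -rw (le_lt_trans wz).
rewrite (mp_radial p0 (holo_ccont hf) rz1 rw).
by apply: mp_mono => //; rewrite r0 r1.
Qed.

Lemma mp_cst p (a : C) z : mp p (fun=> a) z = modc a `^ p.
Proof. by rewrite mpE; exact: Rintegral01_cst. Qed.

(** The integrand exceeds half its value at [t = 0] on an interval [[0, e]]; the comparison is made
    on a primitive. *)
Lemma mp_gt0 p f z : 0 < p -> ccontD1 f -> modc z < 1 -> f z != 0 -> 0 < mp p f z.
Proof.
move=> p0 cf z1 fz; pose h t := modc (f (z * expi t)) `^ p.
have ch t : {for t, continuous h} by exact: mp_cont.
have h0 : 0 < h 0 by rewrite /h expi0 mulr1 powR_gt0// lt_def modc_ge0 modc_eq0 fz.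
have [V dV] := @cont_primitive h 1 ltr01 ch.
have E : mp p f z = V 1 - V 0.
  rewrite mpE.
  apply: Rintegral01_FTC => [t _|t /andP[t0 t1]]; first exact: ch.
  by apply: dV; lra.
have c20 : 0 < h 0 / 2 by rewrite divr_gt0.
have /cvgrPdist_lt/(_ _ c20)/nbhs_ballP[d /= d0 dH] := ch 0.
pose e := Num.min 1 (d / 2).
have e0 : 0 < e by rewrite /e lt_min ltr01 divr_gt0.
have e1 : e <= 1 by rewrite /e ge_min lexx.
have ed : e < d by rewrite /e gt_min; apply/orP; right; lra.
have H1 : V e <= V 1.
  apply: (rdiff_mono (df := h) e1) => x /andP[x0 x1]; first by apply: dV; lra.
  exact: powR_ge0.
have H2 : V 0 + - (h 0 / 2) * 0 <= V e + - (h 0 / 2) * e.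
  apply: (rdiff_mono (f := fun x => V x + - (h 0 / 2) * x) (df := fun x => h x + - (h 0 / 2) * 1)); first exact: ltW.
    move=> x /andP[x0 x1]; apply: rdiffD; first by apply: dV; lra.
    by apply: rdiffZ; exact: rdiff_id.
  move=> x /andP[x0 x1]; have xb : ball 0 d x.
    by rewrite /ball/= sub0r normrN ger0_norm ?(ltW x0)// (lt_trans x1).
  by have /ltr_normlW := dH x xb; lra.
have H3 : 0 < h 0 / 2 * e by rewrite mulr_gt0.
rewrite E; lra.
Qed.

Lemma mp_Mul p f g z (M : R) : 0 < p -> ccontD1 f -> ccontD1 g ->
  (forall w, modc w < 1 -> modc (g w) <= M) -> modc z < 1 ->
  mp p (fun z => f z * g z) z <= M `^ p * mp p f z.
Proof.
move=> p0 cf cg gM z1; apply: mp_le => //; last 2 first.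
- exact: powR_ge0.
- move=> w w1 _; rewrite modcM powRM ?modc_ge0// mulrC.
  by apply: ler_wpM2r; [exact: powR_ge0|apply: powR_le_mono; [exact: ltW|exact: modc_ge0|exact: gM]].
by move=> w w1; apply: ccontM; [exact: cf|exact: cg].
Qed.

Lemma mp_Top p : 0 < p -> exists2 c : R, 0 <= c & forall f g z (M : R),
  analytic f -> analytic g -> (forall w, modc w < 1 -> modc (g w) <= M) -> modc z < 1 ->
  mp p (TT g f) z <= c * M `^ p * mp p f z.
Proof.
move=> p0; have [c c0 Hc] := mp_Sop p0; have P2 : 0 <= 2 `^ p :> R by exact: powR_ge0.
exists (2 `^ p * (2 `^ p * 2 + c)); first by rewrite mulr_ge0// addr_ge0// mulr_ge0.
move=> f g z M hf hg gM z1.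
have H1 := Hc _ _ _ _ hf hg gM z1.
have H2 := mp_Mul p0 (holo_ccont hf) (holo_ccont hg) gM z1.
have d01 : modc (0 : C) < 1 by rewrite modc0.
have H3 : mp p (fun=> f 0 * g 0) z <= M `^ p * mp p f z.
  have -> : mp p (fun=> f 0 * g 0) z = modc (f 0 * g 0) `^ p by exact: mp_cst.
  rewrite modcM powRM ?modc_ge0// mulrC; apply: ler_pM; try exact: powR_ge0.
    by apply: powR_le_mono; [exact: ltW|exact: modc_ge0|exact: gM].
  exact: mp_center.
have hfg := holoM hf hg; have hc := holo_cst (f 0 * g 0); have hS := holo_Sop hg hf.
have H4 : mp p (fun z => f z * g z - f 0 * g 0) z <= 2 `^ p * (mp p (fun z => f z * g z) z + mp p (fun=> f 0 * g 0) z).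
  apply: mp_triangle => //; try exact: holo_ccont; last by move=> w _; exact: modcB.
  exact/holo_ccont/holoB.
have H5 : mp p (TT g f) z <= 2 `^ p * (mp p (fun z => f z * g z - f 0 * g 0) z + mp p (SS g f) z).
  apply: mp_triangle => //; try exact: holo_ccont.
  - exact/holo_ccont/holoB.
  - exact/holo_ccont/holo_Top.
  - by move=> w w1; rewrite (Top_parts hg hf w1); exact: modcB.
apply: le_trans H5 _; rewrite -!mulrA; apply: ler_wpM2l => //.
rewrite mulrDl; apply: lerD; last by rewrite mulrA.
apply: le_trans H4 _; rewrite -mulrA; apply: ler_wpM2l => //.
by rewrite mulr2n mulrDl mul1r lerD.
Qed.

(** [c] is the constant of [mp_Top] for symbols bounded by [1], hence independent of [n]. *)
Lemma mp_Top_id_pow p : 0 < p -> exists2 c : R, 0 <= c & forall n f z,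
  analytic f -> modc z < 1 ->
  mp p (TT id (fun z => z ^+ n * f z)) z <= c * n.+1%:R^-1 `^ p * mp p f z.
Proof.
move=> p0; have [c c0 Hc] := mp_Top p0; exists c => // n f z hf z1.
have hX := holoX n.+1 (@holo_id R).
have hT := holo_Top hX hf.
rewrite (mp_eqD p (Top_id_pow n hf) z1) (mpZ _ p0 (holo_ccont hT) z1).
have H := Hc f _ z 1 hf hX _ z1; rewrite powR1 mulr1 in H.
have -> : modc (n.+1%:R^-1 : C) = n.+1%:R^-1.
  rewrite modcV (_ : n.+1%:R = (n.+1%:R : R)%:C); last by rewrite rmorph_nat.
  by rewrite modc_real ger0_norm.
rewrite [c * _]mulrC -mulrA; apply: ler_wpM2l; first exact: powR_ge0.
apply: H => w w1; rewrite modcX; apply: exprn_ile1; [exact: modc_ge0|exact: ltW].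
Qed.

Lemma mp_sum2 p f g z : 0 < p -> analytic f -> analytic g -> modc z < 1 ->
  mp p (fun z => f z + g z) z <= 2 `^ p * (mp p f z + mp p g z).
Proof.
move=> p0 hf hg z1; apply: mp_triangle => //; try exact: holo_ccont; last by move=> w _; exact: modcD.
exact/holo_ccont/holoD.
Qed.

(** Bounds circle by circle do not mention the weight and integrate against every radial one; the
    class is closed under composition and linear combinations. *)
Definition circle_bounded p (L : (C -> C) -> C -> C) : Prop :=
  exists2 c : R, 0 <= c & forall f, analytic f ->
    analytic (L f) /\ forall z, modc z < 1 -> mp p (L f) z <= c * mp p f z.

Lemma circle_bounded_comp p L1 L2 : circle_bounded p L1 -> circle_bounded p L2 ->
  circle_bounded p (L1 \o L2).
Proof.
move=> [c c0 H] [d d0 H']; exists (c * d); first exact: mulr_ge0.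
move=> f /H'[hf bf]; have [h b] := H _ hf; split=> // z z1.
by apply: le_trans (b z z1) _; rewrite -mulrA; apply: ler_wpM2l => //; exact: bf.
Qed.

Lemma circle_bounded_add p L1 L2 : 0 < p -> circle_bounded p L1 -> circle_bounded p L2 ->
  circle_bounded p (fun f z => L1 f z + L2 f z).
Proof.
move=> p0 [c c0 H] [d d0 H']; exists (2 `^ p * (c + d)).
  by rewrite mulr_ge0 ?powR_ge0// addr_ge0.
move=> f hf; have [h b] := H _ hf; have [h' b'] := H' _ hf; split; first exact: holoD.
move=> z z1; apply: le_trans (mp_sum2 p0 h h' z1) _.
rewrite -mulrA; apply: ler_wpM2l; first exact: powR_ge0.
by rewrite mulrDl lerD// ?b ?b'.
Qed.

Lemma circle_bounded_scale p L (a : C) : 0 < p -> circle_bounded p L ->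
  circle_bounded p (fun f z => a * L f z).
Proof.
move=> p0 [c c0 H]; exists (modc a `^ p * c); first by rewrite mulr_ge0 ?powR_ge0.
move=> f hf; have [h b] := H _ hf; split; first exact: holoZ.
move=> z z1; rewrite (mpZ a p0 (holo_ccont h) z1).
by rewrite -mulrA; apply: ler_wpM2l; [exact: powR_ge0|exact: b].
Qed.

Lemma circle_bounded_eval p (a : C) : 0 < p -> circle_bounded p (fun f _ => a * f 0).
Proof.
move=> p0; exists (modc a `^ p); first exact: powR_ge0.
move=> f hf; split; first exact: holo_cst.
move=> z z1; have -> : mp p (fun=> a * f 0) z = modc (a * f 0) `^ p by exact: mp_cst.
rewrite modcM powRM ?modc_ge0//; apply: ler_wpM2l; first exact: powR_ge0.
exact: mp_center.
Qed.

Lemma circle_bounded_id p : circle_bounded p id.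
Proof. by exists 1 => // f hf; split=> // z _; rewrite mul1r. Qed.

Lemma circle_bounded_Sop p g (M : R) : 0 < p -> analytic g ->
  (forall w, modc w < 1 -> modc (g w) <= M) -> circle_bounded p (SS g).
Proof.
move=> p0 hg gM; have [c c0 H] := mp_Sop p0; exists (c * M `^ p).
  by rewrite mulr_ge0 ?powR_ge0.
by move=> f hf; split=> [|z z1]; [exact: holo_Sop|exact: H].
Qed.

Lemma circle_bounded_Top p g (M : R) : 0 < p -> analytic g ->
  (forall w, modc w < 1 -> modc (g w) <= M) -> circle_bounded p (TT g).
Proof.
move=> p0 hg gM; have [c c0 H] := mp_Top p0; exists (c * M `^ p).
  by rewrite mulr_ge0 ?powR_ge0.
by move=> f hf; split=> [|z z1]; [exact: holo_Top|exact: H].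
Qed.

End CircleOperators.

(** * Integration over the disc *)

Section PlaneMeasure.
Context {R : realType}.
Local Notation C := R[i].
Local Notation mu := (@lebesgue_measure R).
Local Notation RR := (measurableTypeR R).
Local Notation mu2 := (mu \x mu)%E.

Lemma lebesgue_translation (a : R) (A : set R) : measurable A ->
  pushforward mu (+%R a : RR -> RR) A = mu A.
Proof.
move=> mA; have ma : measurable_fun setT (+%R a : RR -> RR).
  exact: measurable_funD.
pose m := pushforward mu (MeasurableFun.pack_ (MeasurableFun.Class (isMeasurableFun.Build _ _ _ _ _ ma))).
apply/esym; apply: (@lebesgue_measure_unique R m) => //= _ [[b c]] _ <-.
rewrite /m /pushforward/=.
have -> : +%R a @^-1` `]b, c] = `](b - a), (c - a)]%classic.
  by apply/seteqP; split=> x /=; rewrite !in_itv/= ltrBlDl lerBrDl.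
rewrite !lebesgue_measure_itv/= !lte_fin ltrD2r -!EFinB.
by have -> : c - a - (b - a) = c - b by ring.
Qed.

Lemma integral_translation (a : R) (f : R -> \bar R) : measurable_fun [set: RR] f ->
  (forall x, 0 <= f x)%E -> (\int[mu]_x f (a + x)%R = \int[mu]_x f x)%E.
Proof.
move=> mf f0; have ma : measurable_fun setT (+%R a : RR -> RR).
  exact: measurable_funD.
have := @ge0_integral_pushforward _ _ RR RR R (+%R a) ma mu setT f measurableT mf (fun y _ => f0 y).
rewrite preimage_setT => <-.
apply: eq_measure_integral => A mA _; exact: lebesgue_translation.
Qed.

(* Planar Lebesgue measure is rotation invariant because rotations are products of
   shears, and shears reduce by Tonelli to translations of the line. *)
Definition shear1 (a : R) (u : RR * RR) : RR * RR := (a * u.2 + u.1, u.2).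
Definition shear2 (a : R) (u : RR * RR) : RR * RR := (u.1, a * u.1 + u.2).

Lemma measurable_shear1 a : measurable_fun setT (shear1 a).
Proof.
apply: measurable_fun_pair; last exact: measurable_snd.
apply: measurable_funD; last exact: measurable_fst.
by apply: measurable_funM; [exact: measurable_cst|exact: measurable_snd].
Qed.

Lemma measurable_shear2 a : measurable_fun setT (shear2 a).
Proof.
apply: measurable_fun_pair; first exact: measurable_fst.
apply: measurable_funD; last exact: measurable_snd.
by apply: measurable_funM; [exact: measurable_cst|exact: measurable_fst].
Qed.

Lemma integral_shear1 a (f : RR * RR -> \bar R) : measurable_fun setT f ->
  (forall x, 0 <= f x)%E -> (\int[mu2]_u f (shear1 a u) = \int[mu2]_u f u)%E.
Proof.
move=> mf f0; have ms := measurableT_comp mf (measurable_shear1 a).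
rewrite (fubini_tonelli2 (f \o shear1 a) ms); last by move=> x; exact: f0.
rewrite (fubini_tonelli2 f mf f0); apply: eq_integral => y _.
apply: (@integral_translation (a * y) (fun x => f (x, y))) => //.
exact: measurableT_comp mf (measurable_fun_pair _ _).
Qed.

Lemma integral_shear2 a (f : RR * RR -> \bar R) : measurable_fun setT f ->
  (forall x, 0 <= f x)%E -> (\int[mu2]_u f (shear2 a u) = \int[mu2]_u f u)%E.
Proof.
move=> mf f0; have ms := measurableT_comp mf (measurable_shear2 a).
rewrite (fubini_tonelli1 (f \o shear2 a) ms); last by move=> x; exact: f0.
rewrite (fubini_tonelli1 f mf f0); apply: eq_integral => x _.
apply: (@integral_translation (a * x) (fun y => f (x, y))) => //.
exact: measurableT_comp mf (measurable_fun_pair _ _).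
Qed.

Definition rot (l : C) (u : RR * RR) : RR * RR :=
  (complex.Re l * u.1 - complex.Im l * u.2, complex.Im l * u.1 + complex.Re l * u.2).

Lemma to_c_rot l u : to_c (rot l u) = l * to_c u.
Proof. by rewrite (complexE l); case: l => a b; apply/eqP; rewrite eq_complex /= /rot /to_c /=; apply/andP; split; apply/eqP; ring. Qed.

(** For [l = exp(i theta)], [a] is [- tan(theta / 2)]: this is the factorization of a rotation into
    three shears, undefined only for the half turn. *)
Lemma rot_shear l u : modc l = 1 -> complex.Re l != -1 ->
  let a := - complex.Im l / (1 + complex.Re l) in
  rot l u = shear1 a (shear2 (complex.Im l) (shear1 a u)).
Proof.
move=> l1 lN; have E : complex.Re l ^+ 2 + complex.Im l ^+ 2 = 1 by rewrite -modc_sqr l1 expr1n.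
have c0 : 1 + complex.Re l != 0 by rewrite addrC addr_eq0.
move: E lN c0; case: l l1 u => [c s] _ [x y] /=; rewrite /rot /shear1 /shear2 /= => E _ c0.
have E1 : s * (- s / (1 + c)) = c - 1.
  rewrite mulrA mulrN; have -> : s * s = (1 - c) * (1 + c) by move: E; lra.
  by rewrite -mulNr mulfK//; ring.
set a := - s / (1 + c) in E1 *.
have E2 : a * (1 + c) = - s by rewrite /a divfK.
congr (_, _).
  have -> : a * (s * (a * y + x) + y) + (a * y + x) = (s * a) * (a * y) + (s * a) * x + 2 * (a * y) + x by ring.
  rewrite E1; have -> : (c - 1) * (a * y) + (c - 1) * x + 2 * (a * y) + x = (a * (1 + c)) * y + c * x by ring.
  by rewrite E2; ring.
by have -> : s * (a * y + x) + y = (s * a) * y + s * x + y by [ring]; rewrite E1; ring.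
Qed.

Lemma measurable_rot l : measurable_fun setT (rot l).
Proof.
have m1 (c : R) : measurable_fun setT (fun u : RR * RR => c * u.1).
  by apply: measurable_funM; [exact: measurable_cst|exact: measurable_fst].
have m2 (c : R) : measurable_fun setT (fun u : RR * RR => c * u.2).
  by apply: measurable_funM; [exact: measurable_cst|exact: measurable_snd].
by apply: measurable_fun_pair; [apply: measurable_funB|apply: measurable_funD].
Qed.

Lemma integral_rot l (f : RR * RR -> \bar R) : modc l = 1 -> measurable_fun setT f ->
  (forall x, 0 <= f x)%E -> (\int[mu2]_u f (rot l u) = \int[mu2]_u f u)%E.
Proof.
move=> l1 mf f0.
have gen l' (h : RR * RR -> \bar R) : modc l' = 1 -> complex.Re l' != -1 -> measurable_fun setT h ->
    (forall x, 0 <= h x)%E -> (\int[mu2]_u h (rot l' u) = \int[mu2]_u h u)%E.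
  move=> l'1 lN mh h0; set a := - complex.Im l' / (1 + complex.Re l').
  under eq_integral => u _ do rewrite (rot_shear u l'1 lN) -/a.
  have m1 : measurable_fun setT (h \o shear1 a) by exact: measurableT_comp mh (measurable_shear1 a).
  have m2 : measurable_fun setT ((h \o shear1 a) \o shear2 (complex.Im l')).
    exact: measurableT_comp m1 (measurable_shear2 _).
  rewrite (integral_shear1 a m2); last by move=> x; exact: h0.
  rewrite (integral_shear2 _ m1); last by move=> x; exact: h0.
  exact: integral_shear1.
(* The half turn is the square of the quarter turn, which has a shear factorization. *)
have [lN|lN] := eqVneq (complex.Re l) (-1); last exact: gen.
have i1 : modc ('i%C : C) = 1 by rewrite /modc /= expr0n expr1n add0r sqrtr1.
have iN : complex.Re ('i%C : C) != -1 by rewrite /= eq_sym oppr_eq0 oner_eq0.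
have l0 : complex.Im l = 0.
  have : complex.Re l ^+ 2 + complex.Im l ^+ 2 = 1 by rewrite -modc_sqr l1 expr1n.
  by rewrite lN sqrrN expr1n => /eqP; rewrite addrC -subr_eq0 addrK sqrf_eq0 => /eqP.
have E u : rot l u = rot 'i%C (rot 'i%C u).
  by rewrite /rot lN l0 /=; congr (_, _); ring.
under eq_integral => u _ do rewrite E.
rewrite (gen 'i%C (fun u => f (rot 'i%C u)))//; last exact: measurableT_comp mf (measurable_rot _).
exact: gen.
Qed.

Section Caratheodory.
Context d (T : measurableType d).

(** [f] is the pointwise limit of the functions in which [t] is rounded down to a multiple of
    [1 / (n + 1)]; these are measurable as countable gluings of slices. *)
Lemma measurable_caratheodory (f : T -> R -> R) :
  (forall t, measurable_fun setT (f ^~ t)) -> (forall x, continuous (f x)) ->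
  measurable_fun [set: T * RR] (fun u => f u.1 u.2).
Proof.
move=> mf cf.
pose q (n : nat) (t : R) : R := (Num.floor (n.+1%:R * t))%:~R / n.+1%:R.
apply: (@measurable_fun_cvg _ _ _ _ (fun n u => f u.1 (q n u.2))).
  move=> n _ A mA; rewrite setTI.
  rewrite [X in measurable X](_ : _ = \bigcup_(k : int)
     ((f ^~ (k%:~R / n.+1%:R) @^-1` A) `*` [set t : RR | Num.floor (n.+1%:R * t) = k])); last first.
    apply/seteqP; split=> [[x t] /= H|[x t] [k _ [/= H tk]]]; last by rewrite /q tk.
    by exists (Num.floor (n.+1%:R * t)).
  apply: countable_bigcupT_measurable; first exact: countableP.
  move=> k; apply: measurableX; first by rewrite -[X in measurable X]setTI; exact: mf.
  rewrite [X in measurable X](_ : _ = `[k%:~R / n.+1%:R, (k + 1)%:~R / n.+1%:R[%classic); first exact: measurable_itv.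
  apply/seteqP; split=> t /=; rewrite in_itv/= ler_pdivrMr// ltr_pdivlMr// [t * _]mulrC.
    by move=> <-; rewrite floor_le_tmp ?floorD1_gt.
  by move=> /floor_def.
move=> [x t] _ /=.
have qt : q ^~ t @ \oo --> t.
  apply/cvgrPdist_le => e e0; near=> n.
  have n0 : 0 < n.+1%:R :> R by [].
  have /andP[a b] := real_floor_itv (num_real (n.+1%:R * t)).
  have -> : t - q n t = (n.+1%:R * t - (Num.floor (n.+1%:R * t))%:~R) / n.+1%:R.
    by rewrite /q mulrBl [n.+1%:R * t]mulrC mulfK// gt_eqF.
  rewrite normrM [`|_^-1|]ger0_norm ?invr_ge0// ler_pdivrMr//.
  rewrite ger0_norm ?subr_ge0//.
  apply: (@le_trans _ _ 1); first by rewrite lerBlDl -[1]/(1%:~R) -intrD ltW.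
  have ne : n.+1%:R^-1 < e by near: n; exact: (near_infty_natSinv_lt (PosNum e0)).
  by rewrite -ler_pdivrMr// div1r ltW.
exact: (cvg_comp _ _ qt (cf x t)).
Unshelve. all: by end_near.
Qed.

End Caratheodory.

End PlaneMeasure.

(** * Tonelli's theorem when one factor is itself a product *)

Section TonelliProduct.
Context d1 d2 d3 (T1 : measurableType d1) (T2 : measurableType d2) (T3 : measurableType d3) (R : realType)
  (m1 : {sigma_finite_measure set T1 -> \bar R}) (m2 : {sigma_finite_measure set T2 -> \bar R})
  (m3 : {sigma_finite_measure set T3 -> \bar R}).

(** The product measure must be equipped with sigma-finiteness before it can serve as a factor in
    Tonelli's theorem. *)
Lemma sigma_finite_product : sigma_finite setT (m1 \x m2)%E.
Proof.
have /sigma_finiteP[F [TF ndF Foo]] := sigma_finiteT m1.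
have /sigma_finiteP[G [TG ndG Goo]] := sigma_finiteT m2.
exists (fun n => F n `*` G n) => [|n].
  apply/esym/seteqP; split => // -[x y] _.
  have [i _ Fx] : (\bigcup_i F i) x by rewrite -TF.
  have [j _ Gy] : (\bigcup_j G j) y by rewrite -TG.
  by exists (maxn i j) => //; split; [apply: (subsetPset _ _ (ndF _ _ (leq_maxl _ _)))|apply: (subsetPset _ _ (ndG _ _ (leq_maxr _ _)))].
have [mF Fn] := Foo n; have [mG Gn] := Goo n; split; first exact: measurableX.
by rewrite product_measure1E// lte_mul_pinfty// ge0_fin_numE.
Qed.

Let m12 := HB.pack_for {sigma_finite_measure set (T1 * T2)%type -> \bar R} (m1 \x m2)%E
  (Measure_isSigmaFinite.Build _ _ _ (m1 \x m2)%E sigma_finite_product).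

Lemma measurable_tonelli_product (F : (T1 * T2) * T3 -> \bar R) : measurable_fun setT F ->
  (forall v, 0 <= F v)%E -> measurable_fun setT (fun t => \int[m1 \x m2]_u F (u, t))%E.
Proof. by move=> mF F0; exact: (@measurable_fun_fubini_tonelli_G _ _ _ _ _ m12 F mF F0). Qed.

Lemma tonelli_product (F : (T1 * T2) * T3 -> \bar R) : measurable_fun setT F ->
  (forall v, 0 <= F v)%E ->
  (\int[m1 \x m2]_u \int[m3]_t F (u, t) = \int[m3]_t \int[m1 \x m2]_u F (u, t))%E.
Proof.
move=> mF F0.
exact: (@fubini_tonelli _ _ _ _ _ m12 m3 F mF F0).
Qed.
End TonelliProduct.

(** * Weighted integrals over the disc and their expression by circle means *)

Section DiscIntegral.
Context {R : realType}.
Local Notation C := R[i].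
Local Notation mu := (@lebesgue_measure R).
Local Notation RR := (measurableTypeR R).
Local Notation mu2 := (mu \x mu)%E.
Implicit Types (f g h : C -> C) (s p : R) (z : C).

Lemma modc_cont_dist (z w : C) : `|modc w - modc z| <= modc (w - z).
Proof.
rewrite ler_norml; apply/andP; split.
  by have := modcBB z w; rewrite modc_dist; lra.
by have := modcBB w z; lra.
Qed.

Lemma ccont_modc z : ccont (fun z => (modc z)%:C) z.
Proof.
move=> e e0; exists e => // w wz; rewrite -rmorphB modc_real.
by apply: le_trans (modc_cont_dist z w) _; exact: ltW.
Qed.

(* The homeomorphism [z / (1 + |z|)] of the plane onto the disc reduces the
   measurability of functions continuous on the disc to that of functions
   continuous on the whole plane. *)
Definition squeeze z : C := z * (1 + (modc z)%:C)^-1.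
Definition unsqueeze (u : RR * RR) : RR * RR :=
  (u.1 * (1 - modc (to_c u))^-1, u.2 * (1 - modc (to_c u))^-1).

Lemma one_modc z : 1 + (modc z)%:C = (1 + modc z)%:C.
Proof. by rewrite rmorphD. Qed.

Lemma ccont_squeeze z : ccont squeeze z.
Proof.
apply: ccontM; first exact: ccont_id.
apply: (@ccont_comp _ (fun z => z^-1) (fun z => 1 + (modc z)%:C)).
  apply: cder_cont; apply: cderV.
  rewrite one_modc -modc_eq0 modc_real.
  by have := modc_ge0 z; move=> m0; rewrite gt_eqF// normr_gt0 gt_eqF//; lra.
by apply: ccontD; [exact: ccont_cst|exact: ccont_modc].
Qed.

Lemma modc_squeeze z : modc (squeeze z) < 1.
Proof.
have m0 := modc_ge0 z; rewrite /squeeze modcM one_modc modcV modc_real ger0_norm; last lra.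
by rewrite ltr_pdivrMr; lra.
Qed.

Lemma to_c_unsqueeze u : to_c (unsqueeze u) = ((1 - modc (to_c u))^-1)%:C * to_c u.
Proof. by rewrite /unsqueeze /to_c /=; apply/eqP; rewrite eq_complex /= mul0r subr0 mul0r addr0 ![_^-1 * _]mulrC !eqxx. Qed.

Lemma squeezeK u : modc (to_c u) < 1 -> squeeze (to_c (unsqueeze u)) = to_c u.
Proof.
move=> u1; have m0 := modc_ge0 (to_c u).
have d0 : 0 < 1 - modc (to_c u) by lra.
rewrite to_c_unsqueeze /squeeze one_modc modcM modc_real ger0_norm ?invr_ge0 ?(ltW d0)//.
have -> : 1 + (1 - modc (to_c u))^-1 * modc (to_c u) = (1 - modc (to_c u))^-1.
  by field; rewrite gt_eqF.
rewrite mulrAC mulfV ?mul1r// -modc_eq0 modc_real ger0_norm ?invr_ge0 ?(ltW d0)//.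
by rewrite invr_eq0 gt_eqF.
Qed.

Lemma measurable_modc_comp h : (forall z, ccont h z) ->
  measurable_fun setT (fun u : RR * RR => modc (h (to_c u))).
Proof.
move=> ch.
have cx (y x : R) : rcont (fun x => x +i* y) x.
  move=> e e0; exists e => // t tx.
  apply: le_trans (modc_le_ReIm _) _; rewrite ReD ReN ImD ImN /= subrr normr0 addr0.
  exact: ltW.
have cy (y x : R) : rcont (fun y => x +i* y) y.
  move=> e e0; exists e => // t tx.
  apply: le_trans (modc_le_ReIm _) _; rewrite ReD ReN ImD ImN /= subrr normr0 add0r.
  exact: ltW.
apply: (@measurable_caratheodory R _ RR (fun x y => modc (h (to_c (x, y))))) => [y|x].
  apply: continuous_measurable_fun => x; apply: (@cont_modc R (fun x => h (to_c (x, y)))).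
  by apply: (@rcont_comp _ h (fun x => x +i* y)); [exact: ch|exact: cx].
move=> y; apply: (@cont_modc R (fun y => h (to_c (x, y)))).
by apply: (@rcont_comp _ h (fun y => x +i* y)); [exact: ch|exact: cy].
Qed.

Lemma measurable_modc : measurable_fun setT (fun u : RR * RR => modc (to_c u)).
Proof. by apply: (@measurable_modc_comp id) => z; exact: ccont_id. Qed.

Lemma measurable_invr : measurable_fun setT (GRing.inv : RR -> RR).
Proof.
have mE : measurable [set x : RR | (x == 0 :> R)].
  rewrite (_ : [set _ | _] = [set 0 : R]); first exact: measurable_set1.
  by apply/seteqP; split=> x /= /eqP.
have -> : (GRing.inv : R -> R) = (GRing.inv : R -> R) \_ [set x | x != 0].
  apply/funext => x; rewrite patchE; case: ifPn => //; rewrite notin_setE /=.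
  by move=> /negP; rewrite negbK => /eqP ->; rewrite invr0.
apply/(measurable_restrictT _ _).1.
  by rewrite (_ : [set x | _] = ~` [set x : RR | (x == 0 :> R)]); [exact: measurableC|apply/seteqP; split => x /= /negP].
apply: open_continuous_measurable_fun; last first.
  by move=> x; rewrite inE/= => x0; exact: inv_continuous.
rewrite (_ : [set x | _] = ~` [set 0 : R]); first by rewrite openC; exact: closed_eq.
by apply/seteqP; split => x /=; move/eqP.
Qed.

Lemma measurable_unsqueeze : measurable_fun setT unsqueeze.
Proof.
have mi : measurable_fun setT (fun u : RR * RR => (1 - modc (to_c u))^-1).
  apply: (measurableT_comp measurable_invr).
  by apply: measurable_funB; [exact: measurable_cst|exact: measurable_modc].
apply: measurable_fun_pair; apply: measurable_funM.
- exact: measurable_fst.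
- exact: mi.
- exact: measurable_snd.
- exact: mi.
Qed.

Section Weight.
Variables (p : R) (w : R -> R).
Hypotheses (p0 : 0 < p) (w0 : forall r, 0 <= r < 1 -> 0 <= w r)
  (mw : measurable_fun (`[0, 1[%classic : set RR) (w : RR -> RR)).

Definition inring s (u : R * R) := (s <= modc (to_c u)) && (modc (to_c u) < 1).

(* [NI p w s f] below is [pi] times the integral of [|f|^p] against the weight over
   [s <= |z| < 1]. *)
Definition Fint s f (u : R * R) : R :=
  if inring s u then modc (f (to_c u)) `^ p * w (modc (to_c u)) else 0.

Lemma Fint_ge0 s f u : 0 <= Fint s f u.
Proof.
rewrite /Fint /inring; case: ifP => // /andP[_ u1].
by rewrite mulr_ge0 ?powR_ge0// w0// modc_ge0.
Qed.

Lemma measurable_Fint s f : ccontD1 f -> measurable_fun setT (Fint s f : RR * RR -> RR).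
Proof.
move=> cf.
(* Nothing is known of [f] and [w] outside the disc; the indicator, [squeeze] and the restriction of
   [w] replace them by functions measurable on the whole plane. *)
have -> : Fint s f = fun u => \1_(`[s, 1[) (modc (to_c u)) *
    (modc ((f \o squeeze) (to_c (unsqueeze u))) `^ p * (w \_ `[0, 1[) (modc (to_c u))).
  apply/funext => u; rewrite /Fint /inring indicE mem_setE in_itv/=; case: ifP => su; last by rewrite mul0r.
  have /andP[_ u1] := su; rewrite mul1r squeezeK// patchE mem_setE in_itv/= modc_ge0 u1/=.
  by [].
have mm := measurable_modc.
apply: measurable_funM; first exact: measurableT_comp (measurable_indic _) mm.
apply: measurable_funM.
  apply: (measurableT_comp (measurable_powR p)).
  have mh : measurable_fun setT (fun u : RR * RR => modc ((f \o squeeze) (to_c u))); last first.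
    exact: measurableT_comp mh measurable_unsqueeze.
  apply: measurable_modc_comp => z; apply: ccont_comp; last exact: ccont_squeeze.
  by apply: cf; exact: modc_squeeze.
apply: measurableT_comp mm.
by apply/(measurable_restrictT _ _).1.
Qed.

(** Caratheodory's criterion, with the point of the plane as measurable variable and [t] as
    continuous one. *)
Lemma measurable_Fint_family s (Phi : R -> C -> C) : (forall t, ccontD1 (Phi t)) ->
  (forall z, modc z < 1 -> forall t, rcont (Phi ^~ z) t) ->
  measurable_fun setT (fun v : (RR * RR) * RR => Fint s (Phi v.2) v.1 : RR).
Proof.
move=> cP cPt.
apply: (@measurable_caratheodory R _ (RR * RR)%type (fun u t => Fint s (Phi t) u)) => [t|u].
  exact: measurable_Fint.
have [su|su] := boolP (inring s u); last first.
  have -> : (fun t => Fint s (Phi t) u) = fun=> 0 by apply/funext => t; rewrite /Fint (negbTE su).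
  by move=> t; exact: cvg_cst.
have -> : (fun t => Fint s (Phi t) u) = fun t => modc (Phi t (to_c u)) `^ p * w (modc (to_c u)).
  by apply/funext => t; rewrite /Fint su.
have /andP[_ u1] := su; move=> t.
have ct : {for t, continuous (fun t => modc (Phi t (to_c u)) `^ p)}.
  by apply: cont_powR => // [v|]; [exact: modc_ge0|exact: cont_modc (cPt _ u1 t)].
by apply: cvgM; [exact: ct|exact: cvg_cst].
Qed.

Fact NI_key : {n : R -> (C -> C) -> \bar R | n = fun s f => (\int[mu2]_u (Fint s f u)%:E)%E}.
Proof. by eexists. Qed.
Definition NI := sval NI_key.
Lemma NIE s f : NI s f = (\int[mu2]_u (Fint s f u)%:E)%E.
Proof. by rewrite /NI (svalP NI_key). Qed.

Lemma NI_ge0 s f : (0 <= NI s f)%E.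
Proof. by rewrite NIE; apply: integral_ge0 => u _; rewrite lee_fin Fint_ge0. Qed.

Definition Mint s (Phi : R -> C -> C) (u : R * R) : R :=
  if inring s u then Rintegral mu `[0, 1] (fun t => modc (Phi t (to_c u)) `^ p) * w (modc (to_c u)) else 0.

Section Family.
Variables (s : R) (Phi : R -> C -> C).
Hypotheses (cP : forall t, ccontD1 (Phi t))
  (cPt : forall z, modc z < 1 -> forall t, rcont (Phi ^~ z) t).

(** The indicator of [[0, 1]] turns the average in [t] into an integral over the line, as Tonelli's
    theorem is applied on full spaces. *)
Let F (v : (RR * RR) * RR) : \bar R := (Fint s (Phi v.2) v.1 * \1_(`[0, 1]) v.2)%:E.

Let mF : measurable_fun setT F.
Proof.
apply/measurable_EFinP; apply: measurable_funM; first exact: measurable_Fint_family.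
exact: measurableT_comp (measurable_indic _) measurable_snd.
Qed.

Let F0 v : (0 <= F v)%E.
Proof. by rewrite lee_fin mulr_ge0// Fint_ge0. Qed.

Let FM u : fubini_F mu F u = (Mint s Phi u)%:E.
Proof.
rewrite /fubini_F /F /=.
transitivity (\int[mu]_(t in `[0%R, 1%R]) (Fint s (Phi t) u)%:E)%E.
  rewrite [RHS]integral_mkcond; apply: eq_integral => t _.
  by rewrite patchE indicE; case: ifPn; rewrite ?mulr1 ?mulr0.
rewrite /Fint /Mint; case: ifP => [/andP[_ u1]|_]; last first.
  by rewrite integral_cst//= mul0e.
have cf t : {for t, continuous (fun t => modc (Phi t (to_c u)) `^ p)}.
  by apply: cont_powR => // [v|]; [exact: modc_ge0|exact: cont_modc (cPt u1 t)].
have I := integrable01 (fun t _ => cf t).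
under eq_integral do rewrite EFinM.
rewrite integralZr// EFinM; congr (_ * _)%E.
by rewrite /Rintegral fineK//; exact: integrable_fin_num.
Qed.

Lemma measurable_Mint : measurable_fun setT (EFin \o Mint s Phi : RR * RR -> \bar R).
Proof.
have := @measurable_fun_fubini_tonelli_F _ _ _ _ R mu F mF F0.
have E : fubini_F mu F = EFin \o Mint s Phi by apply/funext => u; rewrite FM.
by rewrite E.
Qed.

Lemma NI_mean : (\int[mu]_(t in `[0%R, 1%R]) NI s (Phi t) = \int[mu2]_u (Mint s Phi u)%:E)%E.
Proof.
under [RHS]eq_integral => u _ do rewrite -FM.
transitivity (\int[mu]_y \int[mu2]_x F (x, y))%E; last first.
  by apply/esym; exact: (@tonelli_product _ _ _ RR RR RR R mu mu mu F mF F0).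
rewrite integral_mkcond; apply: eq_integral => t _.
rewrite patchE /F /= indicE; case: ifPn => _.
  by rewrite NIE; apply: eq_integral => u _; rewrite mulr1.
by under eq_integral => u _ do rewrite mulr0; rewrite integral0.
Qed.

Lemma measurable_NI_family : measurable_fun setT (fun t : RR => NI s (Phi t)).
Proof.
have mG : measurable_fun setT (fun v : (RR * RR) * RR => (Fint s (Phi v.2) v.1)%:E).
  by apply/measurable_EFinP; exact: measurable_Fint_family.
have G0 (v : (RR * RR) * RR) : (0 <= (Fint s (Phi v.2) v.1)%:E)%E by rewrite lee_fin Fint_ge0.
have := @measurable_tonelli_product _ _ _ RR RR RR R mu mu _ mG G0.
by under [X in _ -> measurable_fun _ X]eq_fun do rewrite NIE.
Qed.

Lemma Mint_ge0 u : 0 <= Mint s Phi u.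
Proof.
rewrite /Mint; case: ifP => // /andP[_ u1]; rewrite mulr_ge0//.
  by apply: Rintegral01_ge0 => t _; exact: powR_ge0.
by rewrite w0// modc_ge0.
Qed.

End Family.

Lemma NI_dil_rot s f l : modc l = 1 -> ccontD1 f -> NI s (dil l f) = NI s f.
Proof.
move=> l1 cf; rewrite !NIE -(@integral_rot R l (fun u => (Fint s f u)%:E))//.
- by apply: eq_integral => u _; rewrite /Fint /inring to_c_rot modcM l1 mul1r.
- by apply/measurable_EFinP; exact: measurable_Fint.
- by move=> u; rewrite lee_fin Fint_ge0.
Qed.

Lemma ccont_dil (l : C) f : modc l <= 1 -> ccontD1 f -> ccontD1 (dil l f).
Proof.
move=> l1 cf z z1; apply: (@ccont_comp _ f (fun z => l * z)).
  by apply: cf; exact: modc_scale.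
by apply: ccontM; [exact: ccont_cst|exact: ccont_id].
Qed.

Definition mpint s f (u : R * R) : R :=
  if inring s u then mp p f (to_c u) * w (modc (to_c u)) else 0.

Lemma mpint_Mint s f : mpint s f = Mint s (fun t => dil (expi t) f).
Proof.
apply/funext => u; have E : mp p f (to_c u) = Rintegral mu `[0, 1] (fun t => modc (dil (expi t) f (to_c u)) `^ p).
  by rewrite mpE; apply: eq_Rintegral01 => t _; rewrite /dil [expi t * _]mulrC.
by rewrite /mpint /Mint E.
Qed.

Section Rotations.
Variables (s : R) (f : C -> C).
Hypothesis cf : ccontD1 f.

Let cP t : ccontD1 (dil (expi t) f).
Proof. by apply: ccont_dil => //; rewrite modc_expi. Qed.

Let cPt z : modc z < 1 -> forall t, rcont (fun t => dil (expi t) f z) t.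
Proof.
move=> z1 t; have -> : (fun t => dil (expi t) f z) = (fun t => f (z * expi t)).
  by apply/funext => v; rewrite /dil mulrC.
exact: circle_cont.
Qed.

Lemma measurable_mpint : measurable_fun setT (EFin \o mpint s f : RR * RR -> \bar R).
Proof. by rewrite mpint_Mint; exact: measurable_Mint. Qed.

Lemma mpint_ge0 u : 0 <= mpint s f u.
Proof. by rewrite mpint_Mint; exact: Mint_ge0. Qed.

(** By rotation invariance [NI s f] is the average of its values at the rotations of [f], and
    Tonelli's theorem turns this average into circle means. This stands in for polar coordinates and
    exploits that the weight is radial. *)
Lemma NI_mp : NI s f = (\int[mu2]_u (mpint s f u)%:E)%E.
Proof.
rewrite mpint_Mint -NI_mean//.
under eq_integral => t _ do rewrite (NI_dil_rot s (modc_expi t) cf).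
by rewrite integral_cst//= lebesgue_measure_itv/= lte_fin ltr01 oppr0 adde0 mule1.
Qed.

End Rotations.

(** Estimates between circle means integrate to estimates between norms; two terms on the right
    accommodate sums and the use of different bounds on different annuli. *)
Lemma NI_le s f h k (a b : R) : ccontD1 f -> ccontD1 h -> ccontD1 k -> 0 <= a -> 0 <= b ->
  (forall z, s <= modc z -> modc z < 1 -> mp p f z <= a * mp p h z + b * mp p k z) ->
  (NI s f <= a%:E * NI s h + b%:E * NI s k)%E.
Proof.
move=> cf ch ck a0 b0 H; rewrite !NI_mp//.
have mh := measurable_mpint s ch; have mk := measurable_mpint s ck.
rewrite -ge0_integralZl//; last by move=> u _; rewrite lee_fin mpint_ge0.
rewrite -[X in (_ <= _ + X)%E]ge0_integralZl//; last by move=> u _; rewrite lee_fin mpint_ge0.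
rewrite -ge0_integralD//; last 4 first.
- by move=> u _; rewrite -EFinM lee_fin mulr_ge0// mpint_ge0.
- exact: emeasurable_funM.
- by move=> u _; rewrite -EFinM lee_fin mulr_ge0// mpint_ge0.
- exact: emeasurable_funM.
apply: ge0_le_integral => //.
- by move=> u _; rewrite lee_fin mpint_ge0.
- exact: measurable_mpint.
- by apply: emeasurable_funD; exact: emeasurable_funM.
move=> u _; rewrite -!EFinM -EFinD lee_fin /mpint; case: ifP => [/andP[su u1]|_]; last by rewrite !mulr0 addr0.
rewrite !mulrA -mulrDl; apply: ler_wpM2r; last exact: H.
by rewrite w0// modc_ge0.
Qed.

End Weight.

End DiscIntegral.

(** * Analytic families of operators *)

Section OperatorFamilies.
Context {R : realType}.
Local Notation C := R[i].
Implicit Types (f g h : C -> C) (z m : C) (p : R).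

Lemma TopE g f z : TT g f z = ci (fun t => f (t%:C * z) * der g (t%:C * z) * z).
Proof. by rewrite TTE derE ciE. Qed.

(** Analyticity in each variable with bounds on closed bidiscs is what [holo_cint01] asks for, and
    it is preserved by every operator involved. *)
Record separately_analytic (Phi : C -> C -> C) : Prop := SeparatelyAnalytic {
  sep_l : forall z, modc z < 1 -> analytic (Phi ^~ z);
  sep_r : forall m, modc m < 1 -> analytic (Phi m);
  sep_bnd : forall r : R, r < 1 -> exists2 B : R, 0 <= B &
    forall m z, modc m <= r -> modc z <= r -> modc (Phi m z) <= B }.

Lemma sep_cst f : analytic f -> separately_analytic (fun _ => f).
Proof.
move=> hf; split=> [z _|m _|r r1]; [exact: holo_cst|exact: hf|].
have [B B0 BH] := ccont_bounded (fun z zr => holo_ccont hf (le_lt_trans zr r1)).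
by exists B => // m z _; exact: BH.
Qed.

Lemma sep_dil g : analytic g -> separately_analytic (fun m => dil m g).
Proof.
move=> hg; split=> [z z1|m m1|r r1].
- have -> : (fun m => dil m g z) = dil z g by apply/funext => m; rewrite /dil mulrC.
  exact: holo_dil (ltW z1) hg.
- exact: holo_dil (ltW m1) hg.
have [B B0 BH] := ccont_bounded (fun z zr => holo_ccont hg (le_lt_trans zr r1)).
exists B => // m z mr zr; apply: BH; rewrite modcM (le_trans _ zr)// ler_piMl ?modc_ge0//.
by rewrite (le_trans mr)// ltW.
Qed.

Lemma sepD Phi Psi : separately_analytic Phi -> separately_analytic Psi ->
  separately_analytic (fun m z => Phi m z + Psi m z).
Proof.
move=> [l r b] [l' r' b']; split=> [z z1|m m1|s s1].
- by apply: holoD; [exact: l|exact: l'].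
- by apply: holoD; [exact: r|exact: r'].
have [B B0 BH] := b s s1; have [B' B'0 BH'] := b' s s1.
exists (B + B'); first exact: addr_ge0.
by move=> m z mr zr; rewrite (le_trans (modcD _ _))// lerD// ?BH ?BH'.
Qed.

Lemma sepM Phi Psi : separately_analytic Phi -> separately_analytic Psi ->
  separately_analytic (fun m z => Phi m z * Psi m z).
Proof.
move=> [l r b] [l' r' b']; split=> [z z1|m m1|s s1].
- by apply: holoM; [exact: l|exact: l'].
- by apply: holoM; [exact: r|exact: r'].
have [B B0 BH] := b s s1; have [B' B'0 BH'] := b' s s1.
exists (B * B'); first exact: mulr_ge0.
by move=> m z mr zr; rewrite modcM ler_pM ?modc_ge0// ?BH ?BH'.
Qed.

Lemma sepZ (a : C) Phi : separately_analytic Phi -> separately_analytic (fun m z => a * Phi m z).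
Proof. by move=> hP; apply: (sepM (sep_cst (holo_cst a)) hP). Qed.

Lemma sep_eval0 Phi : separately_analytic Phi -> separately_analytic (fun m _ => Phi m 0).
Proof.
move=> [l r b]; split=> [z z1|m m1|s s1].
- by apply: l; rewrite modc0.
- exact: holo_cst.
have [s0|s0] := leP 0 s.
  have [B B0 BH] := b s s1; exists B => // m z mr zr; apply: BH => //; by rewrite modc0.
by exists 0 => // m z ms; have := le_trans (modc_ge0 m) ms; rewrite leNgt s0.
Qed.

Lemma sep_eqD Phi Psi : separately_analytic Phi ->
  (forall m z, modc m < 1 -> modc z < 1 -> Phi m z = Psi m z) -> separately_analytic Psi.
Proof.
move=> [l r b] E; split=> [z z1|m m1|s s1].
- by apply: (@holo_eqD _ (Phi ^~ z)); [move=> m m1; exact: E|exact: l].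
- by apply: (@holo_eqD _ (Phi m)); [move=> z z1; exact: E|exact: r].
have [B B0 BH] := b s s1; exists B => // m z mr zr; rewrite -E ?BH//.
  exact: le_lt_trans mr s1.
exact: le_lt_trans zr s1.
Qed.

(** Differentiating [dil m g] gives [m] times the dilated derivative of [g], so the integrand
    depends analytically on [m]. *)
Lemma sep_Top g Phi : analytic g -> separately_analytic Phi ->
  separately_analytic (fun m => TT (dil m g) (Phi m)).
Proof.
move=> hg hP; have [l r b] := hP.
have hdg := holo_cderiv hg.
have [dl dr db] := sep_dil hdg.
have E m z : modc m < 1 -> modc z < 1 ->
    TT (dil m g) (Phi m) z = ci (fun t => Phi m (t%:C * z) * (m * dil m (der g) (t%:C * z)) * z).
  move=> m1 z1; rewrite TopE; apply: eq_cint01 => t t01.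
  by rewrite cderiv_dil//; [exact: ltW|exact: modc_tz].
have cont m z : modc m < 1 -> modc z < 1 ->
    cont01 (fun t => Phi m (t%:C * z) * (m * dil m (der g) (t%:C * z)) * z).
  move=> m1 z1 t t01; have tz1 := modc_tz t01 z1.
  apply: rcontM; last exact: rcont_cst.
  apply: rcontM; last first.
    apply: rcontM; first exact: rcont_cst.
    apply: (@rcont_comp _ (dil m (der g)) (fun t => t%:C * z)); last exact: rcont_mulr.
    exact: holo_ccont (dr m m1) _ tz1.
  apply: (@rcont_comp _ (Phi m) (fun t => t%:C * z)); last exact: rcont_mulr.
  exact: holo_ccont (r m m1) _ tz1.
have tzr (t : R) z s : 0 <= t <= 1 -> modc z <= s -> modc (t%:C * z) <= s.
  move=> /andP[t0 t1] zs; rewrite modcM modc_real ger0_norm//.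
  by rewrite (le_trans _ zs)// ler_piMl ?modc_ge0.
have bnd s : s < 1 -> exists2 B : R, 0 <= B & forall m z (t : R), modc m <= s -> modc z <= s -> 0 <= t <= 1 ->
    modc (Phi m (t%:C * z) * (m * dil m (der g) (t%:C * z)) * z) <= B.
  move=> s1; have [B B0 BH] := b s s1; have [B' B'0 BH'] := db s s1.
  exists (B * (1 * B') * 1); first by rewrite !mulr_ge0.
  move=> m z t mr zr t01; have z1 := ltW (le_lt_trans zr s1); have m1 := ltW (le_lt_trans mr s1).
  have tz := tzr t z s t01 zr.
  rewrite [modc (_ * z)]modcM [modc (Phi _ _ * _)]modcM [modc (m * _)]modcM.
  apply: ler_pM => //; rewrite ?mulr_ge0 ?modc_ge0//.
  apply: ler_pM => //; rewrite ?mulr_ge0 ?modc_ge0//; first exact: BH.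
  by apply: ler_pM => //; rewrite ?modc_ge0//; exact: BH'.
split=> [z z1|m m1|s s1].
- apply: (@holo_eqD _ (fun m => ci (fun t => Phi m (t%:C * z) * (m * dil m (der g) (t%:C * z)) * z))).
    by move=> m m1; rewrite E.
  apply: (@holo_cint01 _ (fun m t => Phi m (t%:C * z) * (m * dil m (der g) (t%:C * z)) * z)).
  + move=> t t01; have tz1 := modc_tz t01 z1; apply: holoM; last exact: holo_cst.
    apply: holoM; first exact: l.
    by apply: holoM; [exact: holo_id|exact: dl].
  + by move=> m m1; exact: cont.
  + move=> s s1; pose s' := Num.max s (modc z).
    have s'1 : s' < 1 by rewrite /s' gt_max s1 z1.
    have [B B0 BH] := bnd s' s'1; exists B => m t ms t01; apply: BH => //.
      by rewrite /s' le_max ms.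
    by rewrite /s' le_max lexx orbT.
- apply: holo_Top; [exact: holo_dil (ltW m1) hg|exact: r].
have [B B0 BH] := bnd s s1; exists (2 * B); first by rewrite mulr_ge0.
move=> m z mr zr; have m1 := le_lt_trans mr s1; have z1 := le_lt_trans zr s1.
by rewrite E//; apply: cint01_bound; [exact: cont|move=> t t01; exact: BH].
Qed.

Lemma Top_dil (a : C) g f : modc a <= 1 -> analytic g -> analytic f ->
  eqD (TT (dil a g) (dil a f)) (dil a (TT g f)).
Proof.
move=> a1 hg hf; apply: eqD_sym; apply: Top_uniq; [exact: holo_dil|exact: holo_dil| |].
  by rewrite /dil mulr0 Top0.
move=> z z1; rewrite cderiv_dil//; have az1 := modc_scale a1 z1.
by apply: (cder_eq (cder_dil (cder_Top hg hf az1))); rewrite /dil; ring.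
Qed.

Lemma Sop_dil (a : C) g f : modc a <= 1 -> analytic g -> analytic f ->
  eqD (SS (dil a g) (dil a f)) (dil a (SS g f)).
Proof.
move=> a1 hg hf; apply: eqD_sym; apply: Sop_uniq; [exact: holo_dil|exact: holo_dil| |].
  by rewrite /dil mulr0 Sop0.
move=> z z1; rewrite cderiv_dil//; have az1 := modc_scale a1 z1.
by apply: (cder_eq (cder_dil (cder_Sop hg hf az1))); rewrite /dil; ring.
Qed.

(** Integration by parts avoids the [z]-derivative of the family [Phi]. *)
Lemma sep_Sop g Phi : analytic g -> separately_analytic Phi ->
  separately_analytic (fun m => SS (dil m g) (Phi m)).
Proof.
move=> hg hP; have hd := sep_dil hg; have hT := sep_Top hg hP.
apply: (sep_eqD (sepD (sepD (sepM hP hd) (sepZ (-1) (sepM (sep_eval0 hP) (sep_eval0 hd)))) (sepZ (-1) hT))).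
move=> m z m1 z1.
rewrite (Top_parts (holo_dil (ltW m1) hg) (sep_r hP m1) z1); ring.
Qed.

(** The properties of [gop] on which both implications rest. They are stable under composition and
    sums, so they need checking only on the building blocks. *)
Record admissible p (L : (C -> C) -> (C -> C) -> C -> C) : Prop := Admissible {
  adm_holo : forall g f, analytic g -> analytic f -> analytic (L g f);
  adm_congr : forall g f1 f2, analytic g -> analytic f1 -> eqD f1 f2 -> eqD (L g f1) (L g f2);
  adm_add : forall g f1 f2, analytic g -> analytic f1 -> analytic f2 ->
    eqD (L g (fun z => f1 z + f2 z)) (fun z => L g f1 z + L g f2 z);
  adm_scale : forall g f (a : C), analytic g -> analytic f ->
    eqD (L g (fun z => a * f z)) (fun z => a * L g f z);
  adm_dil : forall g f (a : C), modc a <= 1 -> analytic g -> analytic f ->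
    eqD (L (dil a g) (dil a f)) (dil a (L g f));
  adm_sep : forall g Phi, analytic g -> separately_analytic Phi ->
    separately_analytic (fun m => L (dil m g) (Phi m));
  adm_bnd : forall g (M : R), analytic g -> (forall w, modc w < 1 -> modc (g w) <= M) ->
    circle_bounded p (L g) }.

Lemma eqD_trans f g h : eqD f g -> eqD g h -> eqD f h.
Proof. by move=> fg gh z z1; rewrite fg// gh. Qed.

Lemma adm_Top p : 0 < p -> admissible p TT.
Proof.
move=> p0; split.
- exact: holo_Top.
- by move=> g f1 f2 _ _; exact: Top_congr.
- exact: TopD.
- exact: TopZ.
- by move=> g f a; exact: Top_dil.
- exact: sep_Top.
- by move=> g M; exact: circle_bounded_Top.
Qed.

Lemma adm_Sop p : 0 < p -> admissible p SS.
Proof.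
move=> p0; split.
- exact: holo_Sop.
- by move=> g f1 f2 _; exact: Sop_congr.
- exact: SopD.
- exact: SopZ.
- by move=> g f a; exact: Sop_dil.
- exact: sep_Sop.
- by move=> g M; exact: circle_bounded_Sop.
Qed.

Lemma adm_id p : admissible p (fun _ f => f).
Proof.
split=> //.
by move=> g M _ _; exact: circle_bounded_id.
Qed.

Lemma adm_comp p L1 L2 : admissible p L1 -> admissible p L2 ->
  admissible p (fun g f => L1 g (L2 g f)).
Proof.
move=> a b; split.
- by move=> g f hg hf; apply: (adm_holo a) => //; exact: (adm_holo b).
- move=> g f1 f2 hg hf E; apply: (adm_congr a) => //; first exact: (adm_holo b).
  exact: (adm_congr b).
- move=> g f1 f2 hg h1 h2; apply: eqD_trans (adm_add a hg (adm_holo b hg h1) (adm_holo b hg h2)).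
  by apply: (adm_congr a) => //; [apply: (adm_holo b) => //; exact: holoD|exact: (adm_add b)].
- move=> g f c hg hf; apply: eqD_trans (adm_scale a c hg (adm_holo b hg hf)).
  by apply: (adm_congr a) => //; [apply: (adm_holo b) => //; exact: holoZ|exact: (adm_scale b)].
- move=> g f c c1 hg hf; apply: eqD_trans (adm_dil a c1 hg (adm_holo b hg hf)).
  apply: (adm_congr a); [exact: holo_dil|apply: (adm_holo b); exact: holo_dil|exact: (adm_dil b)].
- by move=> g Phi hg hP; apply: (adm_sep a hg); exact: (adm_sep b).
- move=> g M hg gM; exact: (circle_bounded_comp (adm_bnd a hg gM) (adm_bnd b hg gM)).
Qed.

Lemma adm_sum2 p L1 L2 : 0 < p -> admissible p L1 -> admissible p L2 ->
  admissible p (fun g f z => L1 g f z + L2 g f z).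
Proof.
move=> p0 a b; split.
- by move=> g f hg hf; apply: holoD; [exact: (adm_holo a)|exact: (adm_holo b)].
- by move=> g f1 f2 hg hf E z z1; rewrite (adm_congr a hg hf E z1) (adm_congr b hg hf E z1).
- by move=> g f1 f2 hg h1 h2 z z1; rewrite (adm_add a hg h1 h2 z1) (adm_add b hg h1 h2 z1) addrACA.
- by move=> g f c hg hf z z1; rewrite (adm_scale a c hg hf z1) (adm_scale b c hg hf z1) mulrDr.
- by move=> g f c c1 hg hf z z1; rewrite (adm_dil a c1 hg hf z1) (adm_dil b c1 hg hf z1).
- by move=> g Phi hg hP; apply: sepD; [exact: (adm_sep a)|exact: (adm_sep b)].
- move=> g M hg gM; exact: (circle_bounded_add p0 (adm_bnd a hg gM) (adm_bnd b hg gM)).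
Qed.

Lemma adm_mulc p L (c : C) : 0 < p -> admissible p L -> admissible p (fun g f z => c * L g f z).
Proof.
move=> p0 a; split.
- by move=> g f hg hf; apply: holoZ; exact: (adm_holo a).
- by move=> g f1 f2 hg hf E z z1; rewrite (adm_congr a hg hf E z1).
- by move=> g f1 f2 hg h1 h2 z z1; rewrite (adm_add a hg h1 h2 z1) mulrDr.
- by move=> g f d hg hf z z1; rewrite (adm_scale a d hg hf z1) mulrCA.
- by move=> g f d d1 hg hf z z1; rewrite (adm_dil a d1 hg hf z1).
- by move=> g Phi hg hP; apply: sepZ; exact: (adm_sep a).
- move=> g M hg gM; exact: (circle_bounded_scale c p0 (adm_bnd a hg gM)).
Qed.

Lemma adm_eval0 p : 0 < p -> admissible p (fun _ f _ => f 0).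
Proof.
move=> p0; have d0 : modc (0 : C) < 1 by rewrite modc0.
split.
- by move=> g f _ _; exact: holo_cst.
- by move=> g f1 f2 _ _ E z _; exact: E.
- by [].
- by [].
- by move=> g f a _ _ _ z _; rewrite /dil mulr0.
- by move=> g Phi _; exact: sep_eval0.
- move=> g M _ _; have [c c0 H] := circle_bounded_eval (p := p) 1 p0; exists c => // f /H[h b].
  have E : (fun _ : C => 1 * f 0) = fun=> f 0 by apply/funext => z; rewrite mul1r.
  by rewrite -E.
Qed.

Lemma adm_iter p L n : admissible p L -> admissible p (fun g f => iter n (L g) f).
Proof.
move=> a; elim: n => [|n IH]; first exact: adm_id.
exact: (adm_comp a IH).
Qed.

Lemma adm_bigsum p n (L : 'I_n -> (C -> C) -> (C -> C) -> C -> C) : 0 < p ->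
  (forall i, admissible p (L i)) -> admissible p (fun g f z => \sum_(i < n) L i g f z).
Proof.
move=> p0; elim: n L => [|n IH] L a.
  have -> : (fun g f z => \sum_(i < 0) L i g f z) = (fun g f z => 0 * f 0).
    by apply/funext => g; apply/funext => f; apply/funext => z; rewrite big_ord0 mul0r.
  exact: (adm_mulc 0 p0 (adm_eval0 p0)).
have -> : (fun g f z => \sum_(i < n.+1) L i g f z) =
    (fun g f z => \sum_(i < n) L (widen_ord (leqnSn n) i) g f z + L ord_max g f z).
  by apply/funext => g; apply/funext => f; apply/funext => z; rewrite big_ord_recr.
by apply: adm_sum2 => //; apply: IH => i; exact: a.
Qed.

Lemma adm_polyop p (P : {poly C}) L : 0 < p -> admissible p L ->
  admissible p (fun g f => polyop P (L g) f).
Proof.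
move=> p0 a; apply: (adm_bigsum p0) => i; apply: adm_mulc => //; exact: adm_iter.
Qed.

Lemma adm_Mul p : 0 < p -> admissible p (fun g f z => f z * g z).
Proof.
move=> p0; split.
- by move=> g f hg hf; exact: holoM.
- by move=> g f1 f2 _ _ E z z1; rewrite E.
- by move=> g f1 f2 _ _ _ z _; rewrite mulrDl.
- by move=> g f a _ _ z _; rewrite mulrA.
- by [].
- by move=> g Phi hg hP; apply: sepM => //; exact: sep_dil.
- move=> g M hg gM; exists (M `^ p); first exact: powR_ge0.
  move=> f hf; split=> [|z z1]; first exact: holoM.
  by apply: mp_Mul => //; exact: holo_ccont.
Qed.

Lemma adm_Pi0 p : 0 < p -> admissible p (fun _ f => Pi0 f).
Proof.
move=> p0; have := adm_sum2 p0 (adm_id p) (adm_mulc (-1) p0 (adm_eval0 p0)).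
by congr admissible; apply/funext => g; apply/funext => f; apply/funext => z; rewrite mulN1r.
Qed.

(* Terms of the last summand of [gop], expanded in powers of [g - g(0)]. *)
Definition mon_eval0 (c : C -> C) j g f z : C := c (g 0) * ((g z - g 0) ^+ j * f 0).

(** [dil a g] and [g] agree at [0], so the coefficient [c (g 0)] is not affected by dilations. *)
Lemma adm_mon_eval0 p c j : 0 < p -> admissible p (mon_eval0 c j).
Proof.
move=> p0; have d0 : modc (0 : C) < 1 by rewrite modc0.
have a : admissible p (fun g f z => (g z - g 0) ^+ j * f 0).
  (* Multiplication by [g - g 0]; the monomial is its [j]-th iterate applied to the constant
     [f 0]. *)
  have am : admissible p (fun g f z => f z * g z + (-1) * (f z * g 0)).
    split.
    - by move=> g f hg hf; apply: holoD; [exact: holoM|apply: holoZ; apply: holoM => //; exact: holo_cst].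
    - by move=> g f1 f2 _ _ E z z1; rewrite E.
    - by move=> g f1 f2 _ _ _ z _; ring.
    - by move=> g f a _ _ z _; ring.
    - by move=> g f a _ _ _ z _; rewrite /dil mulr0.
    - move=> g Phi hg hP; have hd := sep_dil hg.
      by apply: sepD; [exact: sepM|apply: sepZ; apply: sepM => //; exact: sep_eval0 hd].
    - move=> g M hg gM.
      have b1 := adm_bnd (adm_Mul p0) hg gM.
      have b2 := circle_bounded_scale (- g 0) p0 (circle_bounded_id p).
      have [k k0 H] := circle_bounded_add p0 b1 b2; exists k => // f /H[].
      have -> : (fun z => f z * g z + - g 0 * id f z) = (fun z => f z * g z + -1 * (f z * g 0)).
        by apply/funext => z /=; ring.
      by split.
  have := adm_comp (adm_iter j am) (adm_eval0 p0).
  congr admissible; apply/funext => g; apply/funext => f; apply/funext => z.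
  elim: j => [|j IH]; first by rewrite expr0 mul1r.
  by rewrite iterS IH exprS; ring.
have d g : eqD g g by [].
split.
- by move=> g f hg hf; apply: holoZ; exact: (adm_holo a).
- by move=> g f1 f2 hg hf E z z1; rewrite /mon_eval0 (adm_congr a hg hf E z1).
- by move=> g f1 f2 hg h1 h2 z z1; rewrite /mon_eval0; ring.
- by move=> g f k hg hf z z1; rewrite /mon_eval0; ring.
- by move=> g f k k1 hg hf z z1; rewrite /mon_eval0 /dil !mulr0.
- move=> g Phi hg hP; have := sepZ (c (g 0)) (adm_sep a hg hP).
  by congr separately_analytic; apply/funext => m; apply/funext => z; rewrite /mon_eval0 /dil mulr0.
- move=> g M hg gM; exact: (circle_bounded_scale (c (g 0)) p0 (adm_bnd a hg gM)).
Qed.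

(** An opaque copy of [gop], with the symbol after the polynomials so that [LL N P Q] has the type
    expected by [admissible]. *)
Fact LL_key : {L : nat -> (nat -> {poly C}) -> {poly {poly C}} -> (C -> C) -> (C -> C) -> C -> C |
  L = fun N P Q g f => @gop R g N P Q f}.
Proof. by eexists. Qed.
Definition LL := sval LL_key.
Lemma LLE N P Q g f : LL N P Q g f = gop g N P Q f.
Proof. by rewrite /LL (svalP LL_key). Qed.

Lemma LL_SS N P Q g f z : LL N P Q g f z =
  \sum_(k < N.+1) iter k (SS g) (TT g (polyop (P k) (TT g) (Pi0 f))) z
  + SS g (polyop (P N.+1) (SS g) f) z + \sum_(j < size Q) mon_eval0 (fun x => (Q`_j).[x]) j g f z.
Proof.
rewrite LLE /gop SSE TTE /eval2 big_distrl/=; congr (_ + _).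
by apply: eq_bigr => j _; rewrite /mon_eval0 mulrA.
Qed.

Lemma adm_LL p N P Q : 0 < p -> admissible p (LL N P Q).
Proof.
move=> p0.
have -> : LL N P Q = fun g f z => \sum_(k < N.+1) iter k (SS g) (TT g (polyop (P k) (TT g) (Pi0 f))) z
  + SS g (polyop (P N.+1) (SS g) f) z + \sum_(j < size Q) mon_eval0 (fun x => (Q`_j).[x]) j g f z.
  by apply/funext => g; apply/funext => f; apply/funext => z; exact: LL_SS.
have aT := adm_Top p0; have aS := adm_Sop p0.
apply: adm_sum2 => //; last by apply: adm_bigsum => // j; exact: adm_mon_eval0.
apply: adm_sum2 => //; last exact: (adm_comp aS (adm_polyop (P N.+1) p0 aS)).
apply: adm_bigsum => // k.
exact: (adm_comp (adm_iter k aS) (adm_comp aT (adm_comp (adm_polyop (P k) p0 aT) (adm_Pi0 p0)))).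
Qed.

End OperatorFamilies.

(** * Transfer of bounds to dilations of the symbol *)

Section WeightedNorm.
Context {R : realType}.
Local Notation C := R[i].
Local Notation mu := (@lebesgue_measure R).
Local Notation RR := (measurableTypeR R).
Local Notation mu2 := (mu \x mu)%E.
Variables (p : R) (w : R -> R).
Hypotheses (p0 : 0 < p) (w0 : forall r, 0 <= r < 1 -> 0 <= w r)
  (mw : measurable_fun (`[0, 1[%classic : set RR) (w : RR -> RR)).
Implicit Types (f g h : C -> C) (s : R) (z a : C).
Local Notation NI := (NI p w).
Local Notation Fint := (Fint p w).

Lemma NI_eqD s f h : eqD f h -> NI s f = NI s h.
Proof.
move=> E; rewrite !NIE; apply: eq_integral => u _; congr (_%:E).
by rewrite /Fint; case: ifP => // /andP[_ u1]; rewrite E.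
Qed.

Lemma NI_dil_le s f a : modc a <= 1 -> analytic f -> (NI s (dil a f) <= NI s f)%E.
Proof.
move=> a1 hf; have hd := holo_dil a1 hf.
have := @NI_le _ p w p0 w0 mw s (dil a f) f f 1 0 (holo_ccont hd) (holo_ccont hf) (holo_ccont hf) ler01 (lexx 0).
rewrite mul1e mul0e adde0; apply => z _ z1; rewrite mul1r mul0r addr0.
have -> : mp p (dil a f) z = mp p f (a * z).
  by rewrite !mpE; apply: eq_Rintegral01 => t _; rewrite /dil mulrA.
by apply: mp_mono_le => //; rewrite modcM ler_piMl ?modc_ge0.
Qed.

Lemma NI_scale s f a : ccontD1 f -> (NI s (fun z => a * f z)%R = (modc a `^ p)%:E * NI s f)%E.
Proof.
move=> cf; rewrite !NIE -ge0_integralZl//.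
- apply: eq_integral => u _; rewrite -EFinM; congr (_%:E); rewrite /Fint.
  case: ifP => _; last by rewrite mulr0.
  by rewrite modcM powRM ?modc_ge0// mulrA.
- by apply/measurable_EFinP; exact: measurable_Fint.
- by move=> u _; rewrite lee_fin Fint_ge0.
- by rewrite lee_fin powR_ge0.
Qed.

Lemma NI_sum2 s f h : analytic f -> analytic h ->
  (NI s (fun z => (f z + h z)%R) <= (2 `^ p)%:E * NI s f + (2 `^ p)%:E * NI s h)%E.
Proof.
move=> hf hh; apply: NI_le => //; try exact: holo_ccont; try exact: powR_ge0.
  exact/holo_ccont/holoD.
by move=> z _ z1; rewrite -mulrDr; exact: mp_sum2.
Qed.

Lemma NI_circle_bounded L : circle_bounded p L ->
  exists2 c : R, 0 <= c & forall s f, analytic f -> (NI s (L f) <= c%:E * NI s f)%E.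
Proof.
move=> [c c0 H]; exists c => // s f hf; have [hL b] := H f hf.
have := @NI_le _ p w p0 w0 mw s (L f) f f c 0 (holo_ccont hL) (holo_ccont hf) (holo_ccont hf) c0 (lexx 0).
rewrite mul0e adde0; apply => z _ z1; rewrite mul0r addr0; exact: b.
Qed.

Lemma NI_ring_mono s s' f : ccontD1 f -> s <= s' -> (NI s' f <= NI s f)%E.
Proof.
move=> cf ss'; rewrite !NIE; apply: ge0_le_integral => //.
- by move=> u _; rewrite lee_fin Fint_ge0.
- by apply/measurable_EFinP; exact: measurable_Fint.
- by apply/measurable_EFinP; exact: measurable_Fint.
move=> u _; rewrite lee_fin /Fint /inring; case: ifP => [/andP[su u1]|_].
  by rewrite (le_trans ss' su) u1.
by case: ifP => // /andP[_ u1]; rewrite mulr_ge0 ?powR_ge0// w0// modc_ge0.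
Qed.

Lemma Aint_NI f : (Aint p w (@udisc R) f = (pi^-1)%:E * NI 0 f)%E.
Proof.
rewrite /Aint NIE integral_mkcond; congr (_ * _)%E; apply: eq_integral => u _.
rewrite patchE /Fint /inring modc_ge0/=; case: ifPn; rewrite ?inE ?notin_setE /= /udisc /=.
  by move=> ->.
by move=> /negP/negbTE ->.
Qed.

Section TransferToDilations.
Variables (L : (C -> C) -> (C -> C) -> C -> C) (g : C -> C).
Hypotheses (aL : admissible p L) (hg : analytic g).

(* If [f] has norm [0] it cannot be normalized; [f + K] and [K] can. *)
Lemma bounded_on_ball (B : R) K : 0 <= B -> analytic K -> (NI 0 K = pi%:E)%E ->
  (forall f, analytic f -> NI 0 f = pi%:E -> (NI 0 (L g f) <= B%:E)%E) ->
  exists2 B' : R, 0 <= B' & forall f, analytic f -> (NI 0 f <= pi%:E)%E -> (NI 0 (L g f) <= B'%:E)%E.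
Proof.
move=> B0 hK NK HB; have pi0 : 0 < pi :> R by exact: pi_gt0.
have k0 : 0 <= 2 `^ p :> R by exact: powR_ge0.
have scaled f (b : R) : 0 < b -> analytic f -> NI 0 f = b%:E -> (NI 0 (L g f) <= (b / pi * B)%:E)%E.
  move=> b0 hf Nf; pose a : R := (pi / b) `^ p^-1.
  have pb0 : 0 < pi / b by rewrite divr_gt0.
  have ap : modc a%:C `^ p = pi / b.
    by rewrite modc_real ger0_norm ?powR_ge0// -powRrM mulVf ?gt_eqF// powRr1// ltW.
  have Na : NI 0 (fun z => a%:C * f z) = pi%:E.
    by rewrite NI_scale ?ap ?Nf; [rewrite -EFinM divfK// gt_eqF|exact: holo_ccont].
  have := HB _ (holoZ a%:C hf) Na.
  rewrite (NI_eqD 0 (adm_scale aL a%:C hg hf)) NI_scale ?ap; last exact/holo_ccont/(adm_holo aL).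
  rewrite [(pi / b)%:E](_ : _ = ((b / pi)^-1)%:E); last by rewrite invf_div.
  by rewrite muleC lee_pdivrMr ?divr_gt0// -EFinM mulrC.
pose B' := 2 `^ p * (2 `^ p * B) + 2 `^ p * B.
have BB' : B <= B'.
  have k1 : 1 <= 2 `^ p :> R by rewrite -[X in X <= _](powRr0 2); apply: ler_powR; [rewrite ler1n|exact: ltW].
  have kB : B <= 2 `^ p * B by rewrite ler_peMl.
  by rewrite /B'; apply: le_trans kB _; rewrite lerDr !mulr_ge0.
have B'0 : 0 <= B' by exact: le_trans BB'.
exists B' => // f hf Nf.
have fin : NI 0 f \is a fin_num.
  by rewrite ge0_fin_numE ?NI_ge0// (le_lt_trans Nf)// ltry.
have [N0|N0] := eqVneq (NI 0 f) 0%E; last first.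
  have [b Nb] : exists b : R, NI 0 f = b%:E by exists (fine (NI 0 f)); rewrite fineK.
  have b0 : 0 < b by rewrite -lte_fin -Nb lt_def N0 NI_ge0.
  apply: le_trans (scaled f b b0 hf Nb) _; rewrite lee_fin; apply: le_trans BB'.
  by rewrite Nb lee_fin in Nf; rewrite ler_piMl// ler_pdivrMr// mul1r.
have hfK := holoD hf hK.
have up : (NI 0 (fun z => (f z + K z)%R) <= (2 `^ p * pi)%:E)%E.
  by apply: le_trans (NI_sum2 0 hf hK) _; rewrite N0 mule0 add0e NK.
have [b Nb] : exists b : R, NI 0 (fun z => f z + K z) = b%:E.
  exists (fine (NI 0 (fun z => f z + K z))); rewrite fineK// ge0_fin_numE ?NI_ge0//.
  exact: le_lt_trans up (ltry _).
have b0 : 0 < b.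
  have lo : (pi%:E <= (2 `^ p)%:E * NI 0 (fun z => f z + K z)%R)%E.
    rewrite -NK; have E : eqD K (fun z => (f z + K z) + -1 * f z) by move=> z _; ring.
    rewrite (NI_eqD 0 E); apply: le_trans (NI_sum2 0 hfK (holoZ (-1) hf)) _.
    by rewrite [X in (_ + _ * X)%E]NI_scale ?N0 ?mule0 ?adde0//; exact: holo_ccont.
  move: lo; rewrite Nb -EFinM lee_fin => lo.
  rewrite ltNge; apply/negP => b0; have := mulr_ge0_le0 k0 b0.
  by move=> /(le_trans lo); rewrite leNgt pi0.
have H1 := scaled _ b b0 hfK Nb.
have H2 := HB K hK NK.
have hLfK := adm_holo aL hg hfK; have hLK := adm_holo aL hg hK.
have E : eqD (L g f) (fun z => L g (fun z => f z + K z) z + -1 * L g K z).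
  by move=> z z1; rewrite (adm_add aL hg hf hK z1); ring.
rewrite (NI_eqD 0 E); apply: le_trans (NI_sum2 0 hLfK (holoZ (-1) hLK)) _.
rewrite [X in (_ + _ * X)%E]NI_scale; last exact: holo_ccont.
rewrite modcN modc1 powR1 mul1e /B' EFinD !EFinM; apply: leeD.
  apply: lee_wpmul2l => //; apply: le_trans H1 _; rewrite -EFinM lee_fin.
  apply: ler_wpM2r => //; rewrite ler_pdivrMr//.
  by move: up; rewrite Nb lee_fin.
exact: lee_wpmul2l.
Qed.

Variable (B : R).
Hypothesis (HB : forall f, analytic f -> (NI 0 f <= pi%:E)%E -> (NI 0 (L g f) <= B%:E)%E).

(* [L_{g_m} f_rho] is the dilation by [m] of [L_g f_{rho / m}]. *)
Lemma bounded_outer_dilation f (rho : R) (m : C) : analytic f -> (NI 0 f <= pi%:E)%E ->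
  0 < rho -> rho <= modc m -> modc m < 1 -> (NI 0 (L (dil m g) (dil rho%:C f)) <= B%:E)%E.
Proof.
move=> hf Nf r0 rm m1; have m0 : 0 < modc m by exact: lt_le_trans rm.
have mn0 : m != 0 by rewrite -modc_eq0 gt_eqF.
pose f' := dil (rho%:C / m) f.
have a1 : modc (rho%:C / m) <= 1.
  by rewrite modcM modcV modc_real gtr0_norm// ler_pdivrMr// mul1r.
have hf' := holo_dil a1 hf.
have -> : dil rho%:C f = dil m f' by apply/funext => z; rewrite /dil /f' /dil mulrA divfK.
rewrite (NI_eqD 0 (adm_dil aL (ltW m1) hg hf')).
apply: le_trans (NI_dil_le 0 (ltW m1) (adm_holo aL hg hf')) _.
by apply: HB => //; apply: le_trans (NI_dil_le 0 a1 hf) _.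
Qed.

(** Disc automorphism sending [0] to [c]: in the variable [u] the point [c] becomes the centre of a
    circle, as the sub-mean value property requires. *)
Definition moebius (c : R) (u : C) : C := (u + c%:C) * (1 + c%:C * u)^-1.

Lemma moebius_bound (c : R) (u : C) : 0 <= c -> c < 1 -> modc u < 1 ->
  modc (moebius c u) ^+ 2 = 1 - (1 - c ^+ 2) * (1 - modc u ^+ 2) / modc (1 + c%:C * u) ^+ 2
  /\ 1 - c <= modc (1 + c%:C * u).
Proof.
move=> c0 c1 u1.
have cu : modc (c%:C * u) <= c by rewrite modcM modc_real ger0_norm// ler_piMr// ltW.
have lb : 1 - c <= modc (1 + c%:C * u).
  by have := modcBB 1 (- (c%:C * u)); rewrite modcN modc1 opprK; lra.
split=> //; have D0 : 0 < modc (1 + c%:C * u) by lra.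
have D2 : modc (1 + c%:C * u) ^+ 2 != 0 by rewrite expf_neq0// gt_eqF.
rewrite /moebius modcM modcV exprMn exprVn.
have -> : modc (u + c%:C) ^+ 2 = modc (1 + c%:C * u) ^+ 2 - (1 - c ^+ 2) * (1 - modc u ^+ 2).
  by rewrite !modc_sqr; case: (u) => x y /=; ring.
by rewrite mulrBl mulfV.
Qed.

Lemma modc_moebius (c : R) (u : C) : 0 <= c -> c < 1 -> modc u < 1 -> modc (moebius c u) < 1.
Proof.
move=> c0 c1 u1; have [E lb] := moebius_bound c0 c1 u1.
have D0 : 0 < modc (1 + c%:C * u) by lra.
have u0 := modc_ge0 u.
have u2 : 0 < 1 - modc u ^+ 2 by rewrite subr_gt0 expr_lt1.
have c2 : 0 < 1 - c ^+ 2 by rewrite subr_gt0 expr_lt1.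
have pos : 0 < (1 - c ^+ 2) * (1 - modc u ^+ 2) / modc (1 + c%:C * u) ^+ 2.
  by rewrite divr_gt0 ?exprn_gt0// mulr_gt0.
have : modc (moebius c u) ^+ 2 < 1 by rewrite E; lra.
by rewrite expr_lt1// modc_ge0.
Qed.

Lemma holo_moebius (c : R) : 0 <= c -> c < 1 -> analytic (moebius c).
Proof.
move=> c0 c1; pose D := fun u : C => 1 + c%:C * u.
have hD : analytic D by apply: holoD; [exact: holo_cst|apply: holoZ; exact: holo_id].
apply: holoM; first by apply: holoD; [exact: holo_id|exact: holo_cst].
apply: (@holo_cder _ _ (fun z => - D z ^- 2 * der D z)) => z z1.
have [_ lb] := moebius_bound c0 c1 z1.
have Dz : D z != 0 by rewrite -modc_eq0 gt_eqF//; apply: lt_le_trans lb; lra.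
have /holoP/(_ z z1) dD := hD.
apply: (cder_eq (cder_comp dD (cderV Dz))); ring.
Qed.

Lemma moebius_outer (c rho : R) : 0 <= c -> c < 1 -> 0 < rho -> rho < 1 ->
  exists2 tau : R, 0 < tau < 1 & forall u, modc u = tau -> rho <= modc (moebius c u).
Proof.
(* As [|1 + c u| >= 1 - c], it suffices that [1 - |u|^2] be at most [e], for then [1 - |moebius c
   u|^2 <= e / (1 - c)^2 = 1 - rho^2]; the radius [1 - e / 2] achieves this. *)
move=> c0 c1 r0 r1; pose e := (1 - rho ^+ 2) * (1 - c) ^+ 2.
have q1 : 0 < 1 - rho ^+ 2 by rewrite subr_gt0 expr_lt1// ltW.
have q2 : 1 - rho ^+ 2 <= 1 by rewrite lerBlDl lerDr sqr_ge0.
have q3 : 0 < (1 - c) ^+ 2 by rewrite exprn_gt0// subr_gt0.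
have q4 : (1 - c) ^+ 2 <= 1 by rewrite expr_le1//; lra.
have e0 : 0 < e by rewrite mulr_gt0.
have e1 : e <= 1 by rewrite /e -[leRHS]mulr1; apply: ler_pM => //; exact: ltW.
exists (1 - e / 2) => [|u ut]; first by lra.
have u1 : modc u < 1 by rewrite ut; lra.
have [E lb] := moebius_bound c0 c1 u1.
rewrite -(@ler_pXn2r _ 2)// ?nnegrE ?modc_ge0 ?(ltW r0)// E ut.
have D0 : 0 < modc (1 + c%:C * u) by lra.
have D2 : (1 - c) ^+ 2 <= modc (1 + c%:C * u) ^+ 2.
  by rewrite ler_pXn2r// nnegrE; lra.
have t2 : 1 - (1 - e / 2) ^+ 2 <= e by have := sqr_ge0 e; lra.
have t0 : 0 <= 1 - (1 - e / 2) ^+ 2.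
  have -> : 1 - (1 - e / 2) ^+ 2 = e * (1 - e / 4) by field.
  by apply: mulr_ge0; lra.
rewrite lerBrDl -lerBrDr ler_pdivrMr ?exprn_gt0//.
apply: (@le_trans _ _ (1 * e)).
  by apply: ler_pM => //; rewrite ?subr_ge0 ?expr_le1// ?lerBlDl ?lerDr ?sqr_ge0// ltW.
by rewrite mul1r /e; apply: ler_wpM2l => //; exact: ltW.
Qed.

(* Sub-mean value property, in the variable [u], of [|L_{g_{moebius c u}} f_rho (z)|^p]
   on a circle [|u| = tau] that [moebius c] maps into [rho <= |m|]. *)
Lemma bounded_inner_dilation f (c rho : R) : analytic f -> (NI 0 f <= pi%:E)%E ->
  0 < rho -> rho < 1 -> 0 <= c -> c < 1 ->
  (NI 0 (L (dil c%:C g) (dil rho%:C f)) <= B%:E)%E.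
Proof.
move=> hf Nf r0 r1 c0 c1; have [tau /andP[t0 t1] Ht] := moebius_outer c0 c1 r0 r1.
have rC1 : modc rho%:C <= 1 :> R by rewrite modc_real gtr0_norm// ltW.
have hfr := holo_dil rC1 hf.
have mt t : modc (tau%:C * expi t) = tau by rewrite modcM modc_expi mulr1 modc_real gtr0_norm.
have mt1 t : modc (tau%:C * expi t) < 1 by rewrite mt.
pose Psi u := L (dil (moebius c u) g) (dil rho%:C f).
have [sl sr _] := adm_sep aL hg (sep_cst hfr).
have aPsi z : modc z < 1 -> analytic (Psi ^~ z).
  move=> z1; apply: (holo_comp (sl z z1) (holo_moebius c0 c1)) => u u1; exact: modc_moebius.
have aPsi2 u : modc u < 1 -> analytic (Psi u).
  by move=> u1; apply: sr; exact: modc_moebius.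
pose Phi t := Psi (tau%:C * expi t).
have cP t : ccontD1 (Phi t) by exact/holo_ccont/aPsi2.
have cPt z : modc z < 1 -> forall t, rcont (Phi ^~ z) t.
  move=> z1 t; apply: (@circle_cont _ (Psi ^~ z)); first exact/holo_ccont/aPsi.
  by rewrite modc_real gtr0_norm.
have Psi0 : L (dil c%:C g) (dil rho%:C f) = Psi 0.
  by rewrite /Psi /moebius add0r mulr0 addr0 invr1 mulr1.
rewrite Psi0.
have le1 : (NI 0 (Psi 0%R) <= \int[mu2]_u (Mint p w 0 Phi u)%:E)%E.
  rewrite NIE; apply: ge0_le_integral => //.
  - by move=> u _; rewrite lee_fin Fint_ge0.
  - by apply/measurable_EFinP; apply: measurable_Fint => //; apply/holo_ccont/aPsi2; rewrite modc0.
  - exact: measurable_Mint.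
  move=> u _; rewrite lee_fin /Fint /Mint; case: ifP => // /andP[_ u1].
  apply: ler_wpM2r; first by rewrite w0// modc_ge0.
  have tau1 : modc (tau%:C : C) < 1 by rewrite modc_real gtr0_norm.
  by have := mp_center p0 (aPsi _ u1) tau1; rewrite mpE.
apply: le_trans le1 _; rewrite -NI_mean//.
have -> : B%:E = (\int[mu]_(t in `[0%R, 1%R]) (cst B%:E) t)%E.
  by rewrite integral_cst//= lebesgue_measure_itv/= lte_fin ltr01 oppr0 adde0 mule1.
apply: ge0_le_integral => //.
- by move=> t _; exact: NI_ge0.
- apply: measurable_funTS; exact: (measurable_NI_family p0 w0 mw 0 cP cPt).
- move=> t _; apply: bounded_outer_dilation => //; first exact: Ht.
  exact: modc_moebius.
Qed.

(** For [rho < 1] the dilation of [L_{g_r} f] by [rho] is [L] with symbol [g_{rho r}] applied to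
    [f_rho], which [bounded_inner_dilation] controls; Fatou's lemma lets [rho] tend to [1]. *)
Lemma bounded_dilation f (r : R) : analytic f -> (NI 0 f <= pi%:E)%E -> 0 <= r -> r < 1 ->
  (NI 0 (L (dil r%:C g) f) <= B%:E)%E.
Proof.
move=> hf Nf r0 r1; have rC1 : modc r%:C <= 1 :> R by rewrite modc_real ger0_norm// ltW.
have hgr := holo_dil rC1 hg.
set H := L (dil r%:C g) f; have hH : analytic H by exact: (adm_holo aL).
pose rho (n : nat) : R := 1 - n.+2%:R^-1.
have rn n : 0 < rho n < 1.
  have n2 : n.+2%:R^-1 < 1 :> R by rewrite invf_lt1// ltr1n.
  have n0 : 0 < n.+2%:R^-1 :> R by rewrite invr_gt0.
  by rewrite /rho subr_gt0 n2 ltrBlDr ltrDl n0.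
have rhoC n : modc (rho n)%:C <= 1 :> R.
  by have /andP[a b] := rn n; rewrite modc_real gtr0_norm// ltW.
have bnd n : (NI 0 (dil (rho n)%:C H) <= B%:E)%E.
  have /andP[a b] := rn n.
  rewrite -(NI_eqD 0 (adm_dil aL (rhoC n) hgr hf)).
  have -> : dil (rho n)%:C (dil r%:C g) = dil (rho n * r)%:C g.
    by apply/funext => z; rewrite /dil mulrA rmorphM [r%:C * _]mulrC.
  apply: bounded_inner_dilation => //; first by rewrite mulr_ge0// ltW.
  by rewrite mulr_ilt1// ltW.
have rho1 : rho n @[n --> \oo] --> (1 : R).
  rewrite -[X in _ --> X]subr0; apply: cvgB; first exact: cvg_cst.
  by have := @cvg_harmonic R; rewrite -(cvg_shiftS (@harmonic R)).
have cv u : (Fint 0 (dil (rho n)%:C H) u)%:E @[n --> \oo] --> (Fint 0 H u)%:E.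
  apply: cvg_EFin; first by near=> n.
  have [ru|ru] := boolP (inring 0 u); last first.
    by rewrite /comp /Fint /= (negbTE ru); exact: cvg_cst.
  have /andP[_ u1] := ru.
  have -> : fine \o (fun n => (Fint 0 (dil (rho n)%:C H) u)%:E) =
     fun n => modc (H ((rho n)%:C * to_c u)) `^ p * w (modc (to_c u)).
    by apply/funext => n /=; rewrite /Fint ru /dil.
  rewrite /Fint ru; apply: cvgM; last exact: cvg_cst.
  have cH : {for 1, continuous (fun t : R => modc (H (t%:C * to_c u)) `^ p)}.
    apply: cont_powR => // [t|]; first exact: modc_ge0.
    apply: cont_modc; apply: (@rcont_comp _ H (fun t => t%:C * to_c u)); last exact: rcont_mulr.
    by apply: holo_ccont => //; rewrite mul1r.
  have -> : modc (H (to_c u)) `^ p = (fun t : R => modc (H (t%:C * to_c u)) `^ p) 1 by rewrite mul1r.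
  exact: (cvg_comp _ _ rho1 cH).
have mF n : measurable_fun setT (fun u => (Fint 0 (dil (rho n)%:C H) u)%:E : \bar R).
  by apply/measurable_EFinP; apply: measurable_Fint => //; apply/holo_ccont/holo_dil.
have F0 n u : setT u -> (0 <= (Fint 0 (dil (rho n)%:C H) u)%:E)%E.
  by move=> _; rewrite lee_fin Fint_ge0.
have := fatou mu2 measurableT mF F0.
have -> : (fun u => limn_einf (fun n => (Fint 0 (dil (rho n)%:C H) u)%:E)) = fun u => (Fint 0 H u)%:E.
  by apply/funext => u; have [] := cvg_limn_einf_sup (cv u).
rewrite -NIE => le; apply: le_trans le _.
have -> : (fun n => \int[mu2]_u (Fint 0 (dil (rho n)%:C H) u)%:E)%E = fun n => NI 0 (dil (rho n)%:C H).
  by apply/funext => n; rewrite NIE.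
rewrite limn_einf_lim; apply: lime_le; first exact: is_cvg_einfs.
near=> n; apply: ereal_inf_le; exists (NI 0 (dil (rho n)%:C H)) => //.
by exists n => //=.
Unshelve. all: by end_near.
Qed.

End TransferToDilations.

End WeightedNorm.

(** * Null sequences *)

Section Sequences.
Context {R : realType}.
Local Notation C := R[i].
Local Notation RR := (measurableTypeR R).
Variables (p : R) (w : R -> R).
Hypotheses (p0 : 0 < p) (w0 : forall r, 0 <= r < 1 -> 0 <= w r)
  (mw : measurable_fun (`[0, 1[%classic : set RR) (w : RR -> RR)).
Local Notation NI := (NI p w).
Implicit Types (f g G : C -> C) (h k : nat -> C -> C) (z a : C).

Definition locally_null h := forall r e : R, r < 1 -> 0 < e ->
  \forall n \near \oo, forall z, modc z <= r -> modc (h n z) <= e.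

Lemma ln_eqD h k : (forall n, eqD (h n) (k n)) -> locally_null h -> locally_null k.
Proof.
move=> E H r e r1 e0; have := H r e r1 e0; apply: filterS => n b z zr.
by rewrite -E ?b//; exact: le_lt_trans r1.
Qed.

Lemma lnD h k : locally_null h -> locally_null k -> locally_null (fun n z => h n z + k n z).
Proof.
move=> H K r e r1 e0; have e20 : 0 < e / 2 by rewrite divr_gt0.
have := K r _ r1 e20; have := H r _ r1 e20; apply: filterS2 => n a b z zr.
by rewrite (le_trans (modcD _ _))//; have := a z zr; have := b z zr; lra.
Qed.

Lemma lnM h G (M : R) : (forall z, modc z < 1 -> modc (G z) <= M) -> locally_null h ->
  locally_null (fun n z => h n z * G z).
Proof.
move=> GM H r e r1 e0.
have M0 : 0 <= M by apply: le_trans (modc_ge0 (G 0)) (GM _ _); rewrite modc0.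
have M1 : 0 < M + 1 by lra.
have d0 : 0 < e / (M + 1) by rewrite divr_gt0.
have := H r _ r1 d0; apply: filterS => n a z zr; rewrite modcM.
apply: (@le_trans _ _ (e / (M + 1) * (M + 1))); last by rewrite divfK// gt_eqF.
apply: ler_pM; rewrite ?modc_ge0 ?a//.
by have := GM z (le_lt_trans zr r1); lra.
Qed.

Lemma ln_eval0 h : locally_null h -> locally_null (fun n _ => h n 0).
Proof.
move=> H r e r1 e0; have := H 0 e ltr01 e0; apply: filterS => n a z _; apply: a.
by rewrite modc0.
Qed.

Lemma Top_id_bound f (r e : R) z : analytic f -> r < 1 -> (forall z, modc z <= r -> modc (f z) <= e) ->
  modc z <= r -> modc (TT id f z) <= 2 * e.
Proof.
move=> hf r1 fe zr; have z1 := le_lt_trans zr r1.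
have E t : 0 <= t <= 1 -> f (t%:C * z) * der id (t%:C * z) * z = f (t%:C * z) * z.
  by move=> _; rewrite (cder_cderiv (cder_id _)) mulr1.
rewrite TopE (eq_cint01 E); apply: cint01_bound => t t01.
  apply: rcontM; last exact: rcont_cst.
  apply: (@rcont_comp _ f (fun t => t%:C * z)); last exact: rcont_mulr.
  by apply: holo_ccont => //; exact: modc_tz.
have tz : modc (t%:C * z) <= r.
  case/andP: t01 => t0 t1; rewrite modcM modc_real ger0_norm//.
  by rewrite (le_trans _ zr)// ler_piMl ?modc_ge0.
have := fe _ tz; rewrite modcM => ft; apply: le_trans ft.
by rewrite ler_piMr ?modc_ge0// ltW.
Qed.

Lemma ln_Top_id h : (forall n, analytic (h n)) -> locally_null h ->
  locally_null (fun n => TT id (h n)).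
Proof.
move=> ah H r e r1 e0; have e20 : 0 < e / 2 by rewrite divr_gt0.
have := H r _ r1 e20; apply: filterS => n a z zr.
by have := Top_id_bound (ah n) r1 a zr; rewrite mulrC divfK.
Qed.

(** [dvz] averages the derivative along a radius, and the Cauchy estimate bounds that derivative by
    the size of [h n] on a larger disc. *)
Lemma ln_dvz h : (forall n, analytic (h n)) -> locally_null h -> locally_null (fun n => dvz (h n)).
Proof.
move=> ah H r e r1 e0; pose r' := Num.max r 0.
have r'1 : r' < 1 by rewrite /r' gt_max r1 ltr01.
have r'0 : 0 <= r' by rewrite /r' le_max lexx orbT.
have [lo hi] : r' < (r' + 1) / 2 /\ (r' + 1) / 2 < 1 by lra.
have [M M0 HM] := Cauchy_estimate r'0 lo hi.
have d0 : 0 < e / (2 * (M + 1)) by rewrite divr_gt0// mulr_gt0//; lra.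
have := H _ _ hi d0; apply: filterS => n a z zr.
have [db _] := HM _ _ (ah n) a.
have z1 := le_lt_trans zr r1.
apply: le_trans (cint01_bound (B := M * (e / (2 * (M + 1)))) (dvz_cont (ah n) z1) _) _.
  move=> t /andP[t0 t1]; apply: db; rewrite modcM modc_real ger0_norm//.
  apply: (@le_trans _ _ r); last by rewrite /r' le_max lexx.
  by rewrite (le_trans _ zr)// ler_piMl ?modc_ge0.
have -> : 2 * (M * (e / (2 * (M + 1)))) = M / (M + 1) * e by field; rewrite gt_eqF//; lra.
have M1 : 0 < M + 1 by rewrite ltr_wpDl.
have q1 : M / (M + 1) <= 1 by rewrite ler_pdivrMr// mul1r lerDl.
by rewrite ler_piMl// ltW.
Qed.

(** * Bounded and null sequences in the norm of an outer ring *)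

Section Ring.
Variables (s W : R).
Hypotheses (W0 : 0 <= W) (HW : (NI s (fun=> 1%R) <= W%:E)%E).

(** Norms are taken over the ring [s <= |z| < 1], where constants have finite norm by [HW];
    [locally_null] controls the rest of the disc. *)
Record bounded_seq h : Prop := BoundedSeq {
  bs_an : forall n, analytic (h n);
  bs_ln : locally_null h;
  bs_bnd : exists2 B : R, 0 <= B & \forall n \near \oo, (NI s (h n) <= B%:E)%E }.

Record null_seq h : Prop := NullSeq {
  ns_an : forall n, analytic (h n);
  ns_ln : locally_null h;
  ns_null : forall e : R, 0 < e -> \forall n \near \oo, (NI s (h n) <= e%:E)%E }.

Lemma null_bounded h : null_seq h -> bounded_seq h.
Proof. by case=> a l n; split=> //; exists 1 => //; exact: n. Qed.

Lemma NI_add_le f g (a b : R) : analytic f -> analytic g -> (NI s f <= a%:E)%E -> (NI s g <= b%:E)%E ->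
  (NI s (fun z => (f z + g z)%R) <= (2 `^ p * (a + b))%:E)%E.
Proof.
move=> hf hg fa gb; apply: le_trans (NI_sum2 p0 w0 mw s hf hg) _.
rewrite mulrDr EFinD !EFinM; apply: leeD; apply: lee_wpmul2l => //; rewrite lee_fin; exact: powR_ge0.
Qed.

Lemma NI_mul_le f G (M a : R) : analytic f -> analytic G ->
  (forall z, modc z < 1 -> modc (G z) <= M) -> (NI s f <= a%:E)%E ->
  (NI s (fun z => (f z * G z)%R) <= (M `^ p * a)%:E)%E.
Proof.
move=> hf hG GM fa; have hfG := holoM hf hG.
have := @NI_le _ p w p0 w0 mw s _ f f (M `^ p) 0 (holo_ccont hfG) (holo_ccont hf) (holo_ccont hf) (powR_ge0 _ _) (lexx 0).
rewrite mul0e adde0 => H.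
apply: le_trans (H _) _; last by rewrite EFinM; apply: lee_wpmul2l => //; rewrite lee_fin powR_ge0.
move=> z _ z1; rewrite mul0r addr0.
exact: mp_Mul p0 (holo_ccont hf) (holo_ccont hG) GM z1.
Qed.

Lemma bs_eqD h k : (forall n, eqD (h n) (k n)) -> bounded_seq h -> bounded_seq k.
Proof.
move=> E [a l [B B0 b]]; split; first by move=> n; exact: holo_eqD (E n) (a n).
  exact: ln_eqD E l.
by exists B => //; apply: filterS b => n; rewrite (NI_eqD p w s (E n)).
Qed.

Lemma ns_eqD h k : (forall n, eqD (h n) (k n)) -> null_seq h -> null_seq k.
Proof.
move=> E [a l b]; split; first by move=> n; exact: holo_eqD (E n) (a n).
  exact: ln_eqD E l.
by move=> e /b; apply: filterS => n; rewrite (NI_eqD p w s (E n)).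
Qed.

Lemma bsD h k : bounded_seq h -> bounded_seq k -> bounded_seq (fun n z => h n z + k n z).
Proof.
move=> [a l [B B0 b]] [a' l' [B' B'0 b']]; split.
- by move=> n; exact: holoD.
- exact: lnD.
exists (2 `^ p * (B + B')); first by rewrite mulr_ge0 ?powR_ge0// addr_ge0.
by move: b b'; apply: filterS2 => n; exact: NI_add_le.
Qed.

Lemma nsD h k : null_seq h -> null_seq k -> null_seq (fun n z => h n z + k n z).
Proof.
move=> [a l b] [a' l' b']; split.
- by move=> n; exact: holoD.
- exact: lnD.
move=> e e0; have k0 : 0 < 2 * 2 `^ p :> R by rewrite mulr_gt0// powR_gt0.
have d0 : 0 < e / (2 * 2 `^ p) by rewrite divr_gt0.
have := b' _ d0; have := b _ d0; apply: filterS2 => n h1 h2.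
have E : 2 `^ p * (e / (2 * 2 `^ p) + e / (2 * 2 `^ p)) = e.
  by field; rewrite gt_eqF// powR_gt0.
by have := NI_add_le (a n) (a' n) h1 h2; rewrite E.
Qed.

Lemma bsM h G (M : R) : analytic G -> (forall z, modc z < 1 -> modc (G z) <= M) -> bounded_seq h ->
  bounded_seq (fun n z => h n z * G z).
Proof.
move=> hG GM [a l [B B0 b]]; split.
- by move=> n; exact: holoM.
- exact: lnM GM l.
exists (M `^ p * B); first by rewrite mulr_ge0 ?powR_ge0.
by apply: filterS b => n; exact: NI_mul_le.
Qed.

Lemma nsM h G (M : R) : analytic G -> (forall z, modc z < 1 -> modc (G z) <= M) -> null_seq h ->
  null_seq (fun n z => h n z * G z).
Proof.
move=> hG GM [a l b]; split.
- by move=> n; exact: holoM.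
- exact: lnM GM l.
move=> e e0; have M0 : 0 <= M `^ p by exact: powR_ge0.
have M1 : 0 < M `^ p + 1 by lra.
have d0 : 0 < e / (M `^ p + 1) by rewrite divr_gt0.
have := b _ d0; apply: filterS => n h1.
apply: le_trans (NI_mul_le (a n) hG GM h1) _; rewrite lee_fin.
rewrite mulrC mulrAC ler_pdivrMr// ler_wpM2l//; first exact: ltW.
by rewrite lerDl.
Qed.

Lemma bsZ h (c : C) : bounded_seq h -> bounded_seq (fun n z => c * h n z).
Proof.
move=> H; apply: (@bs_eqD (fun n z => h n z * c)); first by move=> n z _; rewrite mulrC.
exact: (bsM (holo_cst c) (fun z _ => lexx (modc c)) H).
Qed.

Lemma nsZ h (c : C) : null_seq h -> null_seq (fun n z => c * h n z).
Proof.
move=> H; apply: (@ns_eqD (fun n z => h n z * c)); first by move=> n z _; rewrite mulrC.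
exact: (nsM (holo_cst c) (fun z _ => lexx (modc c)) H).
Qed.

Lemma ns0 : null_seq (fun _ _ => 0).
Proof.
split=> [n|r e r1 e0|e e0]; first exact: holo_cst.
  by apply: nearW => n z _; rewrite modc0 ltW.
apply: nearW => n.
have E : eqD (fun=> 0 : C) (fun z : C => 0 * 0) by move=> z _; rewrite mul0r.
rewrite (NI_eqD p w s E) NI_scale//; last by apply: holo_ccont; exact: holo_cst.
by rewrite modc0 powR0 ?gt_eqF// mul0e lee_fin ltW.
Qed.

Lemma ns_cst (c : nat -> C) : locally_null (fun n _ => c n) -> null_seq (fun n _ => c n).
Proof.
move=> H; split=> // [n|e e0]; first exact: holo_cst.
have W1 : 0 < W + 1 by rewrite ltr_wpDl.
have d0 : 0 < e / (W + 1) by rewrite divr_gt0.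
have [d dp dH] := powR_small p0 d0.
have := H 0 d ltr01 dp; apply: filterS => n /(_ 0); rewrite modc0 lexx => /(_ isT) cd.
have E : eqD (fun=> c n) (fun z : C => c n * (fun=> 1) z) by move=> z _; rewrite mulr1.
rewrite (NI_eqD p w s E) NI_scale//; last by apply: holo_ccont; exact: holo_cst.
apply: (@le_trans _ _ ((e / (W + 1))%:E * W%:E)%E).
  apply: lee_pmul => //; [by rewrite lee_fin powR_ge0|exact: NI_ge0|].
  by rewrite lee_fin dH// modc_ge0.
by rewrite -EFinM lee_fin mulrAC ler_pdivrMr// ler_wpM2l ?lerDl// ltW.
Qed.

Lemma ns_eval0 h : locally_null h -> null_seq (fun n _ => h n 0).
Proof. by move=> /ln_eval0; exact: ns_cst. Qed.

Lemma ns_eval0M h G (M : R) : analytic G -> (forall z, modc z < 1 -> modc (G z) <= M) ->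
  locally_null h -> null_seq (fun n z => h n 0 * G z).
Proof. by move=> hG GM l; exact: nsM hG GM (ns_eval0 l). Qed.

Lemma pow_bound (m : nat) z : modc z < 1 -> modc (z ^+ m) <= 1.
Proof. by move=> z1; rewrite modcX exprn_ile1 ?modc_ge0// ltW. Qed.

Lemma ln_iter_dvz h j : (forall n, analytic (h n)) -> locally_null h ->
  (forall n, analytic (iter j dvz (h n))) /\ locally_null (fun n => iter j dvz (h n)).
Proof.
move=> ah H; elim: j => [//|j [aj Hj]]; split; first by move=> n; exact: holo_dvz (aj n).
exact: ln_dvz aj Hj.
Qed.

Lemma dvz_step j f z : analytic f -> modc z < 1 ->
  z ^+ j * f z = f 0 * z ^+ j + z ^+ j.+1 * dvz f z.
Proof. by move=> hf z1; rewrite exprSr -mulrA dvzE//; ring. Qed.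

(** The Taylor coefficients of [h n] are the values at [0] of the iterates of [dvz], and these tend
    to [0] with [n]. *)
Lemma ns_taylor h j : (forall n, analytic (h n)) -> locally_null h ->
  null_seq (fun n z => h n z - z ^+ j * iter j dvz (h n) z).
Proof.
move=> ah H; elim: j => [|j IH].
  by apply: ns_eqD ns0 => n z _ /=; rewrite mul1r subrr.
have [aj lj] := ln_iter_dvz j ah H.
have := nsD IH (ns_eval0M (holoX j (@holo_id R)) (@pow_bound j) lj).
apply: ns_eqD => n z z1 /=; rewrite (dvz_step j (aj n) z1); ring.
Qed.

Lemma ns_Top_id_taylor h j : (forall n, analytic (h n)) -> locally_null h ->
  null_seq (fun n z => TT id (h n) z - TT id (fun z => z ^+ j * iter j dvz (h n) z) z).
Proof.
move=> ah H; have hid := @holo_id R; elim: j => [|j IH].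
  apply: ns_eqD ns0 => n z z1.
  have E : eqD (h n) (fun z => z ^+ 0 * iter 0 dvz (h n) z) by move=> y _ /=; rewrite expr0 mul1r.
  by rewrite (Top_congr _ E z1) subrr.
have [aj lj] := ln_iter_dvz j ah H.
have hX := holoX j hid.
have bT z : modc z < 1 -> modc (TT id (fun z => z ^+ j) z) <= 2 * 1.
  move=> z1; apply: (Top_id_bound hX z1) => // y yz; apply: pow_bound; exact: le_lt_trans z1.
have := nsD IH (ns_eval0M (holo_Top hid hX) bT lj).
apply: ns_eqD => n z z1.
have E : eqD (fun z => z ^+ j * iter j dvz (h n) z)
    (fun z => iter j dvz (h n) 0 * z ^+ j + z ^+ j.+1 * iter j.+1 dvz (h n) z).
  by move=> y y1; exact: (dvz_step j (aj n) y1).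
have h1 := holoZ (iter j dvz (h n) 0) hX.
have h2 := holoM (holoX j.+1 hid) (holo_dvz (aj n)).
rewrite (Top_congr _ E z1) (TopD hid h1 h2 z1) (TopZ _ hid hX z1); ring.
Qed.

Lemma outer_radius j : exists2 s1 : R, 0 < s1 < 1 & forall x, s1 <= x -> 1 <= 2 * (x ^+ j) `^ p.
Proof.
(* The threshold is [2^(- a)]: beyond it [x^(j p) >= 2^(- j p / (j p + 1)) >= 1 / 2]. The [1] covers
   [j = 0]. *)
pose a := (j%:R * p + 1)^-1; have jp : 0 <= j%:R * p by rewrite mulr_ge0// ltW.
have a0 : 0 < a by rewrite invr_gt0; lra.
have h0 : 0 < 2^-1 :> R by rewrite invr_gt0.
have h1 : 2^-1 < 1 :> R by rewrite invf_lt1// ltr1n.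
exists (2^-1 `^ a) => [|x xs].
  rewrite powR_gt0//=; have := @gt0_ltr_powR R a a0 2^-1 1; rewrite powR1; by apply => //; rewrite nnegrE ltW.
apply: (@le_trans _ _ (2 * (2^-1 `^ a ^+ j) `^ p)); last first.
  apply: ler_wpM2l => //; apply: powR_le_mono; [exact: ltW|by rewrite exprn_ge0 ?powR_ge0|].
  by apply: lerXn2r => //; rewrite nnegrE ?powR_ge0//; apply: le_trans xs; exact: powR_ge0.
rewrite -powR_mulrn ?powR_ge0// -!powRrM.
apply: (@le_trans _ _ (2 * 2^-1 `^ 1)); first by rewrite powRr1 ?(ltW h0)// mulfV ?pnatr_eq0.
apply: ler_wpM2l => //; apply: ger_powR; first by rewrite h0 ltW.
by rewrite mulrC ler_pdivrMr ?mul1r ?lerDl// ltr_wpDl.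
Qed.

(** The bound does not involve [j]: for [|z| >= s1] division by [z^j] costs a factor [2], and for
    [|z| < s1] the iterate is at most [1] for large [n], which contributes [W]. Only [s1] and the
    threshold on [n] depend on [j]. *)
Lemma NI_dvz_bound h j (B : R) : (forall n, analytic (h n)) -> locally_null h -> 0 <= B ->
  (\forall n \near \oo, (NI s (h n) <= B%:E)%E) ->
  \forall n \near \oo, (NI s (iter j dvz (h n)) <= (2 * (2 `^ p * (B + 1)) + W)%:E)%E.
Proof.
move=> ah H B0 hB; have [aj lj] := ln_iter_dvz j ah H.
have hT := ns_taylor j ah H.
have [s1 /andP[s10 s11] Hs1] := outer_radius j.
have := lj s1 1 s11 ltr01; have := ns_null hT ltr01; move: hB; apply: filterS3 => n h1 h2 h3.
have hX := holoX j (@holo_id R).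
have hz := holoM hX (aj n).
have h4 : (NI s (fun z => z ^+ j * iter j dvz (h n) z)%R <= (2 `^ p * (B + 1))%:E)%E.
  have E : eqD (fun z => z ^+ j * iter j dvz (h n) z)
      (fun z => h n z + -1 * (h n z - z ^+ j * iter j dvz (h n) z)) by move=> z _; ring.
  have hd := ns_an hT n.
  rewrite (NI_eqD p w s E); apply: (NI_add_le (ah n) (holoZ (-1) hd)) => //.
  by rewrite NI_scale//; [rewrite modcN modc1 powR1 mul1e|exact: holo_ccont].
have h1' := holo_cst (1 : C).
have := @NI_le _ p w p0 w0 mw s (iter j dvz (h n)) (fun z => z ^+ j * iter j dvz (h n) z) (fun=> 1) 2 1
  (holo_ccont (aj n)) (holo_ccont hz) (holo_ccont h1') (ler0n _ 2) ler01.
have T : (2%:E * NI s (fun z => (z ^+ j * iter j dvz (h n) z)%R) + 1%:E * NI s (fun=> 1%R) <=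
    (2 * (2 `^ p * (B + 1)) + W)%:E)%E.
  by rewrite mul1e (EFinD (2 * _) W) (EFinM 2); apply: leeD => //; apply: lee_wpmul2l.
move=> HH; apply: le_trans (HH _) T => z _ z1.
have [zs|zs] := leP s1 (modc z).
  apply: (@le_trans _ _ (2 * mp p (fun z => z ^+ j * iter j dvz (h n) z) z)); last first.
    by rewrite lerDl mul1r mp_ge0.
  apply: mp_le => //; try exact: holo_ccont.
  move=> v v1 vz; rewrite modcM modcX powRM ?modc_ge0 ?exprn_ge0 ?modc_ge0// mulrA.
  by apply: ler_peMl; [exact: powR_ge0|apply: Hs1; rewrite vz].
apply: (@le_trans _ _ (1 * mp p (fun=> 1 : C) z)); last by rewrite lerDr mulr_ge0// mp_ge0.
apply: mp_le => //; try exact: holo_ccont.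
move=> v v1 vz; rewrite modc1 mul1r.
by apply: powR_le_mono; [exact: ltW|exact: modc_ge0|apply: h3; rewrite vz ltW].
Qed.

(* Up to a null sequence [T_z h] is [T_z (z^j D^j h)], where [D f = (f - f(0)) / z], and
   the norm of the latter is [O((j + 1)^-1)] times that of [D^j h]. *)
Lemma ns_Top_id h : bounded_seq h -> null_seq (fun n => TT id (h n)).
Proof.
move=> [ah H [B B0 hB]]; have hid := @holo_id R.
split; [by move=> n; exact: holo_Top|exact: ln_Top_id|move=> e e0].
have [c c0 Hc] := mp_Top_id_pow p0.
pose B2 := 2 * (2 `^ p * (B + 1)) + W.
have k0 : 0 < 2 `^ p :> R by exact: powR_gt0.
have B20 : 0 < B2 + 1.
  by rewrite /B2 ltr_wpDl// addr_ge0// !mulr_ge0 ?addr_ge0// ltW.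
pose e1 := e / (2 * 2 `^ p); have e10 : 0 < e1 by rewrite divr_gt0// mulr_gt0.
have c1 : 0 < c + 1 by rewrite ltr_wpDl.
have d0 : 0 < e1 / ((c + 1) * (B2 + 1)) by rewrite divr_gt0// mulr_gt0.
have [d dp dH] := powR_small p0 d0.
(* [j] is fixed before [n], which is possible because [B2] is independent of [j]. *)
have [j jd] : exists j : nat, j.+1%:R^-1 <= d.
  exists (Num.truncn d^-1); rewrite invf_ple ?posrE//; apply/ltW; exact: truncnS_gt.
have hj : c * j.+1%:R^-1 `^ p * B2 <= e1.
  apply: (@le_trans _ _ ((c + 1) * (e1 / ((c + 1) * (B2 + 1))) * (B2 + 1))).
    have B2' : 0 <= B2.
      by rewrite /B2 addr_ge0// !mulr_ge0 ?addr_ge0// ltW.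
    apply: ler_pM => //; [by rewrite mulr_ge0 ?powR_ge0| |by rewrite lerDl].
    by apply: ler_pM; rewrite ?powR_ge0// ?lerDl// dH// invr_ge0.
  by rewrite le_eqVlt; apply/orP; left; apply/eqP; field; rewrite !gt_eqF.
have [aj lj] := ln_iter_dvz j ah H.
have hT := ns_Top_id_taylor j ah H.
have := ns_null hT e10; have := NI_dvz_bound j ah H B0 hB; apply: filterS2 => n h1 h2.
have hz := holoM (holoX j hid) (aj n).
have hTz := holo_Top hid hz.
have h3 : (NI s (TT id (fun z => z ^+ j * iter j dvz (h n) z)%R) <= e1%:E)%E.
  have ca : 0 <= c * j.+1%:R^-1 `^ p by rewrite mulr_ge0 ?powR_ge0.
  have := @NI_le _ p w p0 w0 mw s (TT id (fun z => z ^+ j * iter j dvz (h n) z)) (iter j dvz (h n)) (iter j dvz (h n))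
    (c * j.+1%:R^-1 `^ p) 0 (holo_ccont hTz) (holo_ccont (aj n)) (holo_ccont (aj n)) ca (lexx 0).
  rewrite mul0e adde0 => HH; apply: le_trans (HH _) _.
    by move=> z _ z1; rewrite mul0r addr0; exact: Hc.
  apply: (@le_trans _ _ ((c * j.+1%:R^-1 `^ p)%:E * B2%:E)%E); first exact: lee_wpmul2l.
  by rewrite -EFinM lee_fin.
have E : eqD (TT id (h n)) (fun z => TT id (fun z => z ^+ j * iter j dvz (h n) z) z +
    (TT id (h n) z - TT id (fun z => z ^+ j * iter j dvz (h n) z) z)) by move=> z _; ring.
rewrite (NI_eqD p w s E); apply: le_trans (NI_add_le hTz (ns_an hT n) h3 h2) _.
by rewrite lee_fin le_eqVlt; apply/orP; left; apply/eqP; rewrite /e1; field; rewrite gt_eqF.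
Qed.

Section Operators.
Variables (G : C -> C) (M M' : R).
Hypotheses (hG : analytic G) (GM : forall z, modc z < 1 -> modc (G z) <= M)
  (GM' : forall z, modc z < 1 -> modc (der G z) <= M').

(** [T_G h] is [T_z (h G')], and multiplication by the bounded function [G'] preserves bounded
    sequences. *)
Lemma ns_Top h : bounded_seq h -> null_seq (fun n => TT G (h n)).
Proof.
move=> H; have := ns_Top_id (bsM (holo_cderiv hG) GM' H).
apply: ns_eqD => n; apply: eqD_sym; exact: Top_mul_id hG (bs_an H n).
Qed.

(** By parts, the difference is [- h(0) G(0) - T_G h]. *)
Lemma ns_Sop_sub h : bounded_seq h -> null_seq (fun n z => SS G (h n) z - h n z * G z).
Proof.
move=> H; have := nsD (nsZ (- G 0) (ns_eval0 (bs_ln H))) (nsZ (-1) (ns_Top H)).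
apply: ns_eqD => n z z1; rewrite (Top_parts hG (bs_an H n) z1); ring.
Qed.

Lemma bs_Sop h : bounded_seq h -> bounded_seq (fun n => SS G (h n)).
Proof.
move=> H; have := bsD (null_bounded (ns_Sop_sub H)) (bsM hG GM H).
by apply: bs_eqD => n z _; ring.
Qed.

Lemma ns_Sop h : null_seq h -> null_seq (fun n => SS G (h n)).
Proof.
move=> H; have := nsD (ns_Sop_sub (null_bounded H)) (nsM hG GM H).
by apply: ns_eqD => n z _; ring.
Qed.

Lemma ns_iter_Sop j h : null_seq h -> null_seq (fun n => iter j (SS G) (h n)).
Proof. by move=> H; elim: j => [//|j IH]; exact: ns_Sop. Qed.

Lemma bs_Top h : bounded_seq h -> bounded_seq (fun n => TT G (h n)).
Proof. by move=> /ns_Top/null_bounded. Qed.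

Lemma bs_Pi0 h : bounded_seq h -> bounded_seq (fun n => Pi0 (h n)).
Proof.
move=> H; have := bsD H (bsZ (-1) (null_bounded (ns_eval0 (bs_ln H)))).
by apply: bs_eqD => n z _; rewrite /Pi0; ring.
Qed.

Lemma bs_bigsum m (h : 'I_m -> nat -> C -> C) : (forall i, bounded_seq (h i)) ->
  bounded_seq (fun n z => \sum_(i < m) h i n z).
Proof.
elim: m h => [|m IH] h H.
  by apply: bs_eqD (null_bounded ns0) => n z _; rewrite big_ord0.
have := bsD (IH _ (fun i => H (widen_ord (leqnSn m) i))) (H ord_max).
by apply: bs_eqD => n z _; rewrite big_ord_recr.
Qed.

Lemma ns_bigsum m (h : 'I_m -> nat -> C -> C) : (forall i, null_seq (h i)) ->
  null_seq (fun n z => \sum_(i < m) h i n z).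
Proof.
elim: m h => [|m IH] h H.
  by apply: ns_eqD ns0 => n z _; rewrite big_ord0.
have := nsD (IH _ (fun i => H (widen_ord (leqnSn m) i))) (H ord_max).
by apply: ns_eqD => n z _; rewrite big_ord_recr.
Qed.

Lemma bs_iter (A : (C -> C) -> C -> C) j h :
  (forall h, bounded_seq h -> bounded_seq (fun n => A (h n))) ->
  bounded_seq h -> bounded_seq (fun n => iter j A (h n)).
Proof. by move=> HA H; elim: j => [//|j IH]; exact: HA. Qed.

Lemma bs_polyop (P : {poly C}) A h :
  (forall h, bounded_seq h -> bounded_seq (fun n => A (h n))) ->
  bounded_seq h -> bounded_seq (fun n => polyop P A (h n)).
Proof. by move=> HA H; apply: bs_bigsum => i; apply: bsZ; exact: bs_iter. Qed.

Lemma ns_iter_Sop_sub j h : bounded_seq h ->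
  null_seq (fun n z => iter j (SS G) (h n) z - h n z * G z ^+ j).
Proof.
move=> H; elim: j => [|j IH].
  by apply: ns_eqD ns0 => n z _; rewrite /= mulr1 subrr.
have Hj := bs_iter j bs_Sop H.
have := nsD (ns_Sop_sub Hj) (nsM hG GM IH).
by apply: ns_eqD => n z _ /=; rewrite exprSr; ring.
Qed.

Lemma ns_polyop_Sop_sub (P : {poly C}) h : bounded_seq h ->
  null_seq (fun n z => polyop P (SS G) (h n) z - h n z * P.[G z]).
Proof.
move=> H; have := @ns_bigsum (size P) (fun j n z => P`_j * (iter j (SS G) (h n) z - h n z * G z ^+ j)).
move=> /(_ (fun j => nsZ _ (ns_iter_Sop_sub j H))); apply: ns_eqD => n z _.
rewrite /polyop horner_coef mulr_sumr -sumrB; apply: eq_bigr => j _; ring.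
Qed.

Lemma ns_mon_eval0 (c : C -> C) j h : bounded_seq h -> null_seq (fun n => mon_eval0 c j G (h n)).
Proof.
move=> H; have hG0 := holoX j (holoB hG (holo_cst (G 0))).
have M0 : 0 <= M by apply: le_trans (modc_ge0 (G 0)) (GM _); rewrite modc0.
have b z : modc z < 1 -> modc ((G z - G 0) ^+ j) <= (M + M) ^+ j.
  move=> z1; rewrite modcX; apply: lerXn2r; rewrite ?nnegrE ?modc_ge0 ?addr_ge0//.
  apply: le_trans (modcB _ _) _; apply: lerD; [exact: GM|by apply: GM; rewrite modc0].
have := nsZ (c (G 0)) (ns_eval0M hG0 b (bs_ln H)).
by apply: ns_eqD => n z _; rewrite /mon_eval0; ring.
Qed.

(** The summands containing [T_G] or the evaluation at [0] are null; in the remaining one each [S_G]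
    may be replaced by multiplication by [G], the outermost giving the factor ['X]. *)
Lemma ns_LL_sub N (P : nat -> {poly C}) Q h : bounded_seq h ->
  null_seq (fun n z => LL N P Q G (h n) z - h n z * (('X * P N.+1).[G z])).
Proof.
move=> H.
have H1 : null_seq (fun n z => \sum_(k < N.+1) iter k (SS G) (TT G (polyop (P k) (TT G) (Pi0 (h n)))) z).
  apply: ns_bigsum => k.
  exact: ns_iter_Sop (ns_Top (bs_polyop (P k) bs_Top (bs_Pi0 H))).
have H2 := ns_bigsum (fun j : 'I_(size Q) => ns_mon_eval0 (fun x => (Q`_j).[x]) j H).
have H3 := ns_Sop_sub (bs_polyop (P N.+1) bs_Sop H).
have H4 := nsM hG GM (ns_polyop_Sop_sub (P N.+1) H).
have := nsD (nsD H1 H2) (nsD H3 H4).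
apply: ns_eqD => n z _; rewrite LL_SS hornerM hornerX; ring.
Qed.

End Operators.

End Ring.

End Sequences.

(** * Boundedness of the symbol *)

Section Necessity.
Context {R : realType}.
Local Notation C := R[i].
Local Notation mu := (@lebesgue_measure R).
Local Notation RR := (measurableTypeR R).
Local Notation mu2 := (mu \x mu)%E.
Variables (p : R) (w : R -> R).
Hypotheses (p0 : 0 < p) (w0 : forall r, 0 <= r < 1 -> 0 <= w r)
  (mw : measurable_fun (`[0, 1[%classic : set RR) (w : RR -> RR)).
Local Notation NI := (NI p w).
Implicit Types (f g K : C -> C) (z : C).

Lemma NI_Aint f : (NI 0 f = pi%:E * Aint p w (@udisc R) f)%E.
Proof.
have pi0 : pi != 0 :> R by rewrite gt_eqF// pi_gt0.
by rewrite Aint_NI muleA -EFinM mulfV// mul1e.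
Qed.

Lemma Aint_ge0 f : (0 <= Aint p w (@udisc R) f)%E.
Proof. by rewrite Aint_NI mule_ge0 ?NI_ge0// lee_fin invr_ge0 pi_ge0. Qed.

Lemma Apnorm_powR f : (Aint p w (@udisc R) f = Apnorm p w f `^ p)%E.
Proof. by rewrite /Apnorm -poweRrM mulVf ?gt_eqF// poweRe1// Aint_ge0. Qed.

(** [NI] omits the factor [1 / pi] of [dA], hence the value [pi]. *)
Lemma Apnorm_eq1 f : Apnorm p w f = 1%E <-> NI 0 f = pi%:E.
Proof.
split=> [H|H]; first by rewrite NI_Aint Apnorm_powR H poweR1r mule1.
by rewrite /Apnorm Aint_NI H -EFinM mulVf ?poweR1r// gt_eqF// pi_gt0.
Qed.

Lemma Apnorm_le f (M : R) : (Apnorm p w f <= M%:E)%E -> (NI 0 f <= (pi * M `^ p)%:E)%E.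
Proof.
move=> H; rewrite NI_Aint EFinM; apply: lee_wpmul2l; first by rewrite lee_fin pi_ge0.
rewrite Apnorm_powR -poweR_EFin; apply: gt0_ler_poweR => //; first exact: ltW.
  by rewrite in_itv/= leey andbT poweR_ge0.
by rewrite in_itv/= leey andbT (le_trans _ H)// poweR_ge0.
Qed.

Lemma NI_le_Apnorm f (c : R) : (NI 0 f <= (pi * c)%:E)%E -> (Apnorm p w f <= (c `^ p^-1)%:E)%E.
Proof.
move=> H; have pi0 : 0 < pi :> R by exact: pi_gt0.
have le : (Aint p w (@udisc R) f <= c%:E)%E.
  rewrite Aint_NI; apply: (@le_trans _ _ (pi^-1%:E * (pi * c)%:E)%E).
    by apply: lee_wpmul2l => //; rewrite lee_fin invr_ge0 ltW.
  by rewrite -EFinM mulKf// gt_eqF.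
have A0 := Aint_ge0 f.
rewrite /Apnorm -poweR_EFin; apply: gt0_ler_poweR => //; first by rewrite invr_ge0 ltW.
  by rewrite in_itv/= leey andbT.
by rewrite in_itv/= leey andbT (le_trans A0).
Qed.

(* The weight need not be treated near the origin: integrability over an outer ring
   is enough, and it follows from the existence of a single nonzero [K]. *)
Lemma finite_ring K : analytic K -> NI 0 K = pi%:E ->
  exists s W : R, [/\ 0 <= s, s < 1, 0 <= W & (NI s (fun=> 1%R) <= W%:E)%E].
Proof.
move=> hK NK; have pi0 : 0 < pi :> R by exact: pi_gt0.
have [z [z1 Kz]] : exists z, modc z < 1 /\ K z != 0.
  apply: contrapT => H; have : NI 0 K = 0%E.
    rewrite NIE; apply: integral0_eq => u _; rewrite /Fint; case: ifP => // /andP[_ u1].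
    have [->|Ku] := eqVneq (K (to_c u)) 0; first by rewrite modc0 powR0 ?gt_eqF// mul0r.
    by exfalso; apply: H; exists (to_c u).
  by rewrite NK => /eqP; rewrite eqe gt_eqF.
have c0 := mp_gt0 p0 (holo_ccont hK) z1 Kz; set c := mp p K z in c0.
exists (modc z), (c^-1 * pi); split=> //; first exact: modc_ge0.
  by rewrite mulr_ge0 ?invr_ge0 ?ltW.
have h1 := holo_cst (1 : C).
have := @NI_le _ p w p0 w0 mw (modc z) (fun=> 1) K K c^-1 0 (holo_ccont h1) (holo_ccont hK) (holo_ccont hK) _ (lexx 0).
rewrite mul0e adde0 => H; apply: le_trans (H _ _) _.
- by rewrite invr_ge0 ltW.
- move=> v zv v1; rewrite mp_cst modc1 powR1 mul0r addr0 mulrC ler_pdivlMr// mul1r.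
  exact: mp_mono_le.
rewrite EFinM -NK; apply: lee_wpmul2l; first by rewrite lee_fin invr_ge0 ltW.
by apply: NI_ring_mono => //; [exact: holo_ccont|exact: modc_ge0].
Qed.

(** Induction on the Horner form: if [|P(x)| >= c] for large [x], then
    [|P(x) x + a| >= c |x| - |a|], which is eventually at least [1]. *)
Lemma poly_lower_bound (P : {poly C}) : P != 0 -> exists A c : R,
  0 < c /\ forall x, A <= modc x -> c <= modc P.[x].
Proof.
elim/poly_ind: P => [|P a IH]; first by rewrite eqxx.
have [->|P0] := eqVneq P 0.
  rewrite mul0r add0r polyC_eq0 => a0; exists 0, (modc a).
  by split=> [|x _]; [rewrite lt_def modc_eq0 a0 modc_ge0|rewrite hornerC].
have [A [c [c0 Hc]]] := IH P0; move=> _.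
exists (Num.max A ((1 + modc a) / c)), 1; split=> // x.
rewrite ge_max => /andP[Ax]; rewrite ler_pdivrMr// => cx.
have := Hc _ Ax; rewrite hornerD hornerM hornerX hornerC => cP.
have : modc x * c <= modc (P.[x] * x) by rewrite modcM mulrC ler_wpM2r ?modc_ge0.
have := modcBB (P.[x] * x) (- a); rewrite opprK modcN; lra.
Qed.

Lemma poly_bounded_arg (P : {poly C}) (B : R) : P != 0 ->
  exists A : R, forall x, modc (('X * P).[x]) <= B -> modc x <= A.
Proof.
move=> /poly_lower_bound[A [c [c0 H]]]; exists (Num.max A (B / c)) => x.
rewrite hornerM hornerX modcM le_max => xB.
have [//|/ltW Ax] := leP (modc x) A; rewrite /= ler_pdivlMr//.
by rewrite (le_trans _ xB)// ler_wpM2l ?modc_ge0// H.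
Qed.

Lemma holo_horner (P : {poly C}) g : analytic g -> analytic (fun z => P.[g z]).
Proof.
move=> hg; elim/poly_ind: P => [|P a IH].
  by have := holo_cst (0 : C); apply: holo_eqD => z _; rewrite horner0.
have := holoD (holoM IH hg) (holo_cst a); apply: holo_eqD => z _.
by rewrite hornerMXaddC.
Qed.

(** * Lower bound from the concentration of mass *)

Section LowerBound.
Variables (K H : C -> C) (s delta c : R) (zeta : C).
Hypotheses (hK : analytic K) (NK : NI 0 K = pi%:E) (hH : analytic H) (c0 : 0 < c)
  (far : (Aint p w (@udisc R `\` [set z | (modc (z - zeta) < delta)%R]) K < 2^-1%:E)%E)
  (near_s : forall z, modc z < 1 -> modc (z - zeta) < delta -> s <= modc z)
  (near_c : forall z, modc z < 1 -> modc (z - zeta) < delta -> c <= modc (H z)).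

Let Fout (u : RR * RR) : R := Fint p w 0 K u * \1_(`[delta, +oo[) (modc (to_c u - zeta)).

Let measurable_Fout : measurable_fun setT Fout.
Proof.
apply: measurable_funM; first by apply: measurable_Fint => //; exact: holo_ccont.
apply: measurableT_comp (measurable_indic _) _; first exact: measurable_itv.
apply: (@measurable_modc_comp R (fun z => z - zeta)) => z.
by apply: ccontB; [exact: ccont_id|exact: ccont_cst].
Qed.

Let Fout_ge0 u : 0 <= Fout u.
Proof. by rewrite mulr_ge0// Fint_ge0. Qed.

Let integral_Fout : (\int[mu2]_u (Fout u)%:E <= (pi / 2)%:E)%E.
Proof.
have pi0 : 0 < pi :> R by exact: pi_gt0.
have -> : (\int[mu2]_u (Fout u)%:E =
    pi%:E * Aint p w (@udisc R `\` [set z | (modc (z - zeta) < delta)%R]) K)%E.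
  rewrite /Aint muleA -EFinM mulfV ?gt_eqF// mul1e [RHS]integral_mkcond.
  apply: eq_integral => u _; rewrite patchE; set S := (@to_c R @^-1` _).
  have -> : (u \in S) = (modc (to_c u) < 1) && (delta <= modc (to_c u - zeta)).
    apply/idP/andP => [|[u1 ud]]; first by rewrite inE => -[u1 /negP]; rewrite -leNgt.
    by rewrite inE; split=> //; apply/negP; rewrite -leNgt.
  rewrite /Fout /Fint /inring modc_ge0/= indicE mem_setE in_itv/= andbT.
  by have [u1|u1] := ltP (modc (to_c u)) 1; have [d1|d1] := leP delta (modc (to_c u - zeta));
    rewrite ?mul0r ?mulr0 ?mulr1.
by rewrite EFinM; apply: lee_wpmul2l; [rewrite lee_fin ltW|exact: ltW].
Qed.

(** Of the total mass [pi] of [|K|^p] against the weight, at most half lies at distance [delta] or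
    more from [zeta]; on the rest [|K|^p <= |K H|^p / c^p]. *)
Lemma NI_concentrated_lower (B : R) : (NI s (fun z => (K z * H z)%R) <= B%:E)%E ->
  c `^ p <= 2 * B / pi.
Proof.
move=> HB; have pi0 : 0 < pi :> R by exact: pi_gt0.
have cp : 0 < c `^ p by exact: powR_gt0.
have hKH := holoM hK hH.
have mKH : measurable_fun setT (fun u => (Fint p w s (fun z => K z * H z) u)%:E : \bar R).
  by apply/measurable_EFinP; apply: measurable_Fint => //; exact: holo_ccont.
have mO : measurable_fun setT (fun u => (Fout u)%:E : \bar R) by exact/measurable_EFinP.
have le : (NI 0 K <= (c `^ p)^-1%:E * NI s (fun z => (K z * H z)%R) + \int[mu2]_u (Fout u)%:E)%E.
  rewrite !NIE -ge0_integralZl//; last 2 first.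
  - by move=> u _; rewrite lee_fin Fint_ge0.
  - by rewrite lee_fin invr_ge0 ltW.
  rewrite -ge0_integralD//; last 3 first.
  - by move=> u _; rewrite -EFinM lee_fin mulr_ge0 ?invr_ge0 ?(ltW cp)// Fint_ge0.
  - exact: emeasurable_funM.
  - by move=> u _; rewrite lee_fin.
  apply: ge0_le_integral => //.
  - by move=> u _; rewrite lee_fin Fint_ge0.
  - by apply/measurable_EFinP; apply: measurable_Fint => //; exact: holo_ccont.
  - by apply: emeasurable_funD => //; exact: emeasurable_funM.
  move=> u _; rewrite -EFinM -EFinD lee_fin /Fout indicE mem_setE in_itv/= andbT.
  have [far_u|near_u] := leP delta (modc (to_c u - zeta)).
    by rewrite mulr1 lerDr mulr_ge0 ?invr_ge0 ?(ltW cp)// Fint_ge0.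
  rewrite mulr0 addr0 /Fint /inring modc_ge0/=.
  have [u1|u1] := ltP (modc (to_c u)) 1; last by rewrite andbF mulr0.
  rewrite near_s//= mulrA; apply: ler_wpM2r; first by rewrite w0// modc_ge0.
  rewrite modcM powRM ?modc_ge0// mulrC -mulrA ler_peMr ?powR_ge0// ler_pdivlMr// mul1r.
  by apply: powR_le_mono; [exact: ltW|exact: ltW|exact: near_c].
have : (pi%:E <= (c `^ p)^-1%:E * B%:E + (pi / 2)%:E)%E.
  rewrite -NK; apply: le_trans le _; apply: leeD; last exact: integral_Fout.
  by apply: lee_wpmul2l => //; rewrite lee_fin invr_ge0 ltW.
rewrite -EFinM -EFinD lee_fin => h; rewrite ler_pdivlMr//.
have : pi / 2 <= B / c `^ p by rewrite mulrC; lra.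
by rewrite ler_pdivlMr//; lra.
Qed.

End LowerBound.

(** * Test kernels along a radius *)

Section Kernels.
Variables (rho0 : R) (K : C -> C -> C).
Hypotheses (r0 : 0 <= rho0) (r1 : rho0 < 1) (tK : test_kernels p w rho0 K).

(** For [|zeta| = 1] the moduli start at [rho0] for [n = 0] and increase to [1], so the kernels are
    available for every [n]. *)
Definition radial_seq (zeta : C) (n : nat) : C := (1 - (1 - rho0) / n.+1%:R)%:C * zeta.

Lemma modc_radial_seq zeta n : modc zeta = 1 -> modc (radial_seq zeta n) = 1 - (1 - rho0) / n.+1%:R /\
  rho0 <= 1 - (1 - rho0) / n.+1%:R < 1.
Proof.
move=> z1; have d0 : 0 < (1 - rho0) / n.+1%:R by rewrite divr_gt0// subr_gt0.
have d1 : (1 - rho0) / n.+1%:R <= 1 - rho0.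
  by rewrite ler_pdivrMr// ler_peMr ?ler1n// subr_ge0 ltW.
move: d0 d1; rewrite /radial_seq modcM z1 mulr1 modc_real; set d : R := (1 - rho0) / _ => d0 d1.
have h1 : 0 <= 1 - d by rewrite subr_ge0 (le_trans d1)// lerBlDr lerDl.
by rewrite ger0_norm// lerBrDr -lerBrDl d1 ltrBlDr ltrDl d0.
Qed.

Lemma near_radial (e : R) : 0 < e -> \forall n \near \oo, (1 - rho0) / n.+1%:R < e.
Proof.
move=> e0; have d0 : 0 < 1 - rho0 by rewrite subr_gt0.
have e1 : 0 < e / (1 - rho0) by rewrite divr_gt0.
have := near_infty_natSinv_lt (PosNum e1); apply: filterS => n /= H.
by rewrite mulrC -ltr_pdivlMr.
Qed.

Lemma kernel_analytic xi : rho0 <= modc xi < 1 -> analytic (K xi) /\ NI 0 (K xi) = pi%:E.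
Proof.
by case: tK => H _ /H[hK /Apnorm_eq1 NK]; split=> //; apply/analyticE.
Qed.

Lemma radial_kernel zeta n : modc zeta = 1 ->
  analytic (K (radial_seq zeta n)) /\ NI 0 (K (radial_seq zeta n)) = pi%:E.
Proof. by move=> z1; apply: kernel_analytic; have [-> ?] := modc_radial_seq n z1. Qed.

Lemma radial_kernel_bounded s zeta : 0 <= s -> modc zeta = 1 ->
  bounded_seq p w s (fun n => K (radial_seq zeta n)).
Proof.
move=> s0 z1; split=> [n|r e rr e0|].
- by have [] := radial_kernel n z1.
- have [_ [H _]] := tK.
  have Ed : ([set z | modc z <= r] : set C^o) `<=` @udisc R.
    by move=> z /= zr; rewrite /udisc /=; exact: le_lt_trans zr rr.
  have [r' [r'1 Hr']] := H _ (@compact_cdisc R r) Ed e e0.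
  have d0 : 0 < 1 - r' by rewrite subr_gt0.
  have := near_radial d0; apply: filterS => n nd z zr; apply/ltW.
  have [E b] := modc_radial_seq n z1; apply: Hr' => //; rewrite E//.
  by move: nd; set d : R := (1 - rho0) / _; clearbody d; lra.
- exists pi; first exact: pi_ge0.
  apply: nearW => n; have [a <-] := radial_kernel n z1.
  by apply: NI_ring_mono => //; exact: holo_ccont.
Qed.

Lemma radial_kernel_far zeta (delta : R) : modc zeta = 1 -> 0 < delta ->
  \forall n \near \oo, (Aint p w (@udisc R `\` [set z | (modc (z - zeta) < delta)%R])
    (K (radial_seq zeta n)) < 2^-1%:E)%E.
Proof.
move=> z1 d0; have [_ [_ H]] := tK.
have h0 : 0 < 2^-1 :> R by rewrite invr_gt0.
have [eta [eta0 He]] := H delta d0 zeta z1 _ h0.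
have := near_radial eta0; apply: filterS => n ne; have [E b] := modc_radial_seq n z1.
apply: He; first by rewrite E.
have -> : radial_seq zeta n - zeta = (- ((1 - rho0) / n.+1%:R))%:C * zeta.
  by rewrite /radial_seq -{2}[zeta]mul1r -mulrBl -(rmorphB _ _ (1 : R)); congr (_%:C * _); ring.
rewrite modcM z1 mulr1 modc_real normrN ger0_norm// divr_ge0// subr_ge0; exact: ltW.
Qed.

(** For each point [v = r zeta] a single kernel with large [n] suffices: the null remainder and the
    mass away from [zeta] only have to fall below fixed constants, so the bound depends on [B] and
    [p] alone. *)
Lemma symbol_bound N (P : nat -> {poly C}) Q g (B : R) : analytic g -> 0 <= B ->
  (forall f (r : R), analytic f -> (NI 0 f <= pi%:E)%E -> 0 <= r -> r < 1 ->
     (NI 0 (LL N P Q (dil r%:C g) f) <= B%:E)%E) ->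
  exists B' : R, forall z, modc z < 1 -> modc (('X * P N.+1).[g z]) <= B'.
Proof.
move=> hg B0 HB; set q := 'X * P N.+1.
have pi0 : 0 < pi :> R by exact: pi_gt0.
have m1 : rho0 <= modc (rho0%:C : C) < 1 by rewrite modc_real ger0_norm// lexx.
have [hK1 NK1] := kernel_analytic m1.
have [s [W [s0 s1 W0 HW]]] := finite_ring hK1 NK1.
(* [B1] bounds the ring integral for the kernel times [q(G)], the [1] being the allowance for the
   null remainder; [B2] is what [NI_concentrated_lower] makes of it. *)
pose B1 := 2 `^ p * (B + 1); pose B2 := 2 * B1 / pi.
have B10 : 0 <= B1 by rewrite mulr_ge0 ?powR_ge0// addr_ge0.
have B20 : 0 <= B2 by apply: divr_ge0; [exact: mulr_ge0|exact: ltW].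
exists (2 * B2 `^ p^-1) => v v1.
have [t vt] := polar v; set r := modc v in v1 vt; set zeta := expi t in vt.
have z1 : modc zeta = 1 by exact: modc_expi.
have rr0 : 0 <= r by exact: modc_ge0.
have rC1 : modc (r%:C : C) <= 1 by rewrite modc_real ger0_norm// ltW.
have [->|qv] := eqVneq (q.[g v]) 0; first by rewrite modc0 mulr_ge0// powR_ge0.
pose c := modc (q.[g v]) / 2.
have c0 : 0 < c by rewrite divr_gt0// lt_def modc_eq0 qv modc_ge0.
have -> : modc q.[g v] = 2 * c by rewrite mulrC divfK.
apply: ler_wpM2l => //.
suff cB : c `^ p <= B2.
  rewrite -[c](powRr1 (ltW c0)) -(@mulfV _ p) ?gt_eqF// powRrM.
  by apply: powR_le_mono => //; rewrite ?invr_ge0 ?powR_ge0// ltW.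
have hq := holo_horner q hg.
have [d d0 dH] := holo_ccont hq v1 c0.
(* [d] keeps [q (g (r z))] within [c] of [q (g v)], which has modulus [2 c], hence of modulus at
   least [c]; [1 - s] keeps [z] in the ring. *)
pose delta := Num.min d (1 - s).
have delta0 : 0 < delta by rewrite lt_min d0 subr_gt0.
set G := dil r%:C g; have hG := holo_dil rC1 hg : analytic G.
have rz z : modc z < 1 -> modc (r%:C * z) <= r.
  by move=> zz; rewrite modcM modc_real ger0_norm// ler_piMr// ltW.
have [M M0 HM] := ccont_bounded (fun z zr => holo_ccont hg (le_lt_trans zr v1)).
have [M' M'0 HM'] := ccont_bounded (fun z zr => holo_ccont (holo_cderiv hg) (le_lt_trans zr v1)).
have GM z : modc z < 1 -> modc (G z) <= M by move=> zz; apply: HM; exact: rz.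
have GM' z : modc z < 1 -> modc (der G z) <= M'.
  move=> zz; rewrite cderiv_dil// modcM.
  by apply: le_trans (HM' _ (rz z zz)); rewrite ler_piMl ?modc_ge0.
have bs := radial_kernel_bounded s0 z1.
have ns := ns_LL_sub p0 w0 mw W0 HW hG GM GM' N P Q bs.
have [n [n1 n2]] := filter_ex (filterI (ns_null ns ltr01) (radial_kernel_far z1 delta0)).
set Kn := K (radial_seq zeta n) in n1 n2.
have [hKn NKn] := radial_kernel n z1.
have hqG := holo_horner q hG.
have hL := adm_holo (adm_LL N P Q p0) hG hKn.
apply: (@NI_concentrated_lower Kn (fun z => q.[G z]) s delta c zeta) => //.
- move=> z zz zd; have := modcBB zeta (zeta - z); rewrite z1 (_ : zeta - (zeta - z) = z); last by ring.
  rewrite modc_dist; have : delta <= 1 - s by rewrite ge_min lexx orbT.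
  by move=> h1 h2; lra.
- move=> z zz zd.
  have dd : modc (r%:C * z - v) < d.
    rewrite vt -mulrBr; apply: (@le_lt_trans _ _ (modc (z - zeta))).
      by rewrite modcM ler_piMl ?modc_ge0.
    by apply: lt_le_trans zd _; rewrite ge_min lexx.
  have := dH _ dd; rewrite /G /dil => h1.
  have := modcBB q.[g v] (q.[g v] - q.[g (r%:C * z)]); rewrite (_ : forall a b : R[i], a - (a - b) = b); last by move=> a b; ring.
  rewrite modc_dist.
  have : modc q.[g v] = 2 * c by rewrite mulrC divfK.
  by move=> h2 h3; lra.
- have E : eqD (fun z => Kn z * q.[G z])
     (fun z => LL N P Q G Kn z + -1 * (LL N P Q G Kn z - Kn z * q.[G z])) by move=> z _; ring.
  rewrite (NI_eqD p w s E); have hd := ns_an ns n.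
  apply: (NI_add_le p0 w0 mw hL (holoZ (-1) hd)).
    apply: le_trans (HB Kn r hKn _ rr0 v1); last by rewrite NKn.
    by apply: NI_ring_mono => //; exact: holo_ccont.
  by rewrite NI_scale//; [rewrite modcN modc1 powR1 mul1e|exact: holo_ccont].
Qed.

End Kernels.

End Necessity.

Theorem theorem6p1 (R : realType) (w : R -> R) (p : R) :
  radial_weight w -> 0 < p ->
  (exists rho0 : R, 0 <= rho0 < 1 /\
     exists K : R[i] -> R[i] -> R[i], test_kernels p w rho0 K) ->
  forall (g : R[i] -> R[i]) (N : nat) (P : nat -> {poly R[i]})
         (Q : {poly {poly R[i]}}),
  holo g -> P N.+1 != 0 ->
  (bounded_on_Ap p w (gop g N P Q) <-> Hinf g).
Proof.
move=> [w0 [iw _]] p0 [rho0 [/andP[r0 r1] [K tK]]] g N P Q hg PN.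
have mw : measurable_fun (`[0, 1[%classic : set (measurableTypeR R)) (w : measurableTypeR R -> measurableTypeR R).
  by apply/measurable_EFinP; exact: measurable_int iw.
have {}hg : analytic g by apply/analyticE.
have pi0 : 0 < pi :> R by exact: pi_gt0.
have aL := adm_LL N P Q p0.
have gopE f : gop g N P Q f = LL N P Q g f by apply/funext => z; rewrite LLE.
split=> [[M HM]|[_ [M gM]]].
  split; first exact/analyticE.
  (* The kernel at the real point [rho0] provides one function of norm [1]. *)
  have m1 : rho0 <= modc (rho0%:C : R[i]) < 1 by rewrite modc_real ger0_norm// lexx.
  have [hK1 NK1] := kernel_analytic p0 w0 tK m1.
  have B0 : 0 <= pi * M `^ p by rewrite mulr_ge0 ?powR_ge0// ltW.
  have HB f : analytic f -> NI p w 0 f = pi%:E -> (NI p w 0 (LL N P Q g f) <= (pi * M `^ p)%:E)%E.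
    move=> hf Nf; rewrite -gopE; apply: Apnorm_le => //.
    by apply: HM; [exact/analyticE|exact/Apnorm_eq1].
  (* Dilations lower the norm, so the bound has to hold on the whole ball and not only on the unit
     sphere. *)
  have [B B1 HB1] := bounded_on_ball p0 w0 mw aL hg B0 hK1 NK1 HB.
  have HB2 f (r : R) : analytic f -> (NI p w 0 f <= pi%:E)%E -> 0 <= r -> r < 1 ->
     (NI p w 0 (LL N P Q (dil r%:C g) f) <= B%:E)%E.
    by move=> hf Nf rr0 rr1; exact: (bounded_dilation p0 w0 mw aL hg HB1 hf Nf rr0 rr1).
  have [B' HB'] := symbol_bound p0 w0 mw r0 r1 tK hg B1 HB2.
  have [A HA] := poly_bounded_arg B' PN.
  by exists A => z z1; apply: HA; exact: HB'.
have [c c0 Hc] := NI_circle_bounded p0 w0 mw (adm_bnd aL hg gM).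
exists (c `^ p^-1) => f /analyticE hf /(Apnorm_eq1 p0 w0) Nf.
rewrite gopE; apply: NI_le_Apnorm => //.
by have := Hc 0 f hf; rewrite Nf -EFinM mulrC.
Qed.
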